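(* There is a deterministic algorithm in the synchronous multi-port message-passing model with crash failures that, for all $n$ and $t$ with $t<\frac n5$, solves the $\frac35$-almost-everywhere-agreement problem in $\mathcal{O}(t)$ rounds while sending $\mathcal{O}(n)$ messages in total, each message carrying one bit.
   Context: Model: $n$ nodes with distinct names in $\{1,\dots,n\}$; $n$ and an upper bound $t$ on the number of crashes are known to all nodes. Computation proceeds in synchronous rounds starting simultaneously; in a round any node may send messages to any set of other nodes (multi-port), and all messages sent in a round are delivered in that round. An adversary may crash up to $t$ nodes at times of its choosing; a crashed node performs no further activity. A node that halts without crashing is non-faulty. Running time is the number of rounds until all non-faulty nodes have halted; communication is the total number of messages sent. The $\kappa$-almost-everywhere-agreement problem ($\frac12<\kappa<1$): each node starts with an input bit in $\{0,1\}$; every node eventually halts unless it crashes; at least $\kappa n$ nodes eventually either decide (irrevocably set an output value) or crash; no two nodes decide on different values; any decided value is the input value of some node. *)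

(* Defs.v *)
From mathcomp Require Import all_boot all_order all_algebra.

Set Implicit Arguments.
Unset Strict Implicit.
Unset Printing Implicit Defensive.

Import GRing.Theory Num.Theory.

(* A deterministic synchronous multi-port algorithm for n nodes, the node named
   k in {1, .., n} being the ordinal k - 1.  A message is a single bit; [None]
   stands for "no message".  The local state and the local computation are
   arbitrary, as is usual in this model. *)
Record algorithm (n : nat) := Algorithm {
  state : Type;
  init : 'I_n -> bool -> state;
  send : state -> 'I_n -> option bool;
  recv : state -> {ffun 'I_n -> option bool} -> state;
  output : state -> option bool;
  halted : state -> bool
}.

(* Round r (r = 0, 1, ..) leads from configuration r to configuration r.+1.
   A node i with [crash_time i = Some c] acts normally in the rounds before c.
   In round c only its messages addressed to [last_dest i] leave, which covers
   a crash in the middle of sending; it then neither receives nor computes, in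
   round c or later.  As algorithms are deterministic, quantifying over all
   such schedules also covers adversaries that adapt to the execution. *)
Record adversary (n : nat) := Adversary {
  crash_time : 'I_n -> option nat;
  last_dest : 'I_n -> {set 'I_n}
}.

Definition crash_set (n : nat) (adv : adversary n) : {set 'I_n} :=
  [set i | isSome (crash_time adv i)].

Section Execution.

Variables (n : nat) (A : algorithm n) (adv : adversary n) (x : 'I_n -> bool).

Definition message (s : 'I_n -> state A) (r : nat) (i j : 'I_n) : option bool :=
  let m := if halted (s i) || (i == j) then None else send (s i) j in
  if crash_time adv i is Some c then
    if r < c then m
    else if (r == c) && (j \in last_dest adv i) then m else None
  else m.

Definition crashed_by (r : nat) (i : 'I_n) : bool :=
  if crash_time adv i is Some c then c <= r else false.

Fixpoint config (r : nat) : 'I_n -> state A :=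
  if r is r'.+1 then
    let s := config r' in
    fun i => if halted (s i) || crashed_by r' i then s i
             else recv (s i) [ffun j => message s r' j i]
  else fun i => init A i (x i).

(* A crash scheduled after a node has halted is void: that node is non-faulty. *)
Definition faulty (i : 'I_n) : bool :=
  if crash_time adv i is Some c then ~~ halted (config c i) else false.

Definition decides (i : 'I_n) (v : bool) : Prop :=
  exists r, output (config r i) = Some v.

Definition all_halted (r : nat) : Prop :=
  forall i, ~~ faulty i -> halted (config r i).

Definition messages_in_round (r : nat) : nat :=
  #|[set p : 'I_n * 'I_n | isSome (message (config r) r p.1 p.2)]|.

Definition messages_before (T : nat) : nat :=
  \sum_(r < T) messages_in_round r.

(* Meant for 1/2 < kappa < 1.  Agreement and validity also bind the nodes that
   crash after deciding. *)
Record ae_agreement (kappa : rat) : Prop := AEAgreement {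
  aea_termination : forall i, ~~ faulty i -> exists r, halted (config r i);
  aea_irrevocability : forall i r v,
    output (config r i) = Some v -> output (config r.+1 i) = Some v;
  aea_coverage : exists S : {set 'I_n},
    (kappa * n%:R <= #|S|%:R :> rat)%R /\
    (forall i, i \in S -> faulty i \/ exists v, decides i v);
  aea_agreement : forall i j v w, decides i v -> decides j w -> v = w;
  aea_validity : forall i v, decides i v -> exists j, x j = v
}.

End Execution.

Definition solves_aea (kappa : rat) (n t : nat) (A : algorithm n) : Prop :=
  forall (adv : adversary n) (x : 'I_n -> bool),
    #|crash_set adv| <= t -> ae_agreement A adv x kappa.

Definition runs_within (n t : nat) (A : algorithm n) (T : nat) : Prop :=
  forall (adv : adversary n) (x : 'I_n -> bool),
    #|crash_set adv| <= t ->
    exists2 r, r <= T & all_halted A adv x r.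

(* Bounding every finite prefix of the execution bounds the total. *)
Definition sends_at_most (n t : nat) (A : algorithm n) (M : nat) : Prop :=
  forall (adv : adversary n) (x : 'I_n -> bool),
    #|crash_set adv| <= t ->
    forall T, messages_before A adv x T <= M.

(* Main.v *)
(* If t is below an absolute constant, a rotating coordinator suffices: one of t + 1
   coordinators does not crash, and from its round on all nodes agree.

   For larger t, let m <= 5t + 1 "little" nodes agree among themselves and tell the
   others in one last round.  First the bit 1 floods for m rounds along a graph of
   bounded degree in which any two sets of m/a nodes are linked.  Removing from the
   surviving nodes a largest set that does not expand leaves a core of more than 3m/4
   nodes that all hold the same bit v, while fewer than m/a nodes hold the other one.

   Then a tree of runs of depth L and branching 16 is executed depth first.  A run of
   depth k has q 2^(L-k) virtual nodes hosted by random little nodes.  The holders of a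
   certificate in its parent send the certified bit along a random graph of constant
   degree, and enough equal votes give a certificate in the run.  A small set of senders
   produces a D times smaller set of holders; a constant fraction of senders ("full")
   produces almost all.  Hence at the leaves no certificate for the bit other than v is
   left, and whatever a leaf certifies is final.  After every leaf, final values flood
   along the first graph for O(log m) rounds, and a node that has one stays silent.
   So once some leaf has informed the core, only the fewer than m/a nodes not adjacent
   to the core can speak.

   The number of messages is the total number of senders, weighted over the tree.  Where
   the senders are few it decays geometrically down the tree.  For the other, "big", runs:
   random hosting makes the total size of the runs damaged by crashed or isolated nodes
   O(m); a big run after the first success has a damaged parent; a full run that ended
   before it lies above a damaged run on every path; and at most one child of a run is
   big without being full before the first success, since the thresholds of siblings
   increase by a factor kappa^2 and a later sibling has no new senders.  The time is
   dominated by 16^L (L + O(log m)), which is O(m) since D^(L-1) < 5t + 1, D >= 32. *)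

Require Import Defs.
From mathcomp Require Import all_boot all_order all_algebra.
From Stdlib Require Import IndefiniteDescription.
From mathcomp Require Import ring lra zify.

Set Implicit Arguments.
Unset Strict Implicit.
Unset Printing Implicit Defensive.

Import Order.TTheory GRing.Theory Num.Theory.

(** * Averages and the probabilistic method *)

Section Averages.

Local Open Scope ring_scope.

Lemma expn_1D_le4 (u : rat) (N M : nat) :
  0 <= u -> N%:R * u <= M%:R -> (1 + u) ^+ N <= 4%:R ^+ M.
Proof.
(* AM-GM for N copies of 1 + u and 2M copies of 1/2, whose mean is at most 1. *)
move=> u0 NuM.
pose E (i : 'I_(N + M.*2)) : rat := if (i < N)%N then 1 + u else 2%:R^-1.
have E0 : {in 'I_(N + M.*2), forall i, 0 <= E i}.
  by move=> i _; rewrite /E; case: ifP => _; lra.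
have := leif_le (leif_AGM E0).
have EN (i : 'I_N) : E (lshift _ i) = 1 + u by rewrite /E /= ltn_ord.
have EM (i : 'I_M.*2) : E (rshift _ i) = 2%:R^-1 by rewrite /E /= ltnNge leq_addr.
rewrite !big_split_ord /= card_ord.
under eq_bigr do rewrite EN; under [X in _ * X]eq_bigr do rewrite EM.
under [X in (X + _) / _]eq_bigr do rewrite EN; under [X in (_ + X) / _]eq_bigr do rewrite EM.
rewrite !prodr_const !sumr_const !card_ord -!mul2n exprM.
rewrite -[(1 + u) *+ N]mulr_natl -[2%:R^-1 *+ _]mulr_natl.
set mu := (_ / _) => le1.
have mu1 : mu ^+ (N + 2 * M) <= 1.
  have [->|NM0] := posnP (N + 2 * M)%N; first by rewrite expr0.
  apply: exprn_ile1.
    by rewrite /mu divr_ge0 ?ler0n // addr_ge0 ?mulr_ge0 ?ler0n //; lra.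
  rewrite /mu ler_pdivrMr ?ltr0n // mul1r natrD natrM; move: NuM; lra.
move: (le_trans le1 mu1) => le.
have e : (2%:R^-1 ^+ 2) ^+ M * 4%:R ^+ M = 1 :> rat.
  by rewrite -exprMn (_ : _ * _ = 1) ?expr1n.
rewrite -[leLHS]mulr1 -{2}e mulrA -[leRHS]mul1r.
by apply: ler_wpM2r; rewrite ?exprn_ge0.
Qed.

Lemma sum_set_expn (I : finType) (a : rat) :
  \sum_(J : {set I}) a ^+ #|J| = (1 + a) ^+ #|I|.
Proof.
transitivity (\prod_(i : I) (a + 1)); last by rewrite prodr_const addrC.
rewrite bigA_distr; apply: eq_bigr => J _.
by rewrite -big_mkcond /= prodr_const.
Qed.

(** The values of a uniformly random [f] are independent: summing over [f] turns the product into
    one factor [\sum_j w j] for each point of [S] and one factor [#|J|] for each other point. *)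
Lemma sum_ffun_prod (I J : finType) (S : {set I}) (w : J -> rat) (c : rat) :
  \sum_j w j <= c * #|J|%:R -> (forall j, 0 <= w j) ->
  \sum_(f : {ffun I -> J}) \prod_(i in S) w (f i)
    <= c ^+ #|S| * #|{ffun I -> J}|%:R.
Proof.
move=> wc w0.
pose F i j := if i \in S then w j else 1.
under eq_bigr => f _ do rewrite (big_mkcond (mem S)) /= -/(F _ _).
rewrite (eq_bigr (fun f : {ffun I -> J} => \prod_i F i (f i))) //.
rewrite -bigA_distr_bigA /= card_ffun natrX.
rewrite (bigID (mem S)) /= (eq_bigr (fun=> \sum_j w j)); last first.
  by move=> i iS; apply: eq_bigr => j _; rewrite /F iS.
rewrite prodr_const [X in _ * X](eq_bigr (fun=> #|J|%:R)); last first.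
  move=> i /negbTE iS; rewrite (eq_bigr (fun=> 1)); last by move=> j _; rewrite /F iS.
  by rewrite sumr_const.
have -> : \prod_(i | i \notin S) (#|J|%:R : rat) = #|J|%:R ^+ #|~: S|.
  rewrite -(prodr_const (mem (~: S))); apply: eq_bigl => i; by rewrite !inE.
rewrite -[in #|I|](cardsC S) exprD mulrA -exprMn.
apply: ler_wpM2r; first by rewrite exprn_ge0.
by apply: lerXn2r; rewrite ?nnegrE ?sumr_ge0 ?(le_trans _ wc) ?sumr_ge0.
Qed.

(** First moment method: [F] will add up nonnegative weights that reach 1 when a requirement is
    violated, so a mean below 1 gives a point meeting all requirements. *)
Lemma exists_small (T : finType) (F : T -> rat) :
  \sum_t F t < #|T|%:R -> exists t, F t < 1.
Proof.
move=> lt; apply/existsP; apply: contraTT lt; rewrite negb_exists => /forallP H.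
rewrite -leNgt -sumr_const; apply: ler_sum => t _; by rewrite leNgt.
Qed.

End Averages.

Lemma sum_bool_card (T : finType) (P : pred T) :
  \sum_(i : T) (P i : nat) = #|[set i | P i]|.
Proof. by rewrite -sum1dep_card [RHS]big_mkcond; apply: eq_bigr => i _; case: (P i). Qed.

(** * Random graphs of bounded degree that link any two large sets *)

Section Graphs.

Local Open Scope ring_scope.

Lemma bernoulli (x : rat) n : 0 <= x -> 1 + n%:R * x <= (1 + x) ^+ n.
Proof.
move=> x0; elim: n => [|n IH]; first by rewrite mul0r addr0 expr0.
rewrite exprS -natr1; have x2 : 0 <= n%:R * x * x by rewrite !mulr_ge0.
have : (1 + x) * (1 + n%:R * x) <= (1 + x) * (1 + x) ^+ n.
  by apply: ler_wpM2l => //; lra.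
by apply: le_trans; move: x2; lra.
Qed.

(** Multiply by (1 + 1/a)^a, which is at least 2 by Bernoulli: the product (1 - 1/a^2)^a is at most
    1. *)
Lemma expn_1B_le2 (a : nat) : (0 < a)%N -> (1 - a%:R^-1 : rat) ^+ a <= 2%:R^-1.
Proof.
move=> a0; set u : rat := a%:R^-1.
have au : a%:R * u = 1 by rewrite mulfV // pnatr_eq0 -lt0n.
have u0 : 0 < u by rewrite invr_gt0 ltr0n.
have u1 : u <= 1 by rewrite invf_le1 ?ler1n // ltr0n.
have b := bernoulli a (ltW u0); rewrite au in b.
have p : (1 - u) ^+ a * (1 + u) ^+ a <= 1.
  rewrite -exprMn; apply: exprn_ile1; last by move: (sqr_ge0 u); rewrite expr2; lra.
  by apply: mulr_ge0; lra.
have c0 : 0 <= (1 - u) ^+ a by apply: exprn_ge0; lra.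
have : (1 - u) ^+ a * (1 + 1) <= 1 by apply: le_trans p; apply: ler_wpM2l.
lra.
Qed.

Lemma sum_pred_cond (T : finType) (P : pred T) (w : rat) (c : nat) :
  0 <= w -> (#|P| <= c)%N -> \sum_(t | P t) w <= c%:R * w.
Proof. by move=> w0 Pc; rewrite sumr_const -[w *+ _]mulr_natl ler_wpM2r // ler_nat. Qed.

(* The probabilistic method, with each pair (A, B) violating the conclusion with
   probability at most 8^-m. *)
Lemma joining_graph (a m : nat) : (0 < a)%N -> (0 < m)%N ->
  exists f : {ffun 'I_m * 'I_(3 * a ^ 2) -> 'I_m},
    forall A B : {set 'I_m}, (m <= a * #|A|)%N -> (m <= a * #|B|)%N ->
      exists x i, x \in A /\ f (x, i) \in B.
Proof.
move=> a0 m0; set d := (3 * a ^ 2)%N.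
pose big (P : {set 'I_m} * {set 'I_m}) := (m <= a * #|P.1|)%N && (m <= a * #|P.2|)%N.
pose F (f : {ffun 'I_m * 'I_d -> 'I_m}) : rat :=
  \sum_(P | big P) \prod_(p in setX P.1 [set: 'I_d]) (f p \notin P.2)%:R.
have [] := @exists_small _ F.
  rewrite exchange_big /=.
  apply: (@le_lt_trans _ _ (\sum_(P | big P) (8%:R^-1) ^+ m * #|{ffun 'I_m * 'I_d -> 'I_m}|%:R)).
    apply: ler_sum => -[A B] /andP[/= bA bB].
    pose c : rat := 1 - a%:R^-1.
    have c0 : 0 <= c by rewrite subr_ge0 invf_le1 ?ler1n // ltr0n.
    have c1 : c <= 1 by rewrite lerBlDr lerDl invr_ge0 ler0n.
    have := @sum_ffun_prod ('I_m * 'I_d)%type 'I_m (setX A setT)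
      (fun j => (j \notin B)%:R) c.
    move=> H; apply: (le_trans (H _ _)) => [|j|]; last first.
    - apply: ler_wpM2r; first exact: ler0n.
      rewrite cardsX cardsT card_ord.
      (* At least 3am independent links leave A, since [m <= a * #|A|], and each misses B with
         probability at most 1 - 1/a. *)
      apply: (@le_trans _ _ (c ^+ (a * (3 * m)))).
        apply: ler_wiXn2l => //.
        apply: (@leq_trans (a * (3 * (a * #|A|)))); first by rewrite !leq_mul2l bA !orbT.
        by rewrite /d expnS expn1 leq_eqVlt; apply/orP; left; apply/eqP; ring.
      rewrite exprM.
      apply: (@le_trans _ _ (2%:R^-1 ^+ (3 * m))).
        by apply: lerXn2r; rewrite ?nnegrE ?exprn_ge0 ?expn_1B_le2.
      by rewrite exprM le_eqVlt; apply/orP; left; apply/eqP; congr (_ ^+ _).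
    - by rewrite ler0n.
    rewrite -natr_sum sum_bool_card /=.
    have -> : [set x | x \notin B] = ~: B by apply/setP=> x; rewrite !inE.
    have -> : #|~: B| = (m - #|B|)%N by move: (cardsC B); rewrite card_ord; lia.
    rewrite card_ord natrB; last by rewrite -[X in (_ <= X)%N](card_ord m) max_card.
    rewrite mulrBl mul1r lerD2l lerN2 ler_pdivrMl ?ltr0n //.
    by rewrite -natrM ler_nat.
  (* At most 4^m pairs occur, each with probability at most 8^-m. *)
  apply: (le_lt_trans (sum_pred_cond (c := (2 ^ m * 2 ^ m)%N) _ _)).
  - by rewrite mulr_ge0 ?exprn_ge0 ?invr_ge0 ?ler0n.
  - apply: leq_trans (max_card _) _.
    by rewrite card_prod -!cardsT -powersetT card_powerset cardsT card_ord.
  rewrite mulrA gtr_pMl; last by rewrite ltr0n card_ffun card_ord expn_gt0 m0.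
  rewrite natrM !natrX -!exprMn.
  have : 0 <= 2%:R * 2%:R * 8%:R^-1 :> rat by lra.
  have : 2%:R * 2%:R * 8%:R^-1 < 1 :> rat by lra.
  by move: (_ * 8%:R^-1) => x x1 x0; rewrite exprn_ilt1 -?lt0n.
move=> f Ff; exists f => A B bA bB.
have [/existsP[x /existsP[i /andP[xA fB]]]|none] :=
  boolP [exists x, exists i, (x \in A) && (f (x, i) \in B)]; first by exists x, i.
move: Ff; rewrite ltNge => /negP[]; rewrite /F.
rewrite (bigD1 (A, B)) /=; last by rewrite /big bA.
rewrite [X in X + _]big1 ?lerDl ?sumr_ge0 // => [P _|[x i]].
  by apply: prodr_ge0 => p _; rewrite ler0n.
rewrite !inE andbT => xA; case: (boolP (_ \in _)) => // fB.
by case/negP: none; apply/existsP; exists x; apply/existsP; exists i; rewrite xA.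
Qed.

End Graphs.

(** * Samplers *)

Section Samplers.

Local Open Scope ring_scope.

(** Weight each set X by (x/s)^|X|: the total (1 + x/s)^s is at most 4^x, while every set of size x
    weighs (x/s)^x. *)
Lemma count_sets_le (s x : nat) : (0 < x)%N -> (x <= s)%N ->
  #|[set X : {set 'I_s} | #|X| == x]|%:R
    <= (s%:R / x%:R) ^+ x * 4%:R ^+ x :> rat.
Proof.
move=> x0 xs; have xr : 0 < x%:R :> rat by rewrite ltr0n.
have sr : 0 < s%:R :> rat by rewrite ltr0n (leq_trans x0).
pose g : rat := s%:R / x%:R.
have g0 : 0 < g by rewrite divr_gt0.
have := sum_set_expn 'I_s g^-1; rewrite card_ord => sum.
apply: (@le_trans _ _ (g ^+ x * (1 + g^-1) ^+ s)); last first.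
  apply: ler_wpM2l; first by rewrite exprn_ge0 ?ltW.
  apply: expn_1D_le4; first by rewrite invr_ge0 ltW.
  by rewrite /g invf_div mulrCA mulfV ?mulr1 ?lt0r_neq0.
rewrite -sum -sum1dep_card natr_sum mulr_sumr [leRHS](bigID (fun X : {set 'I_s} => #|X| == x)) /=.
rewrite -[leLHS]addr0; apply: lerD; last first.
  by apply: sumr_ge0 => X _; rewrite mulr_ge0 ?exprn_ge0 ?invr_ge0 ?ltW.
by apply: ler_sum => X /eqP->; rewrite -exprMn mulfV ?expr1n ?lt0r_neq0.
Qed.

Lemma sum_by_card (s : nat) (tau : nat -> rat) : (forall x, 0 <= tau x) ->
  \sum_(X : {set 'I_s} | (0 < #|X|)%N) tau #|X|
    <= \sum_(x < s) (s%:R / x.+1%:R) ^+ x.+1 * 4%:R ^+ x.+1 * tau x.+1.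
Proof.
move=> tau0; case: s => [|s].
  rewrite big_ord0 big1 // => X; have := max_card (mem X).
  by rewrite card_ord leqn0 => /eqP->.
have inK (X : {set 'I_s.+1}) : (0 < #|X|)%N -> (inord #|X|.-1 : 'I_s.+1) = #|X|.-1 :> nat.
  by move=> X0; rewrite inordK // prednK // -[X in (_ <= X)%N](card_ord s.+1) max_card.
rewrite (partition_big (fun X : {set 'I_s.+1} => inord #|X|.-1 : 'I_s.+1) predT) //=.
apply: ler_sum => x _.
apply: (@le_trans _ _ (#|[set X : {set 'I_s.+1} | #|X| == x.+1]|%:R * tau x.+1)).
  rewrite mulr_natl -sumr_const le_eqVlt; apply/orP; left; apply/eqP.
  apply: eq_big => [X|X /andP[X0 /eqP Xx]].
    rewrite inE; apply/andP/eqP => [[X0 /eqP Xx]|Xx].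
      by rewrite -Xx inK // prednK.
    by split; [rewrite Xx | apply/eqP/val_inj/(etrans (inK _ _)); rewrite Xx].
  by rewrite -Xx inK // prednK.
by apply: ler_wpM2r => //; apply: count_sets_le.
Qed.

Lemma sum_geom8 (n : nat) : \sum_(x < n) (8%:R^-1 : rat) ^+ x.+1 <= 7%:R^-1.
Proof.
suff : \sum_(x < n) (8%:R^-1 : rat) ^+ x.+1 <= 7%:R^-1 - 7%:R^-1 * 8%:R^-1 ^+ n.
  by move=> /le_trans; apply; rewrite lerBlDr lerDl mulr_ge0 ?exprn_ge0 ?invr_ge0.
elim: n => [|n IH]; first by rewrite big_ord0 expr0 mulr1 subrr.
by rewrite big_ord_recr /= exprS; move: IH; lra.
Qed.

(** The same counting with the weight z^-|W|, which is at least z^-k on the sets in question. *)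
Lemma count_small_sets (n k x : nat) (z : rat) : 1 <= z -> n%:R <= x%:R * z ->
  #|[set W : {set 'I_n} | (#|W| <= k)%N]|%:R <= z ^+ k * 4%:R ^+ x.
Proof.
move=> z1 nz; have z0 : 0 < z by apply: lt_le_trans z1.
have := sum_set_expn 'I_n z^-1; rewrite card_ord => sum.
apply: (@le_trans _ _ (z ^+ k * (1 + z^-1) ^+ n)); last first.
  apply: ler_wpM2l; first by rewrite exprn_ge0 ?ltW.
  apply: expn_1D_le4; first by rewrite invr_ge0 ltW.
  by rewrite ler_pdivrMr.
rewrite -sum -sum1dep_card natr_sum mulr_sumr [leRHS](bigID (fun X : {set 'I_n} => (#|X| <= k)%N)) /=.
rewrite -[leLHS]addr0; apply: lerD; last first.
  by apply: sumr_ge0 => X _; rewrite mulr_ge0 ?exprn_ge0 ?invr_ge0 ?ltW.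
apply: ler_sum => X Xk; rewrite -(subnK Xk) exprD -mulrA -exprMn mulfV ?lt0r_neq0 //.
by rewrite expr1n mulr1 exprn_ege1.
Qed.

Lemma prod_if_expn (T : finType) (S : {set T}) (P : pred T) (a : rat) :
  \prod_(p in S) (if P p then a else 1) = a ^+ #|[set p in S | P p]|.
Proof.
rewrite -big_mkcondr /= -prodr_const; apply: eq_bigl => p; by rewrite inE.
Qed.

Definition fdeg (s s' d : nat) (f : {ffun 'I_s * 'I_d -> 'I_s'}) (W : {set 'I_s}) (x : 'I_s') :=
  #|[set p | (p.1 \in W) && (f p == x)]|.

Lemma sum_fdeg (s s' d : nat) (f : {ffun 'I_s * 'I_d -> 'I_s'}) (W : {set 'I_s}) (X : {set 'I_s'}) :
  (\sum_(x in X) fdeg f W x)%N = #|[set p in setX W [set: 'I_d] | f p \in X]|.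
Proof.
rewrite -sum1_card (partition_big f (mem X)) /=; last by move=> p; rewrite inE => /andP[].
apply: eq_bigr => x xX; rewrite /fdeg -sum1_card; apply: eq_bigl => -[y i].
rewrite !inE /= andbT -andbA; case: eqP => [->|]; by rewrite ?xX ?andbF.
Qed.

(** [g0] is the value of [g] at which the two terms of the maximum [lam] agree. Each of D + 1
    factors [4 / lam] is paired with a factor [2 * g]; the product is at most [2 * g0], by
    [k <= lam] if [g <= g0] and by [g <= lam * cd] otherwise. The other [r] factors are at most
    1/2. *)
Lemma shrink_rat (g g0 k cd : rat) (D r : nat) :
  8%:R <= k -> 0 < cd -> g0 = cd * k -> 1 <= g0 -> 1 <= g ->
  g * (2%:R * g) ^+ D * (4%:R / Num.max k (g / cd)) ^+ (D.+1 + r)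
    <= (2%:R * g0) ^+ D.+1 * 2%:R^-1 ^+ r.
Proof.
move=> k128 cd0 g0E g01 g1; set lam := Num.max _ _.
have kl : k <= lam by rewrite le_max lexx.
have gl : g / cd <= lam by rewrite le_max lexx orbT.
clearbody lam; rewrite (ler_pdivrMr _ _ cd0) in gl.
have lam0 : 0 < lam by lra.
have q0 : 0 <= 4%:R / lam by apply: divr_ge0; [exact: ler0n | exact: ltW].
have q2 : 4%:R / lam <= 2%:R^-1 by rewrite (ler_pdivrMr _ _ lam0); lra.
have q1 : 2%:R * g * (4%:R / lam) <= 2%:R * g0.
  rewrite mulrA (ler_pdivrMr _ _ lam0).
  have [gg|gg] := leP g g0.
    apply: (@le_trans _ _ (g0 * lam)); last by have := mulr_gt0 (lt_le_trans ltr01 g01) lam0; lra.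
    have : g * k <= g0 * lam by apply: ler_pM; lra.
    have : g * 8%:R <= g * k by apply: ler_wpM2l; lra.
    by lra.
  have : g * k <= lam * cd * k by apply: ler_wpM2r; lra.
  have : g * 8%:R <= g * k by apply: ler_wpM2l; lra.
  have := mulr_gt0 (lt_le_trans ltr01 g01) lam0.
  rewrite -(mulrA lam) -g0E; lra.
have g20 : 0 <= 2%:R * g by lra.
have gp : 0 <= (2%:R * g) ^+ D by exact: exprn_ge0.
apply: (@le_trans _ _ ((2%:R * g) ^+ D.+1 * (4%:R / lam) ^+ (D.+1 + r))).
  apply: ler_wpM2r; first exact: exprn_ge0.
  by rewrite exprS; apply: ler_wpM2r; [exact: gp | lra].
rewrite exprD mulrA -exprMn; apply: ler_pM.
- by apply: exprn_ge0; exact: mulr_ge0.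
- exact: exprn_ge0.
- by apply: lerXn2r; rewrite ?nnegrE; [exact: mulr_ge0 | lra | ].
- by apply: lerXn2r; rewrite ?nnegrE; lra.
Qed.

Lemma shrink_numeric (kappa D c h : nat) (g : rat) :
  (128 <= kappa)%N -> (0 < D)%N -> (0 < c)%N ->
  (D + 8 + (2 * (c * D * kappa)) * D.+1 <= h)%N -> 1 <= g ->
  16%:R * (g * (2%:R * g) ^+ D * (4%:R / Num.max kappa%:R (g / (c * D)%:R)) ^+ h)
    <= 8%:R^-1.
Proof.
move=> k128 D0 c0 hh g1; set X := (2 * _ * _)%N in hh.
(* Besides the D + 1 paired factors, [h] provides X halvings that cancel (2cD kappa)^(D+1) <= 2^X,
   and 7 more because 16 * 8 = 2^7. *)
have hr : h = (D.+1 + (X + 7 + (h - D.+1 - X - 7)))%N by lia.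
set Y := (h - _ - _ - _)%N in hr.
have p2 : (2%:R * (c * D * kappa)%:R) ^+ D.+1 <= 2%:R ^+ X :> rat.
  rewrite /X exprM; apply: lerXn2r; rewrite ?nnegrE; [by rewrite mulr_ge0 ?ler0n|by rewrite exprn_ge0|].
  by rewrite -natrM -natrX ler_nat ltnW // ltn_expl.
have := @shrink_rat g (c * D * kappa)%:R kappa%:R (c * D)%:R D (X + 7 + Y).
rewrite -hr => /(_ _ _ (natrM _ _ _) _ g1) /=.
move: (g * _ * _) => a key.
have {key} : a <= (2%:R * (c * D * kappa)%:R) ^+ D.+1 * 2%:R^-1 ^+ (X + 7 + Y).
  by apply: key; rewrite ?ler_nat ?ltr0n ?ler1n ?muln_gt0 ?c0 ?D0 ?(leq_trans _ k128).
move: p2; move: (_ ^+ D.+1) => b p2 ab.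
have e : 2%:R ^+ X * 2%:R^-1 ^+ X = 1 :> rat by rewrite -exprMn mulfV ?expr1n.
have y1 : (2%:R^-1 : rat) ^+ Y <= 1 by apply: exprn_ile1; lra.
have y0 : 0 <= (2%:R^-1 : rat) ^+ Y by apply: exprn_ge0; lra.
have x0 : 0 <= (2%:R^-1 : rat) ^+ X by apply: exprn_ge0; lra.
rewrite !exprD in ab.
have := ler_wpM2r x0 p2; rewrite e.
have e7 : (2%:R^-1 : rat) ^+ 7 = 128%:R^-1 by rewrite exprVn -natrX.
move: ab x0 y0 y1; rewrite e7.
move: (_ ^+ X) (_ ^+ Y) => u y ab u0 y0 y1 bu.
have : b * u * y <= 1 * y by apply: ler_wpM2r.
lra.
Qed.

End Samplers.

Section SamplerExists.

Local Open Scope ring_scope.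

Variables (kappa D c h d s : nat).
Hypothesis k128 : (128 <= kappa)%N.
Hypothesis D0 : (0 < D)%N.
Hypothesis c0 : (0 < c)%N.
Hypothesis hbig : (D + 8 + (2 * (c * D * kappa)) * D.+1 <= h)%N.
Hypothesis dch : (d <= c * h)%N.
Hypothesis s0 : (0 < s)%N.

Notation s2 := (s.*2).
Notation T := {ffun 'I_s2 * 'I_d -> 'I_s}.

(** On the pairs of [over_cond] below, the number |W| d of links is at most hs/kappa and at most
    cDh|X|; the smaller of these bounds is hs / lam |X|. *)
Let lam (x : nat) : rat := Num.max kappa%:R ((s%:R / x%:R) / (c * D)%:R).

Let kr1 : 1 <= kappa%:R :> rat.
Proof. by rewrite ler1n (leq_trans _ k128). Qed.

Let lam_ge1 x : 1 <= lam x.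
Proof. by apply: le_trans kr1 _; rewrite le_max lexx. Qed.

Let lam_gt0 x : 0 < lam x.
Proof. exact: lt_le_trans ltr01 (lam_ge1 x). Qed.

Definition over_cond (P : {set 'I_s2} * {set 'I_s}) :=
  [&& (#|P.1| * d * kappa <= h * s)%N, (0 < #|P.2|)%N & (#|P.1| <= D * #|P.2|)%N].

Definition under_cond (P : {set 'I_s2} * {set 'I_s}) :=
  (kappa * h * s <= #|P.1| * d)%N && (s < 16 * #|P.2|)%N.

(* Chernoff weights of a pair (W, X): at least 1 if the degrees into X violate the
   conclusion for W, and of small average over f. *)
Definition over_wt (f : T) (P : {set 'I_s2} * {set 'I_s}) : rat :=
  (lam #|P.2|)^-1 ^+ (h * #|P.2|)
  * \prod_(p in setX P.1 [set: 'I_d]) (if f p \in P.2 then lam #|P.2| else 1).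

Definition under_wt (f : T) (P : {set 'I_s2} * {set 'I_s}) : rat :=
  2%:R ^+ (h * #|P.2|)
  * \prod_(p in setX P.1 [set: 'I_d]) (if f p \in P.2 then 2%:R^-1 else 1).

Lemma sum_two_values (X : {set 'I_s}) (a : rat) :
  \sum_(j : 'I_s) (if j \in X then a else 1) = (#|X|%:R * (a - 1) + s%:R).
Proof.
transitivity (\sum_(j : 'I_s) ((if j \in X then a - 1 else 0) + 1)).
  by apply: eq_bigr => j _; case: ifP; rewrite ?subrK ?add0r.
by rewrite big_split /= -big_mkcond /= !sumr_const card_ord mulr_natl.
Qed.

Let sr0 : 0 < s%:R :> rat. Proof. by rewrite ltr0n. Qed.

(** Exponential moment: with u = lam |X| / s, the mean of lam^(links from W into X) is at most (1 +
    u)^(|W| d), and |W| d u <= h |X| makes this at most 4^(h |X|). *)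
Lemma over_wt_sum P : over_cond P ->
  \sum_f over_wt f P <= (4%:R / lam #|P.2|) ^+ (h * #|P.2|) * #|{: T}|%:R.
Proof.
case: P => W X /and3P[/= Wk X0 WD]; rewrite /over_wt /= -mulr_sumr.
set l := lam #|X|; have l1 : 1 <= l by exact: lam_ge1.
have xr0 : 0 < #|X|%:R :> rat by rewrite ltr0n.
pose u : rat := l * #|X|%:R / s%:R.
have u0 : 0 <= u by apply: divr_ge0; [apply: mulr_ge0|exact: ltW]; [lra|exact: ltW].
have := @sum_ffun_prod ('I_s2 * 'I_d)%type 'I_s (setX W setT)
  (fun j => if j \in X then l else 1) (1 + u).
rewrite sum_two_values card_ord cardsX cardsT card_ord => H.
have {}H : \sum_(f : T) \prod_(p in setX W [set: 'I_d]) (if f p \in X then l else 1)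
    <= (1 + u) ^+ (#|W| * d) * #|{: T}|%:R.
  apply: H => [|j]; last by case: ifP => _; lra.
  rewrite mulrDl mul1r /u mulfVK ?lt0r_neq0 //.
  by rewrite addrC lerD2l [leRHS]mulrC; apply: ler_wpM2l; lra.
have li0 : 0 <= l^-1 ^+ (h * #|X|) by apply: exprn_ge0; rewrite invr_ge0; lra.
apply: le_trans (ler_wpM2l li0 H) _; rewrite mulrA; apply: ler_wpM2r; first exact: ler0n.
rewrite mulrC expr_div_n -exprVn; apply: ler_wpM2r => //.
apply: expn_1D_le4 => //.
have [al|al] := leP ((#|W| * d)%:R * l) (h * s)%:R.
  have xs0 : 0 <= #|X|%:R / s%:R :> rat by apply: divr_ge0; exact: ler0n.
  rewrite /u -[l * _ / _]mulrA mulrA; apply: le_trans (ler_wpM2r xs0 al) _.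
  by rewrite !natrM mulrA mulrAC mulfK ?lt0r_neq0.
move: al; rewrite ltNge => /negP[].
have [e|e] : l = kappa%:R \/ l = (s%:R / #|X|%:R) / (c * D)%:R.
  by rewrite /l /lam; case: leP => _; [right|left].
  by rewrite e -!natrM ler_nat.
rewrite e mulrA ler_pdivrMr ?ltr0n ?muln_gt0 ?c0 // mulrA ler_pdivrMr // -!natrM ler_nat.
have : (#|W| * d <= (D * #|X|) * (c * h))%N by apply: leq_mul.
nia.
Qed.

(** Weight 1/2 on at least a sixteenth of the targets brings the mean weight down to 31/32. The
    existential keeps this base opaque. *)
Lemma base32 : exists b : rat, [/\ 0 <= b, b <= 1, b ^+ 32 <= 2%:R^-1 &
  forall x y : rat, y <= 16%:R * x -> x * (2%:R^-1 - 1) + y <= b * y].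
Proof.
exists (1 - 32%:R^-1); split; [lra | lra | exact: expn_1B_le2 | by move=> x y; lra].
Qed.

Lemma under_wt_sum P : under_cond P ->
  \sum_f under_wt f P <= 8%:R^-1 ^+ (h * s) * #|{: T}|%:R.
Proof.
case: P => Y X /andP[/= Yk sX]; rewrite /under_wt /= -mulr_sumr.
have [b [b0 b1 b32 bs]] := base32.
have Xs : (#|X| <= s)%N by rewrite -[X in (_ <= X)%N](card_ord s) max_card.
have := @sum_ffun_prod ('I_s2 * 'I_d)%type 'I_s (setX Y setT)
  (fun j => if j \in X then 2%:R^-1 else 1) b.
rewrite sum_two_values card_ord cardsX cardsT card_ord => H.
have {}H : \sum_(f : T) \prod_(p in setX Y [set: 'I_d]) (if f p \in X then 2%:R^-1 else 1 : rat)
    <= b ^+ (#|Y| * d) * #|{: T}|%:R.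
  apply: H => [|j]; last by case: ifP => _; lra.
  by apply: bs; rewrite -natrM ler_nat ltnW.
have e0 : 0 <= (2%:R : rat) ^+ (h * #|X|) by apply: exprn_ge0.
apply: le_trans (ler_wpM2l e0 H) _; rewrite mulrA; apply: ler_wpM2r; first exact: ler0n.
(* As [kappa] is at least 128 = 32 * 4, the exponent |Y| d yields 4hs halvings, of which hs are
   spent on the factor 2^(hs). *)
apply: (@le_trans _ _ (2%:R ^+ (h * s) * b ^+ (32 * (4 * (h * s))))).
  apply: ler_pM; [exact: e0 | exact: exprn_ge0 | |].
    by rewrite ler_eXn2l ?leq_mul2l ?Xs ?orbT // ltr1n.
  apply: ler_wiXn2l; [exact: b0 | exact: b1 |].
  apply: leq_trans Yk; rewrite -mulnA.
  by have := leq_mul k128 (leqnn (h * s)); lia.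
rewrite (exprM _ 32); move: (b ^+ 32) b32 (exprn_ge0 32 b0) => a a2 a0.
apply: (@le_trans _ _ (2%:R ^+ (h * s) * 2%:R^-1 ^+ (4 * (h * s)))).
  apply: ler_wpM2l; first exact: exprn_ge0.
  by apply: lerXn2r; rewrite ?nnegrE //; lra.
rewrite (exprM _ 4) -exprMn; suff -> : 2%:R * 2%:R^-1 ^+ 4 = 8%:R^-1 :> rat by [].
by [].
Qed.

(** Union bound by the size x of X: there are at most (4s/x)^x sets X and (2s/x)^(Dx) 4^x sets W,
    and [shrink_numeric] bounds the total for size x by 8^-x. *)
Lemma over_total :
  \sum_(P | over_cond P) (4%:R / lam #|P.2|) ^+ (h * #|P.2|) <= 7%:R^-1.
Proof.
pose tau x : rat := (s2%:R / x%:R) ^+ (D * x) * 4%:R ^+ x * (4%:R / lam x) ^+ (h * x).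
have q0 x : 0 <= 4%:R / lam x by apply: divr_ge0; [exact: ler0n | exact: ltW].
have tau0 x : 0 <= tau x.
  apply: mulr_ge0; last exact: exprn_ge0.
  by apply: mulr_ge0; apply: exprn_ge0; rewrite ?divr_ge0 ?ler0n.
apply: (@le_trans _ _ (\sum_(X : {set 'I_s} | (0 < #|X|)%N) tau #|X|)).
  rewrite big_mkcond -(pair_bigA _ (fun W X => if over_cond (W, X)
     then (4%:R / lam #|X|) ^+ (h * #|X|) else 0)) exchange_big /= [leRHS]big_mkcond.
  apply: ler_sum => X _; have [X0|X0] := ltnP 0 #|X|; last first.
    by rewrite big1 // => W _; rewrite /over_cond /= ltnNge X0 andbF.
  have Xs : (#|X| <= s)%N by rewrite -[X in (_ <= X)%N](card_ord s) max_card.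
  apply: (@le_trans _ _ (\sum_(W : {set 'I_s2} | (#|W| <= D * #|X|)%N) (4%:R / lam #|X|) ^+ (h * #|X|))).
    rewrite [leRHS]big_mkcond; apply: ler_sum => W _; case: ifP => [/and3P[_ _ /= ->]|_] //.
    by case: ifP => _ //; exact: exprn_ge0.
  rewrite sumr_const -[leLHS]mulr_natl /tau.
  apply: ler_wpM2r; first exact: exprn_ge0.
  have -> : #|[pred W : {set 'I_s2} | (#|W| <= D * #|X|)%N]| = #|[set W : {set 'I_s2} | (#|W| <= D * #|X|)%N]|.
    by apply: eq_card => W; rewrite !inE.
  have xr0 : 0 < #|X|%:R :> rat by rewrite ltr0n.
  apply: count_small_sets.
    by rewrite ler_pdivlMr // mul1r ler_nat (leq_trans Xs) // -addnn leq_addr.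
  by rewrite mulrC divfK ?lt0r_neq0.
apply: le_trans (sum_by_card _ tau0) _; apply: le_trans (sum_geom8 s).
apply: ler_sum => x _; rewrite /tau.
set y : rat := s%:R / _; have g1 : 1 <= y by rewrite ler_pdivlMr ?ltr0n // mul1r ler_nat.
have -> : s2%:R / x.+1%:R = 2%:R * y by rewrite -mul2n natrM mulrA.
have sn := shrink_numeric k128 D0 c0 hbig g1; rewrite -/(lam x.+1) in sn.
have a0 : 0 <= (2%:R * y) ^+ D by apply: exprn_ge0; lra.
have b0 : 0 <= (4%:R / lam x.+1) ^+ h by exact: exprn_ge0.
rewrite !(exprM _ _ x.+1) -!exprMn; clearbody y.
move: (_ ^+ h) (_ ^+ D) b0 a0 sn => v u v0 u0 sn.
apply: lerXn2r; rewrite ?nnegrE; [|lra|by move: sn; lra].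
by apply: mulr_ge0; [lra|apply: mulr_ge0 => //; apply: mulr_ge0].
Qed.

Lemma under_total :
  \sum_(P | under_cond P) (8%:R^-1 : rat) ^+ (h * s) <= 8%:R^-1.
Proof.
apply: le_trans (sum_pred_cond (c := (2 ^ s2 * 2 ^ s)%N) _ _) _.
- by apply: exprn_ge0; rewrite invr_ge0.
- apply: leq_trans (max_card _) _.
  by rewrite card_prod -!cardsT -!powersetT !card_powerset !cardsT !card_ord.
rewrite -expnD -addnn (_ : (s + s + s = 3 * s)%N); last by lia.
rewrite expnM natrX (_ : (2 ^ 3)%:R = 8%:R :> rat) //.
have h2 : (h * s = s + (1 + (h * s - s - 1)))%N.
  have : (8 * s <= h * s)%N by rewrite leq_mul2r (leq_trans _ hbig) ?orbT // addnAC leq_addl.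
  by move: s0; lia.
rewrite h2 !exprD expr1 mulrA -exprMn mulfV // expr1n mul1r ler_piMr ?invr_ge0 ?ler0n //.
by apply: exprn_ile1; rewrite ?invr_ge0 ?ler0n // invf_le1 ?ltr0n // ler1n.
Qed.

(** The mean total weight is at most 1/7 + 1/8, so some [f] gives every pair a weight below 1. A
    violating W or Y, paired with the set of its offending receivers, would have weight at least
    1. *)
Lemma sampler_exists : exists f : T,
  (forall W : {set 'I_s2}, (#|W| * d * kappa <= h * s ->
     #|[set x | h <= fdeg f W x]| * D <= #|W|)%N) /\
  (forall Y : {set 'I_s2}, (kappa * h * s <= #|Y| * d ->
     16 * #|[set x | fdeg f Y x < h]| <= s)%N).
Proof.
pose F (f : T) := \sum_(P | over_cond P) over_wt f P + \sum_(P | under_cond P) under_wt f P.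
have N0 : 0 < #|{: T}|%:R :> rat by rewrite ltr0n card_ffun card_ord expn_gt0 s0.
have [] := @exists_small _ F.
  rewrite /F big_split /= exchange_big [X in _ + X]exchange_big /=.
  apply: (@le_lt_trans _ _ (7%:R^-1 * #|{: T}|%:R + 8%:R^-1 * #|{: T}|%:R)); last by lra.
  apply: lerD.
    apply: le_trans (ler_wpM2r (ltW N0) over_total); rewrite mulr_suml.
    by apply: ler_sum => P; exact: over_wt_sum.
  apply: le_trans (ler_wpM2r (ltW N0) under_total); rewrite mulr_suml.
  by apply: ler_sum => P; exact: under_wt_sum.
have ow0 f P : 0 <= over_wt f P.
  apply: mulr_ge0; first by apply: exprn_ge0; rewrite invr_ge0 ltW.
  by apply: prodr_ge0 => p _; case: ifP => _; rewrite ?ler01 // ltW.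
have uw0 f P : 0 <= under_wt f P.
  apply: mulr_ge0; first exact: exprn_ge0.
  by apply: prodr_ge0 => p _; case: ifP => _; rewrite ?ler01 // invr_ge0.
move=> f Ff; exists f; split=> [W|Y] cond; rewrite leqNgt; apply/negP => viol.
  set X := [set x | (h <= fdeg f W x)%N] in viol *.
  have oc : over_cond (W, X).
    rewrite /over_cond /= cond /= (mulnC D) (ltnW viol) andbT.
    by rewrite lt0n; apply: contraTneq viol => ->.
  have : over_wt f (W, X) < 1.
    apply: le_lt_trans Ff; rewrite /F (bigD1 (W, X)) //= -addrA lerDl.
    by rewrite addr_ge0 ?sumr_ge0.
  rewrite ltNge => /negP[]; rewrite /over_wt /= prod_if_expn -sum_fdeg.
  rewrite exprVn ler_pdivlMl ?exprn_gt0 // mulr1 ler_weXn2l // mulnC -sum_nat_const.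
  by apply: leq_sum => x; rewrite inE.
set X := [set x | (fdeg f Y x < h)%N] in viol *.
have uc : under_cond (Y, X) by rewrite /under_cond /= cond.
have : under_wt f (Y, X) < 1.
  apply: le_lt_trans Ff; rewrite /F [X in _ + X](bigD1 (Y, X)) //= addrCA lerDl.
  by rewrite addr_ge0 ?sumr_ge0.
rewrite ltNge => /negP[]; rewrite /under_wt /= prod_if_expn -sum_fdeg.
rewrite exprVn ler_pdivlMr ?exprn_gt0 // mul1r ler_weXn2l ?ler1n // mulnC -sum_nat_const.
by apply: leq_sum => x; rewrite inE => /ltnW.
Qed.

End SamplerExists.

(** * Random hosts *)

Lemma sum_blocks (s t : nat) (G : nat -> nat) :
  \sum_(v < s * t) G v = \sum_(y < s) \sum_(o < t) G (y * t + o).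
Proof.
elim: s => [|s IH]; first by rewrite mul0n !big_ord0.
by rewrite big_ord_recr /= -IH mulSn addnC big_split_ord.
Qed.

Lemma sum_modn (c t : nat) (G : nat -> nat) : 0 < t ->
  \sum_(v < c * t) G (v %% t) = c * \sum_(o < t) G o.
Proof.
move=> t0; rewrite (sum_blocks c t (fun v => G (v %% t))).
rewrite -[in RHS](card_ord c) -sum_nat_const; apply: eq_bigr => y _.
by apply: eq_bigr => o _; rewrite modnMDl modn_small.
Qed.

Definition in_set (m : nat) (Q : {set 'I_m}) (v : nat) := [exists x in Q, val x == v].

Section Hosts.

Local Open Scope ring_scope.

Variables (U : finType) (lev : U -> nat) (q L : nat).
Hypothesis levL : forall u, (lev u <= L)%N.
Hypothesis q0 : (0 < q)%N.

Let m := (q * 2 ^ L)%N.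
Let sz u := (q * 2 ^ (L - lev u))%N.
Notation T := {ffun U * 'I_m -> 'I_(2 ^ L)}.

(** In a run of depth k, virtual node y owns the y-th block of 2^k little nodes and draws its host
    there. The hosts of a run are thus distinct, and as 2^k divides 2^L, a uniform offset below 2^L
    is uniform in the block. *)
Definition block_host (k y o : nat) := (y * 2 ^ k + o %% 2 ^ k)%N.

Definition bad_hosts (Q : {set 'I_m}) (r : T) (u : U) : nat :=
  #|[set y : 'I_m | (y < sz u)%N && in_set Q (block_host (lev u) y (r (u, y)))]|.

Lemma szM u : (sz u * 2 ^ lev u = m)%N.
Proof. by rewrite /sz -mulnA -expnD subnK. Qed.

Lemma sz_le u : (sz u <= m)%N.
Proof. by rewrite -(szM u) leq_pmulr // expn_gt0. Qed.

Lemma sum_in_set (Q : {set 'I_m}) u :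
  (\sum_(y < sz u) \sum_(o < 2 ^ L) in_set Q (block_host (lev u) y o)
    = 2 ^ (L - lev u) * #|Q|)%N.
Proof.
transitivity (\sum_(y < sz u) 2 ^ (L - lev u) *
    \sum_(o < 2 ^ lev u) in_set Q (y * 2 ^ lev u + o))%N.
  apply: eq_bigr => y _; rewrite /block_host.
  have := @sum_modn (2 ^ (L - lev u)) (2 ^ lev u)
    (fun o => in_set Q (y * 2 ^ lev u + o)) (expn_gt0 _ _).
  by rewrite -expnD subnK // => ->.
rewrite -big_distrr /= -(sum_blocks _ _ (fun v => in_set Q v : nat)) szM.
congr (_ * _)%N; rewrite sum_bool_card; apply: eq_card => x; rewrite inE.
apply/existsP/idP => [[z /andP[zQ /eqP/val_inj <-]] //|xQ]; exists x.
by rewrite xQ eqxx.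
Qed.

Section OneSet.

Variables (Q : {set 'I_m}) (lam gam : rat).
Hypothesis lam1 : 1 <= lam.
Hypothesis Qgam : #|Q|%:R <= gam * m%:R.

Lemma prod_bad (r : T) (u : U) :
  \prod_(y < m) (if (y < sz u)%N && in_set Q (block_host (lev u) y (r (u, y))) then lam else 1)
    = lam ^+ bad_hosts Q r u.
Proof.
rewrite -big_mkcond /= /bad_hosts -prodr_const; apply: eq_bigl => y; by rewrite inE.
Qed.

(** Let [beta y] be the probability that y is hosted in Q. Hosts are independent, the mean of [beta]
    over a run is at most [gam], and by AM-GM the product of the factors [1 + (lam - 1) * beta y] is
    at most the power of their mean. *)
Lemma hosts_mgf (J : {set U}) :
  \sum_(r : T) \prod_(u in J) lam ^+ bad_hosts Q r u
    <= \prod_(u in J) (1 + (lam - 1) * gam) ^+ sz u * #|{: T}|%:R.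
Proof.
pose bad (p : U * 'I_m) (o : nat) :=
  [&& p.1 \in J, (p.2 < sz p.1)%N & in_set Q (block_host (lev p.1) p.2 o)].
pose F (p : U * 'I_m) (o : 'I_(2 ^ L)) : rat := if bad p o then lam else 1.
have -> : \sum_(r : T) \prod_(u in J) lam ^+ bad_hosts Q r u
    = \sum_(r : T) \prod_p F p (r p).
  apply: eq_bigr => r _.
  rewrite (eq_bigr (fun p => F (p.1, p.2) (r (p.1, p.2)))); last by case.
  rewrite -(pair_bigA _ (fun u y => F (u, y) (r (u, y)))) /= big_mkcond /=.
  apply: eq_bigr => u _; rewrite -prod_bad /F /bad /=.
  by case: (u \in J); last by rewrite big1.
rewrite -bigA_distr_bigA /=.
rewrite (eq_bigr (fun p => \sum_j F (p.1, p.2) j)); last by case.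
rewrite -(pair_bigA _ (fun u y => \sum_j F (u, y) j)) /=.
have c2 : 0 < (2 ^ L)%:R :> rat by rewrite ltr0n expn_gt0.
have -> : #|{: T}|%:R = \prod_(u : U) (2 ^ L)%:R ^+ m :> rat.
  by rewrite prodr_const card_ffun card_prod !card_ord natrX mulnC exprM.
rewrite [X in _ <= X * _]big_mkcond -big_split /=; apply: ler_prod => u _; apply/andP; split.
  apply: prodr_ge0 => y _; apply: sumr_ge0 => o _; rewrite /F; case: ifP => _ //.
  exact: le_trans ler01 lam1.
case: (boolP (u \in J)) => [uJ|/negbTE uJ]; last first.
  rewrite mul1r (eq_bigr (fun=> (2 ^ L)%:R)) ?prodr_const ?card_ord // => y _.
  rewrite (eq_bigr (fun=> 1)) ?sumr_const ?card_ord // => o _.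
  by rewrite /F /bad /= uJ.
pose beta (y : 'I_m) : rat := (\sum_(o < 2 ^ L) in_set Q (block_host (lev u) y o))%:R / (2 ^ L)%:R.
have Fs y : \sum_j F (u, y) j
    = (if (y < sz u)%N then 1 + (lam - 1) * beta y else 1) * (2 ^ L)%:R.
  rewrite /F /bad /= uJ /=; case: ifP => ys; last first.
    by rewrite mul1r (eq_bigr (fun=> 1)) ?sumr_const ?card_ord.
  rewrite mulrDl mul1r /beta -mulrA divfK ?lt0r_neq0 // natr_sum mulr_sumr.
  rewrite -[in (2 ^ L)%:R](card_ord (2 ^ L)) -sumr_const -big_split /=.
  by apply: eq_bigr => o _; case: in_set; rewrite ?mulr1 ?mulr0 ?addr0 // addrC subrK.
rewrite (eq_bigr _ (fun y _ => Fs y)) big_split /= prodr_const card_ord.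
apply: ler_wpM2r; first by apply: exprn_ge0; exact: ltW.
have b0 y : 0 <= beta y by apply: divr_ge0; exact: ler0n.
have f0 y : 0 <= 1 + (lam - 1) * beta y.
  by apply: addr_ge0 => //; apply: mulr_ge0 => //; rewrite subr_ge0.
rewrite -big_mkcond /=.
have cS : #|[pred y : 'I_m | (y < sz u)%N]| = sz u.
  rewrite -sum1_card -(big_ord_widen _ (fun=> 1%N) (sz_le u)) sum1_card card_ord //.
have bsum : \sum_(y < m | (y < sz u)%N) beta y <= gam * (sz u)%:R.
  rewrite /beta -mulr_suml -natr_sum.
  rewrite -(big_ord_widen _ (fun y => \sum_(o < 2 ^ L) in_set Q (block_host (lev u) y o))%N (sz_le u)).
  rewrite sum_in_set ler_pdivrMr // -mulrA -natrM /sz -mulnA.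
  have -> : (2 ^ (L - lev u) * 2 ^ L = 2 ^ L * 2 ^ (L - lev u))%N by rewrite mulnC.
  rewrite mulnA !natrM mulrA [leLHS]mulrC; apply: ler_wpM2r; first exact: ler0n.
  by rewrite -natrM.
have := leif_le (@leif_AGM _ _ [pred y : 'I_m | (y < sz u)%N] (fun y => 1 + (lam - 1) * beta y) _).
rewrite cS => H; apply: le_trans (H _) _ => [y _|]; first exact: f0.
have su0 : 0 < (sz u)%:R :> rat by rewrite ltr0n /sz muln_gt0 q0 expn_gt0.
have mean : (\sum_(y < m | (y < sz u)%N) (1 + (lam - 1) * beta y)) / (sz u)%:R <= 1 + (lam - 1) * gam.
  rewrite ler_pdivrMr // big_split /= sumr_const cS -mulr_sumr [leRHS]mulrDl mul1r lerD2l -mulrA.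
  by apply: ler_wpM2l; first by rewrite subr_ge0.
have mean0 : 0 <= (\sum_(y < m | (y < sz u)%N) (1 + (lam - 1) * beta y)) / (sz u)%:R.
  by apply: divr_ge0; [apply: sumr_ge0 => y _; exact: f0 | exact: ltW].
by apply: lerXn2r; rewrite ?nnegrE //; exact: le_trans mean0 mean.
Qed.

Variables (a b : nat) (mu : rat).
Hypothesis mu1 : 1 <= mu.
Hypothesis lamE : lam = mu ^+ b.
Hypothesis gam0 : 0 <= gam.
Hypothesis mgf_le : 3%:R / 2%:R * (1 + (lam - 1) * gam) <= 3%:R / 4%:R * mu ^+ a.

Definition damaged_mass (r : T) : nat :=
  \sum_(u | (a * sz u <= b * bad_hosts Q r u)%N) sz u.

(** In a damaged run lam^bad_hosts is at least mu^(a sz), so its factor (3/2)^sz is at most C u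
    lam^bad_hosts. Expanding the product over the sets J of runs, [mgf_le] bounds the mean
    contribution of u by (3/4)^(sz u) <= (3/4)^q, and (1 + (3/4)^q)^#|U| <= 4. *)
Lemma damaged_mgf : #|U|%:R * (3%:R / 4%:R) ^+ q <= 1 :> rat ->
  \sum_(r : T) (3%:R / 2%:R) ^+ damaged_mass r <= 4%:R * #|{: T}|%:R :> rat.
Proof.
have:= mgf_le; set w : rat := 3%:R / 2%:R; set p : rat := 3%:R / 4%:R => mgf' Uq.
have mu0 : 0 < mu by apply: lt_le_trans mu1.
have w1 : 1 <= w by rewrite /w; lra.
have p0 : 0 <= p by rewrite /p; lra.
have p1 : p <= 1 by rewrite /p; lra.
clearbody w p.
have w0 : 0 <= w by apply: le_trans w1.
have l0 : 0 <= lam by apply: le_trans lam1.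
pose C u : rat := w ^+ sz u * mu^-1 ^+ (a * sz u).
have mui0 : 0 <= mu^-1 by rewrite invr_ge0 ltW.
have C0 u : 0 <= C u by apply: mulr_ge0; exact: exprn_ge0.
have G0 r u : 0 <= C u * lam ^+ bad_hosts Q r u by apply: mulr_ge0 => //; exact: exprn_ge0.
apply: (@le_trans _ _ (\sum_(r : T) \prod_u (C u * lam ^+ bad_hosts Q r u + 1))).
  apply: ler_sum => r _; rewrite /damaged_mass expr_sum big_mkcond /=.
  apply: ler_prod => u _; case: ifP => [du|_]; last by rewrite ler01 lerDr G0.
  rewrite exprn_ge0 //= -[leLHS]addr0; apply: lerD => //.
  rewrite /C -mulrA ler_peMr ?exprn_ge0 // exprVn ler_pdivlMl ?exprn_gt0 // mulr1.
  by rewrite lamE -exprM ler_weXn2l.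
under eq_bigr do rewrite bigA_distr.
rewrite exchange_big /=.
apply: (@le_trans _ _ (\sum_(J : {set U}) \prod_u (if u \in J then p ^+ sz u else 1) * #|{: T}|%:R)).
  apply: ler_sum => J _.
  rewrite (eq_bigr (fun r => (\prod_(u in J) C u) * \prod_(u in J) lam ^+ bad_hosts Q r u)); last first.
    by move=> r _; rewrite -big_mkcond big_split.
  rewrite -mulr_sumr -big_mkcond.
  have PC0 : 0 <= \prod_(u in J) C u by apply: prodr_ge0.
  apply: le_trans (ler_wpM2l PC0 (hosts_mgf J)) _.
  rewrite mulrA -big_split /=; apply: ler_wpM2r; first exact: ler0n.
  apply: ler_prod => u _.
  have e0 : 0 <= 1 + (lam - 1) * gam by apply: addr_ge0 => //; apply: mulr_ge0 => //; rewrite subr_ge0.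
  rewrite mulr_ge0 ?exprn_ge0 //= /C exprM -!exprMn.
  apply: lerXn2r; rewrite ?nnegrE ?mulr_ge0 ?exprn_ge0 ?invr_ge0 ?exprn_ge0 ?(ltW mu0) //.
  by rewrite mulrAC exprVn ler_pdivrMr ?exprn_gt0.
rewrite -mulr_suml -bigA_distr; apply: ler_wpM2r; first exact: ler0n.
apply: (@le_trans _ _ (\prod_(u : U) (1 + p ^+ q))).
  apply: ler_prod => u _; rewrite addr_ge0 ?exprn_ge0 //= addrC lerD2l.
  by apply: ler_wiXn2l => //; rewrite /sz leq_pmulr // expn_gt0.
rewrite prodr_const; have := @expn_1D_le4 (p ^+ q) #|U| 1; rewrite expr1; apply => //.
exact: exprn_ge0.
Qed.

End OneSet.

Lemma two_thirds : 2%:R * (2%:R / 3%:R) ^+ 2 = 1 - 9%:R^-1 :> rat.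
Proof. by rewrite expr2; lra. Qed.

(** 5/4 is a Chernoff base for damage 7/8 when Q holds at most a quarter of the little nodes. *)
Lemma mu_exists : exists mu : rat, 1 <= mu /\
  3%:R / 2%:R * (1 + (mu ^+ 8 - 1) * 4%:R^-1) <= 3%:R / 4%:R * mu ^+ 7.
Proof.
have [x xE] : exists x : rat, x = 5%:R / 4%:R by exists (5%:R / 4%:R).
exists x; split; first by rewrite xE; lra.
have x2 : x * x = 25%:R / 16%:R by rewrite xE; lra.
have x4 : x * x * (x * x) = 625%:R / 256%:R by rewrite x2; lra.
have e7 : x ^+ 7 = (x * x * (x * x)) * (x * x) * x by rewrite !exprS expr0 mulr1 !mulrA.
rewrite (exprS _ 7) e7 x4 x2 xE; lra.
Qed.

(** Union bound over at most 2^m sets Q: a mass above 2m has weight more than (3/2)^(2m), and since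
    2 (2/3)^2 = 8/9, the total decays like (8/9)^m. *)
Lemma hosts_exist (b : nat) : (0 < b)%N -> (36 <= m)%N ->
  #|U|%:R * (3%:R / 4%:R) ^+ q <= 1 :> rat ->
  exists r : T, forall Q : {set 'I_m},
    ((4 * #|Q| <= m)%N -> (damaged_mass Q 7 8 r <= 2 * m)%N) /\
    ((4 ^ b * #|Q| <= m)%N -> (damaged_mass Q 1 b r <= 2 * m)%N).
Proof.
move=> b0 m36 Uq.
pose F (r : T) : rat :=
  \sum_(Q : {set 'I_m} | (4 * #|Q| <= m)%N) (3%:R / 2%:R) ^+ damaged_mass Q 7 8 r * (2%:R / 3%:R) ^+ (2 * m)
  + \sum_(Q : {set 'I_m} | (4 ^ b * #|Q| <= m)%N) (3%:R / 2%:R) ^+ damaged_mass Q 1 b r * (2%:R / 3%:R) ^+ (2 * m).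
have N0 : 0 < #|{: T}|%:R :> rat by rewrite ltr0n card_ffun card_ord expn_gt0 expn_gt0.
have p0 : 0 <= (2%:R / 3%:R : rat) ^+ (2 * m) by apply: exprn_ge0; lra.
have w1 : 1 <= 3%:R / 2%:R :> rat by lra.
have viol Q c e r : (2 * m < damaged_mass Q c e r)%N ->
    1 <= (3%:R / 2%:R) ^+ damaged_mass Q c e r * (2%:R / 3%:R) ^+ (2 * m) :> rat.
  move=> lt; apply: (@le_trans _ _ ((3%:R / 2%:R) ^+ (2 * m) * (2%:R / 3%:R) ^+ (2 * m))).
    by rewrite -exprMn (_ : 3%:R / 2%:R * (2%:R / 3%:R) = 1 :> rat) ?expr1n.
  by apply: ler_wpM2r => //; apply: ler_weXn2l => //; exact: ltnW.
have term0 Q c e r : 0 <= (3%:R / 2%:R) ^+ damaged_mass Q c e r * (2%:R / 3%:R) ^+ (2 * m) :> rat.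
  by apply: mulr_ge0 => //; apply: exprn_ge0; lra.
have [] := @exists_small _ F; last first.
  move=> r Fr; exists r => Q; split=> Qs; rewrite leqNgt; apply/negP => /viol h1;
    move: Fr; rewrite ltNge => /negP[]; apply: le_trans h1 _; rewrite /F.
  - by rewrite (bigD1 Q) //= -addrA lerDl addr_ge0 ?sumr_ge0.
  - by rewrite [X in _ + X](bigD1 Q) //= addrCA lerDl addr_ge0 ?sumr_ge0.
rewrite /F big_split /= exchange_big [X in _ + X]exchange_big /=.
have total (P : pred {set 'I_m}) c e : (forall Q, P Q ->
     \sum_(r : T) (3%:R / 2%:R) ^+ damaged_mass Q c e r <= 4%:R * #|{: T}|%:R :> rat) ->
   \sum_(Q | P Q) \sum_(r : T) (3%:R / 2%:R) ^+ damaged_mass Q c e r * (2%:R / 3%:R) ^+ (2 * m)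
     <= 4%:R^-1 * #|{: T}|%:R :> rat.
  move=> H; apply: (@le_trans _ _ (\sum_(Q | P Q) (4%:R * #|{: T}|%:R * (2%:R / 3%:R) ^+ (2 * m)))).
    by apply: ler_sum => Q PQ; rewrite -mulr_suml; apply: ler_wpM2r => //; exact: H.
  apply: le_trans (sum_pred_cond (c := (2 ^ m)%N) _ _) _.
  - by apply: mulr_ge0 => //; apply: mulr_ge0; [exact: ler0n | exact: ltW].
  - by apply: leq_trans (max_card _) _; rewrite -cardsT -powersetT card_powerset cardsT card_ord.
  rewrite -[4%:R * _ * _]mulrA mulrCA [_%:R * (2%:R / 3%:R) ^+ _]mulrC mulrA mulrA.
  apply: ler_wpM2r; first exact: ltW.
  rewrite exprM natrX -mulrA -exprMn two_thirds.
  have h9 := @expn_1B_le2 9 isT; move: h9.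
  have : 0 <= (1 - 9%:R^-1 : rat) <= 1 by apply/andP; split; lra.
  move: (1 - _) => v /andP[c0 c1] c9.
  (* Here [36 <= m] enters: (8/9)^36 <= (1/2)^4, which leaves 4/16 = 1/4. *)
  apply: (@le_trans _ _ (4%:R * v ^+ (9 * 4))).
    by apply: ler_wpM2l; [exact: ler0n | exact: ler_wiXn2l].
  have c90 := exprn_ge0 9 c0; rewrite (exprM _ 9); move: (v ^+ 9) c9 c90 => u u2 u0.
  have : u * u <= 4%:R^-1 by apply: le_trans (ler_pM u0 u0 u2 u2) _; lra.
  move=> u4; have uu0 : 0 <= u * u by exact: mulr_ge0.
  have := ler_pM uu0 uu0 u4 u4; rewrite !exprS expr0 mulr1 !mulrA; lra.
apply: (@le_lt_trans _ _ (4%:R^-1 * #|{: T}|%:R + 4%:R^-1 * #|{: T}|%:R)); last by lra.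
apply: lerD; apply: total => Q Qs.
- have [mu [mu1 mule]] := mu_exists.
  apply: (@damaged_mgf Q (mu ^+ 8) 4%:R^-1 _ _ 7 8 mu) => //.
  + exact: exprn_ege1.
  + by rewrite mulrC ler_pdivlMr ?ltr0n // -natrM ler_nat mulnC.
(* For sets of density 4^-b the base mu = 4 works, as 3/2 (2 - 4^-b) <= 3. *)
- have p4 : 0 < (4%:R : rat) ^+ b by apply: exprn_gt0.
  have l1 : 1 <= (4%:R : rat) ^+ b by apply: exprn_ege1; rewrite ler1n.
  apply: (@damaged_mgf Q (4%:R ^+ b) (4%:R ^- b) _ _ 1 b 4%:R); [exact: l1 | | | by [] | | | exact: Uq].
  + by rewrite mulrC ler_pdivlMr // -natrX -natrM ler_nat mulnC.
  + by rewrite ler1n.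
  + by rewrite invr_ge0 ltW.
  + rewrite expr1; move: (4%:R ^+ b) p4 l1 => x x0 x1.
    have xx : x * x^-1 = 1 by apply: mulfV; exact: lt0r_neq0.
    rewrite mulrBl xx mul1r.
    have : 0 < x^-1 by rewrite invr_gt0.
    lra.
Qed.

End Hosts.

(** * Expanding cores *)

Section Core.

Variables (m a : nat) (adj : rel 'I_m).
Hypothesis adjC : symmetric adj.
Hypothesis joined : forall A B : {set 'I_m}, m <= a * #|A| -> m <= a * #|B| ->
  exists x y, [/\ x \in A, y \in B & adj x y].

Definition nbrs (K S : {set 'I_m}) : {set 'I_m} :=
  [set y in K :\: S | [exists x in S, adj x y]].

Definition expanding (K : {set 'I_m}) :=
  forall S : {set 'I_m}, S \subset K -> a * #|S| < m -> #|S| <= #|nbrs K S|.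

(* Delete from the complement of Z a largest small set with few neighbours. *)
Lemma expanding_core (Z : {set 'I_m}) : 7 <= a -> 4 * #|Z| <= m ->
  exists K : {set 'I_m}, [/\ [disjoint K & Z], a * #|~: Z :\: K| <= m & expanding K].
Proof.
move=> a7 Zm; set U := ~: Z.
pose bad (S : {set 'I_m}) := [&& S \subset U, a * #|S| <= m & #|nbrs U S| <= #|S|].
have bad0 : bad set0.
  rewrite /bad sub0set cards0 muln0 leq0n /= leqn0 cards_eq0; apply/eqP/setP=> y.
  by rewrite !inE; apply/negbTE/negP=> /andP[_ /existsP[x]]; rewrite inE.
have [S /and3P[SU Sm SN] Smax] := arg_maxnP (fun S : {set 'I_m} => #|S|) bad0.
exists (U :\: S); split.
- by rewrite -setI_eq0; apply/eqP/setP=> x; rewrite !inE; case: (x \in Z); rewrite ?andbF.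
- by rewrite setDDr setDv set0U (setIidPr SU).
move=> S' S'K S'm; rewrite leqNgt; apply/negP=> S'N.
have S'U : S' \subset U := subset_trans S'K (subsetDl _ _).
have dSS' : [disjoint S & S'].
  by rewrite disjoint_sym; move: S'K; rewrite subsetD => /andP[].
have cT : #|S :|: S'| = #|S| + #|S'| by apply/eqP; rewrite (leq_card_setU S S').2.
have NT : #|nbrs U (S :|: S')| <= #|S :|: S'|.
  rewrite cT; apply: leq_trans (leq_add SN (ltnW S'N)).
  apply: leq_trans (leq_card_setU _ _).1; apply: subset_leq_card; apply/subsetP=> y.
  rewrite !inE negb_or => /andP[/andP[/andP[yS yS'] yU] /existsP[x /andP[]]].
  rewrite !inE yS yS' yU /= => /orP[xS|xS'] xy; apply/orP; [left|right].
    by apply/existsP; exists x; rewrite xS.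
  by apply/existsP; exists x; rewrite xS'.
(* A union of size at most m/a would contradict the maximality of S. *)
have [Tm|Tm] := leqP (a * #|S :|: S'|) m.
  have /Smax : bad (S :|: S') by rewrite /bad subUset SU S'U Tm NT.
  by rewrite cT; move: S'N; lia.
(* V has no link to S :|: S', hence fewer than m/a nodes. Then U, with at least 3m/4 nodes, has
   fewer than (2 + 2 + 1) m/a, which is impossible for a >= 7. *)
set V := U :\: ((S :|: S') :|: nbrs U (S :|: S')).
have Vm : a * #|V| < m.
  rewrite ltnNge; apply/negP=> mV; have [x [y [xT yV xy]]] := joined (ltnW Tm) mV.
  move: yV; rewrite !inE !negb_or -!andbA => /and4P[yS yS' ynb yZ].
  case/negP: ynb; apply/and4P; split=> //; apply/existsP; exists x; by rewrite xT.
have cU : #|U| <= #|S :|: S'| + #|nbrs U (S :|: S')| + #|V|.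
  apply: leq_trans (leq_add (leq_card_setU _ _).1 (leqnn _)).
  apply: leq_trans (leq_card_setU _ _).1; apply: subset_leq_card.
  apply/subsetP=> x xU; rewrite inE; case: (boolP (x \in _ :|: _)) => //= xN.
  by rewrite inE xN.
have cUm : #|Z| + #|U| = m by rewrite cardsC card_ord.
have := leq_mul (leqnn a) cU; rewrite !mulnDr.
have := leq_mul (leqnn a) NT; rewrite cT in NT Tm * => aN.
have : 7 * #|U| <= a * #|U| by rewrite leq_mul2r a7 orbT.
rewrite mulnDr in aN *; move: Sm S'm Vm; lia.
Qed.

(** By expansion the informed set doubles until it has m/a nodes. One round later fewer than m/a are
    missing, since sets of that size are linked. From then on the missing ones halve, because core
    neighbours of a missing node were missing one round before. *)
Lemma core_flooded (K : {set 'I_m}) (J : nat) (B : nat -> {set 'I_m}) :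
  expanding K -> m <= 2 ^ J -> 0 < a ->
  (forall j, B j \subset K) -> B 0 != set0 ->
  (forall j, j <= 2 * J + 1 -> B j \subset B j.+1) ->
  (forall j x y, j <= 2 * J + 1 -> x \in B j -> y \in K -> adj x y -> y \in B j.+1) ->
  B (2 * J + 2) = K.
Proof.
move=> Kexp mJ a0 BK B0 Bmon Bstep.
have grow j : j <= J -> (m <= a * #|B j|) || (2 ^ j <= #|B j|).
  elim: j => [|j IH] jJ; first by rewrite expn0 card_gt0 B0 orbT.
  have jb : j <= 2 * J + 1 by lia.
  have mon := subset_leq_card (Bmon j jb).
  have [big|small] := leqP m (a * #|B j|).
    by rewrite (leq_trans big) // leq_mul2l mon orbT.
  move: (IH (ltnW jJ)); rewrite leqNgt small /= => pj; apply/orP; right.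
  have := Kexp _ (BK j) small => nb.
  have : #|B j| + #|nbrs K (B j)| <= #|B j.+1|.
    have <- : #|B j :|: nbrs K (B j)| = #|B j| + #|nbrs K (B j)|.
      apply/eqP; rewrite (leq_card_setU _ _).2 -setI_eq0; apply/eqP/setP=> x.
      by rewrite !inE; case: (x \in B j).
    apply: subset_leq_card; rewrite subUset Bmon //=; apply/subsetP=> y.
    rewrite !inE => /andP[/andP[_ yK] /existsP[x /andP[xB xy]]].
    exact: Bstep xB yK xy.
  by apply: leq_trans; rewrite expnS mul2n -addnn leq_add ?(leq_trans pj).
have bigJ : m <= a * #|B J|.
  case/orP: (grow J (leqnn J)) => // pJ; apply: leq_trans mJ (leq_trans pJ _).
  by rewrite leq_pmull.
pose R j := K :\: B j.
have small : a * #|R J.+1| < m.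
  rewrite ltnNge; apply/negP=> Rbig; have [x [y [xB yR xy]]] := joined bigJ Rbig.
  move: yR; rewrite inE => /andP[yB yK]; case/negP: yB; apply: Bstep xB yK xy; lia.
have shrink i : i <= J.+1 -> #|R (J.+1 + i)| * 2 ^ i <= m /\ a * #|R (J.+1 + i)| < m.
  elim: i => [|i IH] iJ.
    rewrite addn0 expn0 muln1; split=> //.
    by rewrite -[X in _ <= X](card_ord m) max_card.
  have [IH1 IH2] := IH (ltnW iJ); rewrite addnS.
  set j := J.+1 + i in IH1 IH2 *; have jb : j <= 2 * J + 1 by rewrite /j; lia.
  have sub : R j.+1 \subset R j by apply: setDS; exact: Bmon.
  have sm : a * #|R j.+1| < m by apply: leq_ltn_trans IH2; rewrite leq_mul2l subset_leq_card ?orbT.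
  split=> //; have := Kexp (R j.+1) (subsetDl _ _) sm => nb.
  have : #|R j.+1| + #|nbrs K (R j.+1)| <= #|R j|.
    have <- : #|R j.+1 :|: nbrs K (R j.+1)| = #|R j.+1| + #|nbrs K (R j.+1)|.
      apply/eqP; rewrite (leq_card_setU _ _).2 -setI_eq0; apply/eqP/setP=> x.
      by rewrite !inE; case: (x \in K); case: (x \in B j.+1).
    apply: subset_leq_card; rewrite subUset sub /=; apply/subsetP=> y.
    rewrite inE => /andP[]; rewrite inE => /andP[_ yK] /existsP[x /andP[]].
    rewrite !inE yK andbT => /andP[xB xK] xy.
    apply: contra xB => yB; apply: Bstep yB xK _ => //; by rewrite adjC.
  by rewrite expnS mulnA; move: IH1; set p := 2 ^ i; nia.
have [R0 _] := shrink J.+1 (leqnn _).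
have : #|R (J.+1 + J.+1)| = 0.
  apply/eqP; rewrite -leqn0 leqNgt; apply/negP=> Rp.
  have : 2 ^ J.+1 <= m by apply: leq_trans R0; rewrite leq_pmull.
  have : 0 < 2 ^ J by rewrite expn_gt0.
  by rewrite expnS; move: mJ; lia.
have -> : J.+1 + J.+1 = 2 * J + 2 by lia.
by move/eqP; rewrite cards_eq0 setD_eq0 => KB; apply/eqP; rewrite eqEsubset BK.
Qed.

End Core.

(** * The tree of runs *)

Section Tree.

Variables (rho L D : nat) (s : nat -> nat).
Hypothesis rho16 : 16 <= rho.
Hypothesis D_rho : 2 * rho <= D.
Hypothesis s_half : forall k, k < L -> s k = 2 * s k.+1.

Let rho0 : 0 < rho. Proof. exact: leq_trans rho16. Qed.

Lemma sum_children (k : nat) (F : nat -> nat) :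
  \sum_(i < rho ^ k.+1) F i = \sum_(j < rho ^ k) \sum_(b < rho) F (j * rho + b).
Proof. by rewrite expnSr sum_blocks. Qed.

Lemma sum_parent (k : nat) (F : nat -> nat) :
  \sum_(i < rho ^ k.+1) F (i %/ rho) = rho * \sum_(j < rho ^ k) F j.
Proof.
rewrite (sum_children k (fun i => F (i %/ rho))) big_distrr /=.
apply: eq_bigr => j _; rewrite (eq_bigr (fun=> F j)); first by rewrite sum_nat_const card_ord.
by move=> b _; rewrite divnMDl // divn_small ?addn0.
Qed.

Definition tsum (F : nat -> nat -> nat) := \sum_(k < L) \sum_(i < rho ^ k.+1) F k.+1 i.
Definition tsum0 (F : nat -> nat -> nat) := \sum_(k < L.+1) \sum_(i < rho ^ k) F k i.

Lemma tsum0E F : tsum0 F = F 0 0 + tsum F.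
Proof. by rewrite /tsum0 big_ord_recl expn0 big_ord1. Qed.

Lemma leq_tsum F G :
  (forall k i, 0 < k -> k <= L -> i < rho ^ k -> F k i <= G k i) -> tsum F <= tsum G.
Proof. by move=> H; apply: leq_sum => k _; apply: leq_sum => i _; apply: H => //=. Qed.

Lemma tsumD F G : tsum (fun k i => F k i + G k i) = tsum F + tsum G.
Proof. by rewrite -big_split; apply: eq_bigr => k _; rewrite big_split. Qed.

Lemma tsum_parent F : tsum (fun k i => 2 * (F k.-1 (i %/ rho) * s k)) <=
  rho * (F 0 0 * s 0 + tsum (fun k i => F k i * s k)).
Proof.
have -> : tsum (fun k i => 2 * (F k.-1 (i %/ rho) * s k)) =
    \sum_(k < L) rho * \sum_(j < rho ^ k) F k j * s k.
  apply: eq_bigr => k _; rewrite -(sum_parent k (fun j => F k j * s k)).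
  by apply: eq_bigr => i _ /=; rewrite (s_half (ltn_ord k)); ring.
rewrite -big_distrr leq_mul2l -(tsum0E (fun k i => F k i * s k)) /tsum0.
by rewrite big_ord_recr leq_addr orbT.
Qed.

(** Sizes halve from level to level, so s 1 + ... + s L is at most s 0. *)
Lemma tsum_one_per_level (P : nat -> nat -> bool) (x : nat -> nat) :
  (forall k i, 0 < k -> k <= L -> i < rho ^ k -> P k i -> i = x k) ->
  tsum (fun k i => P k i * s k) <= s 0.
Proof.
move=> Px; have lev k : k < L -> \sum_(i < rho ^ k.+1) P k.+1 i * s k.+1 <= s k.+1.
  move=> kL; have [xk|xk] := ltnP (x k.+1) (rho ^ k.+1).
    rewrite (bigD1 (Ordinal xk)) //= big1 ?addn0; first by case: (P _ _); rewrite ?mul1n.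
    move=> i ix; case: (boolP (P _ _)) => // /Px e; case/negP: ix.
    by apply/eqP/val_inj; rewrite /= e.
  rewrite big1 // => i _; case: (boolP (P _ _)) => // /Px e.
  by move: xk; rewrite -e // leqNgt ltn_ord.
apply: (@leq_trans (\sum_(k < L) s k.+1)); first by apply: leq_sum => k _; apply: lev.
suff H n : n <= L -> \sum_(k < n) s k.+1 + s n = s 0 by rewrite -(H L) // leq_addr.
elim: n => [|n IH] nL; first by rewrite big_ord0.
by rewrite big_ord_recr /= -(IH (ltnW nL)) (s_half nL) mul2n -addnn addnA.
Qed.

Variable dam : nat -> nat -> bool.

(* Every path of runs from a bad run to a leaf meets a damaged one. *)
Fixpoint bad_rec (n k i : nat) : bool :=
  dam k i || (if n is n'.+1 then [forall b : 'I_rho, bad_rec n' k.+1 (i * rho + b)] else false).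

Definition bad k i := bad_rec (L - k) k i.

Lemma bad_leaf i : bad L i = dam L i.
Proof. by rewrite /bad subnn /= orbF. Qed.

Lemma badE k i : k < L ->
  bad k i = dam k i || [forall b : 'I_rho, bad k.+1 (i * rho + b)].
Proof. by move=> kL; rewrite /bad -{1}(subnSK kL). Qed.

Lemma dam_bad k i : k <= L -> dam k i -> bad k i.
Proof. by move=> kL d; rewrite /bad; case: (L - k) => [|n] /=; rewrite d. Qed.

Let BD := tsum (fun k i => dam k i * s k).
Let B := tsum (fun k i => bad k i * s k).

Lemma bad_undam_children k i : k < L -> bad k i -> ~~ dam k i ->
  rho * s k = 2 * \sum_(b < rho) bad k.+1 (i * rho + b) * s k.+1.
Proof.
move=> kL; rewrite badE // => /orP[->//|/forallP all_bad] _.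
rewrite (eq_bigr (fun=> s k.+1)); last by move=> b _; rewrite all_bad mul1n.
by rewrite sum_nat_const card_ord (s_half kL); ring.
Qed.

(** All [rho] children of a bad undamaged run are bad and half as large, so together they have rho/2
    times its mass. A bad leaf is damaged. *)
Lemma bad_undam_mass : rho * ((bad 0 0 && ~~ dam 0 0) * s 0 +
  tsum (fun k i => (bad k i && ~~ dam k i) * s k)) <= 2 * B.
Proof.
rewrite -(tsum0E (fun k i => (bad k i && ~~ dam k i) * s k)) /tsum0 big_ord_recr /=.
rewrite [X in _ + X]big1 ?addn0; last by move=> i _; rewrite bad_leaf andbN.
rewrite /B /tsum !big_distrr; apply: leq_sum => k _.
rewrite (sum_children k (fun i => bad k.+1 i * s k.+1)) !big_distrr; apply: leq_sum => j _ /=.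
case: (boolP (bad k j && _)) => [/andP[bk dk]|]; last by rewrite mul0n muln0.
by rewrite mul1n (bad_undam_children (ltn_ord k) bk dk).
Qed.

Lemma bad_mass : B <= 2 * BD.
Proof.
have := bad_undam_mass; set U := tsum _ => UB.
have : B <= U + BD.
  rewrite /B /U /BD -tsumD; apply: leq_tsum => k i _ _ _ /=.
  by case: (bad k i); case: (dam k i); rewrite ?mul1n ?mul0n ?leq_addl ?leq_addr ?addn0.
move: UB; set c := _ * s 0; move: rho16; nia.
Qed.

(** Otherwise the bad mass below the root is at least 8 (s 0 + U), where U is its undamaged part;
    but it is at most U + 4 s 0. *)
Lemma root_not_bad : 0 < s 0 -> ~~ dam 0 0 -> BD <= 4 * s 0 -> ~~ bad 0 0.
Proof.
move=> s0 nd BDs; apply/negP=> b0; have := bad_undam_mass; rewrite b0 nd mul1n.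
set U := tsum _ => UB.
have : B <= U + BD.
  rewrite /B /U /BD -tsumD; apply: leq_tsum => k i _ _ _ /=.
  by case: (bad k i); case: (dam k i); rewrite ?mul1n ?mul0n ?leq_addl ?leq_addr ?addn0.
have : 16 * (s 0 + U) <= rho * (s 0 + U) by rewrite leq_mul2r rho16 orbT.
move: UB BDs s0; lia.
Qed.

(* [sz k i] senders take part in run (k, i), [ts] is the first epoch whose leaf informs
   the core and [start k i] the epoch in which run (k, i) takes place. *)
Variables (sz : nat -> nat -> nat) (big full : nat -> nat -> bool) (ts : nat).

Definition start k i := i * rho ^ (L - k).

Hypothesis sz_le : forall k i, 0 < k -> k <= L -> i < rho ^ k -> sz k i <= s k.-1.
Hypothesis small_shrink : forall k i, 0 < k -> k < L -> i < rho ^ k.+1 ->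
  ~~ big k (i %/ rho) -> sz k.+1 i * D <= sz k (i %/ rho).
Hypothesis small_child : forall k i, 0 < k -> k < L -> i < rho ^ k.+1 ->
  ~~ big k (i %/ rho) -> ~~ big k.+1 i.
Hypothesis big_late : forall k i, 0 < k -> k <= L -> i < rho ^ k ->
  ts < start k i -> big k i -> dam k.-1 (i %/ rho).
Hypothesis critical_parent : forall k i, 0 < k -> k <= L -> i < rho ^ k ->
  start k i < ts -> big k i -> ~~ full k i ->
  (1 < k) && (dam k.-1 (i %/ rho) || ~~ full k.-1 (i %/ rho)).
Hypothesis critical_unique : forall k i j, 0 < k -> k <= L -> j < rho ^ k ->
  i < j -> i %/ rho = j %/ rho -> big k i -> ~~ full k i -> ~~ big k j.
Hypothesis full_early : forall k i, 0 < k -> k <= L -> i < rho ^ k ->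
  start k i + rho ^ (L - k) <= ts -> full k i -> bad k i.

(* A critical run is charged to its parent, which is damaged or again critical and has
   twice as many virtual nodes; hence the total mass is geometric. *)
Let crit k i := [&& start k i < ts, big k i & ~~ full k i].

Lemma start_parent k i : 0 < k -> k <= L -> start k.-1 (i %/ rho) <= start k i.
Proof.
case: k => // k _ kL; rewrite /start /= -(subnSK kL) expnS mulnA leq_mul2r.
by rewrite leq_trunc_div orbT.
Qed.

Lemma critical_mass : tsum (fun k i => crit k i * s k) <= BD.
Proof.
set M := tsum _.
suff : 2 * M <= BD + M by lia.
rewrite /M /BD -tsumD /tsum big_distrr.
pose Q k i := (0 < k) * (dam k i * s k + crit k i * s k).
apply: (@leq_trans (\sum_(k < L) \sum_(i < rho ^ k) Q k i)); last first.
  apply: (@leq_trans (tsum0 Q)); first by rewrite /tsum0 big_ord_recr leq_addr.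
  rewrite tsum0E /Q mul0n add0n.
  apply: (@leq_tsum _ (fun k i => dam k i * s k + crit k i * s k)) => k i k0 _ _.
  by rewrite k0 mul1n.
apply: leq_sum => k _; have kL := ltn_ord k.
rewrite (sum_children k (fun i => crit k.+1 i * s k.+1)) big_distrr; apply: leq_sum => j _ /=.
have jb (b : 'I_rho) : j * rho + b < rho ^ k.+1.
  rewrite expnSr; apply: (@leq_trans (j * rho + rho)); first by rewrite ltn_add2l.
  by rewrite addnC -mulSn leq_mul2r ltn_ord orbT.
have dj (b : 'I_rho) : (j * rho + b) %/ rho = j by rewrite divnMDl // divn_small ?addn0.
have [/existsP[b cb]|none] := boolP [exists b : 'I_rho, crit k.+1 (j * rho + b)]; last first.
  rewrite big1 ?muln0 // => b _; case: (boolP (crit _ _)) => // cb.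
  by case/negP: none; apply/existsP; exists b.
(* By [critical_unique] no second child is critical, so the left side is 2 s k.+1 = s k. *)
rewrite (bigD1 b) //= cb mul1n big1 ?addn0; last first.
  move=> c cb'; case: (boolP (crit _ _)) => // cc.
  case/and3P: cb => _ bb fb; case/and3P: cc => _ bc fc.
  have [lt|lt|e] := ltngtP b c; last by case/negP: cb'; apply/eqP/val_inj.
    have := @critical_unique k.+1 (j * rho + b) (j * rho + c) isT kL (jb c).
    by rewrite !dj ltn_add2l lt => /(_ isT erefl bb fb); rewrite bc.
  have := @critical_unique k.+1 (j * rho + c) (j * rho + b) isT kL (jb b).
  by rewrite !dj ltn_add2l lt => /(_ isT erefl bc fc); rewrite bb.
case/and3P: cb => pre bb fb.
have /andP[k1' par'] := critical_parent (k := k.+1) isT kL (jb b) pre bb fb.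
have k1 : 0 < k by []; move: par'; rewrite dj /= => par; rewrite /Q k1 mul1n -(s_half kL).
case/orP: par => [->|nf]; first by rewrite mul1n leq_addr.
have bk : big k j.
  apply: contraTT bb => nb; apply: small_child => //; by rewrite dj.
have -> : crit k j.
  rewrite /crit bk nf /= andbT; apply: leq_ltn_trans pre.
  by rewrite -[X in start k X](dj b); apply: (@start_parent k.+1).
by rewrite mul1n leq_addl.
Qed.

(** A big run starts after [ts] and has a damaged parent, or its window contains [ts], which happens
    at most once per level, or it ended before. In the last case it is bad if it is full, and
    critical otherwise. *)
Lemma big_mass : tsum (fun k i => big k i * s k) <=
  2 * s 0 + rho * (dam 0 0 * s 0 + BD) + 3 * BD.
Proof.
pose P1 k i := (ts < start k i) && big k i.
pose P2 k i := (start k i <= ts < start k i + rho ^ (L - k)).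
pose P3 k i := bad k i.
have split_le : tsum (fun k i => big k i * s k) <=
    tsum (fun k i => P1 k i * s k) + (tsum (fun k i => P2 k i * s k)
    + (tsum (fun k i => bad k i * s k) + tsum (fun k i => crit k i * s k))).
  rewrite -!tsumD; apply: leq_tsum => k i k0 kL ib /=; rewrite -!mulnDl leq_mul2r.
  apply/orP; right; case: (boolP (big k i)) => // bk; rewrite /P1 bk andbT.
  have [//|le] := ltnP ts (start k i); rewrite /P2 le /=.
  have [//|w] := ltnP ts (start k i + rho ^ (L - k)); rewrite add0n.
  have pre : start k i < ts by apply: leq_trans w; rewrite -addn1 leq_add2l expn_gt0 rho0.
  case: (boolP (full k i)) => f; first by rewrite (full_early k0 kL ib w f).
  by rewrite /crit pre bk f leq_addl.
apply: (leq_trans split_le).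
have l1 : tsum (fun k i => P1 k i * s k) <= rho * (dam 0 0 * s 0 + BD).
  apply: leq_trans (tsum_parent (fun k i => dam k i : nat)).
  apply: leq_tsum => k i k0 kL ib /=; case: (boolP (P1 k i)) => // /andP[l b].
  by rewrite (big_late k0 kL ib l b) !mul1n leq_pmull.
have l2 : tsum (fun k i => P2 k i * s k) <= s 0.
  apply: (@tsum_one_per_level _ (fun k => ts %/ rho ^ (L - k))) => k i _ _ _.
  rewrite /P2 /start => /andP[a b].
  apply/eqP; rewrite eqn_leq leq_divRL ?expn_gt0 ?rho0 // a /= -ltnS ltn_divLR ?expn_gt0 ?rho0 //.
  by rewrite mulSn addnC.
have l3 := bad_mass; rewrite /B in l3.
have l4 := critical_mass; lia.
Qed.

(** A big run has at most s (k-1) = 2 s k senders. A run that is not big has at most s (k-1) below a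
    big parent or the root, and otherwise D times fewer than its parent. As a run has rho <= D/2
    children, the latter contribute a geometric series. *)
Lemma total_senders : tsum sz <= 2 * (rho + 1) * (s 0 + tsum (fun k i => big k i * s k)).
Proof.
set M := tsum (fun k i => big k i * s k).
pose f k i := if big k i then 0 else sz k i.
have l1 : tsum sz <= 2 * M + tsum f.
  have -> : 2 * M = tsum (fun k i => 2 * (big k i * s k)).
    rewrite /M /tsum big_distrr; apply: eq_bigr => k _; by rewrite big_distrr.
  rewrite -tsumD; apply: leq_tsum => -[//|k] i k0 kL ib; rewrite /f /=.
  have := sz_le k0 kL ib => /= le; case: (big _ _) => //.
  by rewrite mul1n addn0 -s_half.
pose g k i := if k == 0 then s 0 else if big k i then s k else 0.
pose h k i := if k == 0 then 0 else f k i.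
have l2 : D * tsum f <= D * (rho * (s 0 + M)) + rho * tsum f.
  have e : tsum f <= \sum_(k < L) \sum_(i < rho ^ k.+1) f k.+1 i by [].
  apply: (@leq_trans (\sum_(k < L) \sum_(i < rho ^ k.+1)
      (D * g k (i %/ rho) + h k (i %/ rho)))).
    rewrite /tsum big_distrr; apply: leq_sum => k _; rewrite big_distrr.
    apply: leq_sum => i _; rewrite /f /g /h /=; case: (boolP (big k.+1 i)) => [_|b]; first by rewrite muln0.
    have := @sz_le k.+1 i isT (ltn_ord k) (ltn_ord i) => /= le.
    have [k0|k0] := posnP k; first by have -> : s 0 = s k by [rewrite k0]; rewrite addn0 leq_mul2l le orbT.
    rewrite /f; case: (boolP (big k _)) => bp; first by rewrite addn0 leq_mul2l le orbT.
    by rewrite muln0 add0n mulnC; apply: small_shrink.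
  have eq1 : \sum_(k < L) \sum_(i < rho ^ k.+1) (D * g k (i %/ rho) + h k (i %/ rho)) =
      \sum_(k < L) rho * \sum_(j < rho ^ k) (D * g k j + h k j).
    by apply: eq_bigr => k _; rewrite -(sum_parent k (fun j => D * g k j + h k j)).
  rewrite eq1 -big_distrr.
  apply: (@leq_trans (rho * tsum0 (fun k j => D * g k j + h k j))).
    by rewrite leq_mul2l /tsum0 big_ord_recr leq_addr orbT.
  rewrite tsum0E tsumD {1}/g {1}/h /= addn0.
  have -> : tsum (fun k j => D * g k j) = D * M.
    rewrite /M /tsum big_distrr; apply: eq_bigr => k _; rewrite big_distrr.
    by apply: eq_bigr => i _; rewrite /g /=; case: (big _ _); rewrite ?mul1n.
  have -> : tsum h = tsum f by apply: eq_bigr.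
  by apply/eq_leq; ring.
have l3 : tsum f <= 2 * rho * (s 0 + M).
  have [D0|D0] := posnP D; first by move: D_rho rho0; rewrite D0; lia.
  have : D * tsum f <= D * (2 * rho * (s 0 + M)).
    have : 2 * (rho * tsum f) <= D * tsum f by rewrite mulnA leq_mul2r D_rho orbT.
    have -> : D * (2 * rho * (s 0 + M)) = 2 * (D * (rho * (s 0 + M))) by ring.
    lia.
  by rewrite leq_mul2l; case/orP => // /eqP e; rewrite e in D0.
apply: leq_trans l1 _.
have -> : 2 * (rho + 1) * (s 0 + M) = 2 * (s 0 + M) + 2 * rho * (s 0 + M) by ring.
by rewrite leq_add // leq_mul2l leq_addl.
Qed.

Lemma senders_bound (X : nat) : ~~ dam 0 0 -> BD <= X * s 0 ->
  tsum sz <= 2 * (rho + 1) * (3 + (rho + 3) * X) * s 0.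
Proof.
move=> nd BDX; apply: leq_trans total_senders _; rewrite -[leqRHS]mulnA leq_mul2l; apply/orP; right.
apply: leq_trans (leq_add (leqnn _) big_mass) _; rewrite (negbTE nd) mul0n add0n.
have : rho * BD <= rho * (X * s 0) by rewrite leq_mul2l BDX orbT.
have -> : (3 + (rho + 3) * X) * s 0 = 3 * s 0 + rho * (X * s 0) + 3 * (X * s 0) by ring.
lia.
Qed.

End Tree.

(** * The protocol *)

Definition cnt (m : nat) (P : pred nat) : nat := \sum_(x < m) P x.

(** [told] is a final value and [cert k i] the certificate obtained in run (k, i); one per run
    suffices, since a little node hosts at most one of its virtual nodes. The two [sent] flags let a
    node speak only once in each kind of flood. *)
Record node_state := NodeState {
  me : nat;
  clock : nat;
  bit : bool;
  bit_sent : bool;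
  cert : nat -> nat -> option bool;
  told : option bool;
  told_sent : bool;
  verdict : option bool
}.

Section Protocol.

(* Run (k, i), for i < rho ^ k, has [s k] virtual nodes; virtual node y of it lives at
   the little node [host k i y].  Run (0, 0) is the initial flood.  The senders of
   run (k, i) are the virtual nodes of its parent run (k - 1, i %/ rho), and [out k c y]
   lists the [d] virtual nodes that sender y addresses in the c-th child; these need
   [h c] equal votes to obtain a certificate.  Links of the flooding graph are given
   by [g]. *)

Variables (m L rho d len dg : nat) (s h : nat -> nat).
Variables (host : nat -> nat -> nat -> nat) (out : nat -> nat -> nat -> nat -> nat).
Variable g : nat -> nat -> nat.

Definition adjacent (x z : nat) : bool :=
  [&& x < m, z < m & [exists i : 'I_dg, (g x i == z) || (g z i == x)]].

Definition epoch_length := L + len.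
Definition last_round := m + rho ^ L * epoch_length.

(* Epoch e belongs to the leaf run (L, e); its round j executes the ancestor of depth
   j + 1 of that leaf, unless an earlier epoch did, so the tree is run depth first. *)
Definition run_at (r : nat) : option (nat * nat) :=
  let e := (r - m) %/ epoch_length in
  let j := (r - m) %% epoch_length in
  if [&& m <= r, r < last_round, j < L & rho ^ (L - j.+1) %| e]
  then Some (j.+1, e %/ rho ^ (L - j.+1)) else None.

Definition flood_at (r : nat) : bool :=
  [&& m <= r, r < last_round & L <= (r - m) %% epoch_length].

Definition linked (k i x z : nat) : bool :=
  [exists y : 'I_(s k.-1), [exists a : 'I_d,
    (host k.-1 (i %/ rho) y == x) && (host k i (out k (i %% rho) y a) == z)]].

Definition cert_of (st : node_state) (k i : nat) : option bool :=
  if k == 0 then Some (bit st) else cert st k i.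

(** The branches are the initial flood, a run, a flood of final values and the last round, in which
    the little node [z %% m] informs the outsider [z]. *)
Definition nsend (st : node_state) (z : nat) : option bool :=
  let r := clock st in
  if r < m then
    if [&& bit st, ~~ bit_sent st & adjacent (me st) z] then Some true else None
  else if run_at r is Some (k, i) then
    if (told st == None) && linked k i (me st) z then cert_of st k.-1 (i %/ rho) else None
  else if flood_at r then
    if ~~ told_sent st && adjacent (me st) z then told st else None
  else if [&& r == last_round, m <= z & z %% m == me st] then told st else None.

(** One bit stands for all parallel links between two hosts; the receiver knows the tables and
    restores the multiplicity. *)
Definition votes (k i x : nat) (msg : nat -> option bool) (v : bool) : nat :=
  \sum_(y < s k.-1) \sum_(a < d)
    ((out k (i %% rho) y a == x %/ 2 ^ k) && (msg (host k.-1 (i %/ rho) y) == Some v)).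

(** Only the virtual node [x %/ 2 ^ k] can live at [x], and the first test asks whether it does. If
    both bits have enough votes, [true] prevails. *)
Definition new_cert (k i x : nat) (msg : nat -> option bool) : option bool :=
  if host k i (x %/ 2 ^ k) == x then
    if h (i %% rho) <= votes k i x msg true then Some true
    else if h (i %% rho) <= votes k i x msg false then Some false else None
  else None.

Definition nrecv (st : node_state) (msg : nat -> option bool) : node_state :=
  let r := clock st in
  if r < m then
    NodeState (me st) r.+1 (bit st || [exists x : 'I_m, msg x != None]) (bit st)
      (cert st) (told st) (told_sent st) (verdict st)
  else if run_at r is Some (k, i) then
    let c := new_cert k i (me st) msg in
    NodeState (me st) r.+1 (bit st) (bit_sent st)
      (fun k' i' => if (k' == k) && (i' == i) then c else cert st k' i')
      (if (k == L) && (told st == None) then c else told st) (told_sent st) (verdict st)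
  else if flood_at r then
    NodeState (me st) r.+1 (bit st) (bit_sent st) (cert st)
      (if told st == None
       then if [pick x : 'I_m | msg x != None] is Some x then msg x else None
       else told st)
      (told_sent st || (told st != None)) (verdict st)
  else
    NodeState (me st) r.+1 (bit st) (bit_sent st) (cert st) (told st) (told_sent st)
      (if r == last_round then if me st < m then told st else msg (me st %% m)
       else verdict st).

(* The model has no messages from a node to itself, so a node adds its own. *)
Definition protocol (n' : nat) : algorithm n'.+1 := {|
  state := node_state;
  init := fun i b => NodeState i 0 b false (fun _ _ => None) None false None;
  send := fun st z => nsend st z;
  recv := fun st f =>
    nrecv st (fun x => if x == me st then nsend st x else f (inord x));
  output := fun st => if last_round < clock st then verdict st else None;
  halted := fun st => last_round < clock st
|}.

Variables (n' : nat) (adv : adversary n'.+1) (inp : 'I_n'.+1 -> bool).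
Notation n := n'.+1.
Notation A := (protocol n').
Hypothesis m0 : 0 < m.
Hypothesis mn : m <= n.

(** * Configurations, crashes and delivered messages *)

Definition st (r x : nat) : node_state := @config n A adv inp r (inord x).

Arguments st : simpl never.

(** Such a node has survived all rounds before r, but may crash while sending in round r;
    [up r.+1 x] guarantees that all its messages of round r leave. *)
Definition up (r x : nat) : bool :=
  if crash_time adv (inord x) is Some c then r <= c else true.

Lemma up_crashed r x : crashed_by adv r (inord x) = ~~ up r.+1 x.
Proof. by rewrite /crashed_by /up; case: crash_time => // c; rewrite -leqNgt. Qed.

Lemma up_le r r' x : r <= r' -> up r' x -> up r x.
Proof. by rewrite /up; case: crash_time => // c; apply: leq_trans. Qed.

Definition sent_to (r x z : nat) : option bool :=
  @message n A adv (@config n A adv inp r) r (inord x) (inord z).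

Definition msgs (r z x : nat) : option bool :=
  if x == z then nsend (st r z) x else sent_to r x z.

Lemma me_st r x : x < n -> me (st r x) = x.
Proof.
move=> xn; elim: r => [|r IH]; first by rewrite /st /= inordK.
rewrite /st /=; case: ifP => _ //=; rewrite -/(st r x).
rewrite /nrecv; case: ifP => _ //; case: (run_at _) => [[k i]|] //.
by case: ifP.
Qed.

Lemma clock_nrecv s' msg : clock (nrecv s' msg) = (clock s').+1.
Proof.
by rewrite /nrecv; case: ifP => _ //; case: (run_at _) => [[k i]|] //; case: ifP.
Qed.

Lemma clock_up r x : r <= last_round.+1 -> up r x -> clock (st r x) = r.
Proof.
elim: r => [|r IH] // rT ux.
have cr := IH (ltnW rT) (up_le (leqnSn r) ux).
rewrite /st /= -/(st r x) cr ltnNge -ltnS rT up_crashed ux /=.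
by rewrite clock_nrecv cr.
Qed.

Lemma st_down r x : ~~ up r.+1 x -> st r.+1 x = st r x.
Proof. by rewrite /st /= up_crashed => ->; rewrite orbT. Qed.

Lemma st_up r x : r <= last_round -> x < n -> up r.+1 x ->
  st r.+1 x = nrecv (st r x)
    (fun y => if y == x then nsend (st r x) y else
      [ffun j => @message n A adv (@config n A adv inp r) r j (inord x)] (inord y)).
Proof.
move=> rT xn ux; have cr := clock_up (leqW rT) (up_le (leqnSn r) ux).
rewrite {1}/st /= -/(st r x) cr ltnNge rT up_crashed ux /=.
by rewrite -/(st r x) me_st.
Qed.

Lemma st_end r x : last_round < r -> st r x = st last_round.+1 x.
Proof.
elim: r => [|r IH] // /[!ltnS]; rewrite leq_eqVlt => /orP[/eqP->//|lt].
rewrite -(IH lt); case: (boolP (up r.+1 x)) => [ux|]; last exact: st_down.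
have cT : clock (st r x) = last_round.+1.
  by rewrite (IH lt) clock_up // (up_le _ ux) // ltnW.
by rewrite {1}/st /= -/(st r x) cT ltnSn.
Qed.

Lemma sent_to_some r x z v : r <= last_round -> z < n ->
  sent_to r x z = Some v -> up r x /\ nsend (st r x) z = Some v.
Proof.
move=> rT zn; rewrite /sent_to /message /= -/(st r x) inordK //.
set m0' := (if _ then _ else _).
have m0P : m0' = Some v -> nsend (st r x) z = Some v by rewrite /m0'; case: ifP.
clearbody m0'; rewrite /up; case: crash_time => [c|]; last by move/m0P.
by case: ltngtP => //= _; [move/m0P | case: ifP => // _ /m0P].
Qed.

Lemma sent_to_full r x z : r <= last_round -> x < n -> z < n -> up r.+1 x -> x != z ->
  sent_to r x z = nsend (st r x) z.
Proof.
move=> rT xn zn ux xz; rewrite /sent_to /message /= -/(st r x) inordK //.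
have -> : (inord x == inord z :> 'I_n) = false.
  by apply/negbTE; apply: contra xz => /eqP e; rewrite -(inordK xn) e inordK.
rewrite (clock_up (leqW rT) (up_le (leqnSn r) ux)) ltnNge rT /=.
by move: ux; rewrite /up; case: crash_time => // c ->.
Qed.

Lemma sent_to_end r i j s' : last_round < r -> s' = @config n A adv inp r ->
  @message n A adv s' r i j = None.
Proof.
move=> rT ->; rewrite /message /=.
have cl : up last_round.+1 i -> clock (@config n A adv inp r i) = last_round.+1.
  by move=> u; have := clock_up (leqnn _) u; rewrite -(st_end i rT) /st inord_val.
move: cl; rewrite /up inord_val; case: crash_time => [c|] cl; last first.
  by rewrite cl // ltnSn.
case: ltngtP => // [rc|rc].
  by rewrite cl ?ltnSn // ltnW // (leq_ltn_trans rT).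
by rewrite cl ?ltnSn /= ?if_same // -rc.
Qed.

Lemma msgs_some r z x v : r <= last_round -> z < n -> up r.+1 z ->
  msgs r z x = Some v -> up r x /\ nsend (st r x) z = Some v.
Proof.
move=> rT zn uz; rewrite /msgs; case: eqP => [->|_]; last exact: sent_to_some.
by split=> //; exact: up_le uz.
Qed.

Lemma msgs_full r z x : r <= last_round -> x < n -> z < n -> up r.+1 x ->
  msgs r z x = nsend (st r x) z.
Proof.
by move=> rT xn zn ux; rewrite /msgs; case: eqP => [->//|/eqP]; exact: sent_to_full.
Qed.

Lemma st_step r z : r <= last_round -> z < n -> up r.+1 z ->
  exists2 msg, st r.+1 z = nrecv (st r z) msg & forall x, msg x = msgs r z x.
Proof.
move=> rT zn uz; rewrite (st_up rT zn uz); eexists; first by reflexivity.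
by move=> x /=; rewrite ffunE.
Qed.

Lemma st_cases r x : x < n -> st r.+1 x = st r x \/
  [/\ r <= last_round, up r.+1 x, clock (st r x) = r &
    exists2 msg, st r.+1 x = nrecv (st r x) msg & forall y, msg y = msgs r x y].
Proof.
move=> xn; case: (leqP r last_round) => [rT|rT]; last by left; rewrite !(st_end _ _) // ltnW.
case: (boolP (up r.+1 x)) => [ux|]; last by left; exact: st_down.
by right; split=> //; [apply: clock_up (leqW rT) (up_le (leqnSn r) ux) | exact: st_step].
Qed.

(** * The initial flood of the bit 1 *)

Lemma bit_mono r x : x < n -> bit (st r x) -> bit (st r.+1 x).
Proof.
move=> xn b; case: (st_cases r xn) => [-> //|[_ _ _ [msg -> _]]].
by rewrite /nrecv; case: ifP => _ /=; [rewrite b | case: run_at => [[k i]|] //=; case: ifP].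
Qed.

Lemma bit_const r x : x < n -> m <= r -> bit (st r x) = bit (st m x).
Proof.
move=> xn; elim: r => [|r IH] mr; first by move: m0 mr; rewrite leqn0; case: m.
move: mr; rewrite leq_eqVlt => /orP[/eqP->//|]; rewrite ltnS => mr; rewrite -(IH mr).
case: (st_cases r xn) => [-> //|[_ _ c [msg -> _]]].
rewrite /nrecv c ltnNge mr /=; by case: run_at => [[k i]|] //=; case: ifP.
Qed.

Lemma last_round_ge : m <= last_round. Proof. exact: leq_addr. Qed.

Lemma early_cases r x : x < n -> r < m -> st r.+1 x = st r x \/
  [/\ up r.+1 x, bit (st r.+1 x) = bit (st r x) || [exists y : 'I_m, msgs r x y != None]
    & bit_sent (st r.+1 x) = bit (st r x)].
Proof.
move=> xn rm; case: (st_cases r xn) => [|[_ u c [msg -> E]]]; [by left|right].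
rewrite /nrecv c rm /=; split=> //; congr (_ || _).
by apply: eq_existsb => y; rewrite E.
Qed.

Lemma early_up r x : x < n -> r < m -> up r.+1 x ->
  bit (st r.+1 x) = bit (st r x) || [exists y : 'I_m, msgs r x y != None]
  /\ bit_sent (st r.+1 x) = bit (st r x).
Proof.
move=> xn rm u; have rT : r <= last_round := leq_trans (ltnW rm) last_round_ge.
have [msg -> E] := st_step rT xn u.
rewrite /nrecv (clock_up (leqW rT) (up_le (leqnSn r) u)) rm /=; split=> //; congr (_ || _).
by apply: eq_existsb => y; rewrite E.
Qed.

Lemma early_msg r x z : x < n -> z < n -> r < m -> up r.+1 z -> msgs r z x != None ->
  [/\ up r x, bit (st r x), ~~ bit_sent (st r x) & x < m].
Proof.
move=> xn zn rm uz; have rT : r <= last_round := leq_trans (ltnW rm) last_round_ge.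
case e : (msgs r z x) => [v|] // _; have [ux] := msgs_some rT zn uz e.
rewrite /nsend (clock_up (leqW rT) ux) rm; case: ifP => // /and3P[-> ->].
by rewrite /adjacent me_st // => /and3P[].
Qed.

Lemma cntS_le (P Q : pred nat) k : (forall x, x < k -> P x -> Q x) -> cnt k P <= cnt k Q.
Proof.
move=> H; apply: leq_sum => x _; case: (boolP (P x)) => // /(H _ (ltn_ord x)) -> //.
Qed.

Lemma cnt_le k P : cnt k P <= k.
Proof.
rewrite -[leqRHS](card_ord k) -sum1_card; apply: leq_sum => x _; exact: leq_b1.
Qed.

Lemma cnt_ltn (P Q : pred nat) k z : (forall x, x < k -> P x -> Q x) -> z < k -> Q z -> ~~ P z ->
  cnt k P < cnt k Q.
Proof.
move=> H zk Qz Pz; rewrite /cnt (bigD1 (Ordinal zk)) // [ltnRHS](bigD1 (Ordinal zk)) //=.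
rewrite Qz (negbTE Pz) add0n add1n ltnS; apply: leq_sum => x _.
by case: (boolP (P x)) => // /(H _ (ltn_ord x)) ->.
Qed.

(* A node that first holds the bit 1 in round r ends a chain of r + 1 such nodes. *)
Lemma fresh_late r x : r <= m -> x < m -> up r x -> bit (st r x) -> ~~ bit_sent (st r x) ->
  r < cnt m (fun y => bit (st r y)).
Proof.
elim: r x => [|r IH] x rm xm ux bx nx.
  rewrite /cnt (bigD1 (Ordinal xm)) // addn_gt0; apply/orP; left.
  by rewrite lt0b; exact: bx.
have xn := leq_trans xm mn.
have [b_eq s_eq] := early_up xn rm ux; rewrite s_eq in nx.
move: bx; rewrite b_eq (negbTE nx) => /existsP[y yx].
have yn : y < n := leq_trans (ltn_ord y) mn.
have [uy by_ ny ym] := early_msg yn xn rm ux yx.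
have := IH y (ltnW rm) ym uy by_ ny; rewrite -ltnS => /leq_trans; apply.
apply: (cnt_ltn (z := x)) => //; last by rewrite b_eq (negbTE nx) /=; apply/existsP; exists y.
by move=> z zm; apply: bit_mono; exact: leq_trans zm mn.
Qed.

Lemma adjacentC x z : adjacent x z = adjacent z x.
Proof.
rewrite /adjacent andbCA; congr [&& _, _ & _].
by apply: eq_existsb => i; rewrite orbC.
Qed.

Lemma adjacent_lt x z : adjacent x z -> x < m /\ z < m.
Proof. by case/and3P. Qed.

Lemma bit_sent_spread r x z : r <= m -> adjacent x z -> up r x -> up r z ->
  bit_sent (st r x) -> bit (st r z).
Proof.
move=> rm xz; have [xm zm] := adjacent_lt xz.
have xn := leq_trans xm mn; have zn := leq_trans zm mn.
elim: r rm => [|r IH] rm ux uz //.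
have [_ s_eq] := early_up xn rm ux; have [b_eq _] := early_up zn rm uz.
have rT : r <= last_round := leq_trans (ltnW rm) last_round_ge.
rewrite s_eq => bx; case: (boolP (bit_sent (st r x))) => [sx|ns].
  by rewrite b_eq (IH (ltnW rm) (up_le (leqnSn r) ux) (up_le (leqnSn r) uz) sx).
rewrite b_eq; apply/orP; right; apply/existsP; exists (Ordinal xm).
rewrite msgs_full //= /nsend (clock_up (leqW rT) (up_le (leqnSn r) ux)) rm me_st //.
by rewrite bx ns xz.
Qed.

(** By [fresh_late], a node with the bit still unsent after m rounds would require more than m
    little nodes holding it. *)
Lemma bits_spread x z : adjacent x z -> up m x -> up m z -> bit (st m x) -> bit (st m z).
Proof.
move=> xz ux uz bx; have [xm zm] := adjacent_lt xz.
apply: (bit_sent_spread (leqnn m) xz) => //; apply: contraT => ns.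
by have := fresh_late (leqnn m) xm ux bx ns; rewrite ltnNge cnt_le.
Qed.

Lemma bit_valid r x : x < n -> bit (st r x) -> exists j, inp j.
Proof.
elim: r x => [|r IH] x xn; first by rewrite /st /= => b; exists (inord x).
have [rm|mr] := ltnP r m; last first.
  by rewrite (bit_const xn (leqW mr)) -(bit_const xn mr); exact: IH.
case: (early_cases xn rm) => [->|[ux -> _]]; first exact: IH.
case/orP => [|/existsP[y yx]]; first exact: IH.
have yn : y < n := leq_trans (ltn_ord y) mn.
by have [_ b _ _] := early_msg yn xn rm ux yx; exact: IH b.
Qed.

Lemma bit_init r x : x < n -> inp (inord x) -> bit (st r x).
Proof. by move=> xn b; elim: r => [//|r IH]; exact: bit_mono. Qed.

(** * The timing of the runs *)

Definition round k i := m + i * rho ^ (L - k) * epoch_length + k.-1.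

Hypothesis rho0 : 0 < rho.

Lemma run_atP r k i :
  reflect ([/\ 0 < k, k <= L, i < rho ^ k & r = round k i]) (run_at r == Some (k, i)).
Proof.
have rp j : 0 < rho ^ j by rewrite expn_gt0 rho0.
rewrite /run_at; apply: (iffP eqP) => [|[k0 kL ik ->]].
  set e := _ %/ _; set j := _ %% _; case: ifP => // /and4P[mr rl jL div] [<- <-].
  have split_r : r - m = e * epoch_length + j by rewrite /e /j -divn_eq.
  have eq_e : e %/ rho ^ (L - j.+1) * rho ^ (L - j.+1) = e by rewrite divnK.
  split=> //; last by rewrite /round eq_e /= -addnA -split_r subnKC.
  rewrite ltn_divLR // -expnD subnKC // ltn_divLR ?(leq_trans _ (leq_addr _ _)) //; first by rewrite ltn_subLR.
  exact: leq_trans jL.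
have E0 : 0 < epoch_length by apply: leq_trans (leq_addr _ _); apply: leq_trans kL.
have kE : k.-1 < epoch_length by rewrite prednK // (leq_trans kL) // leq_addr.
rewrite /round -addnA addKn divnMDl // divn_small // addn0 modnMDl modn_small //.
rewrite prednK // mulnK // dvdn_mull // kL leq_addr /= andbT.
case: ifP => //; rewrite ltn_add2l.
suff -> : i * rho ^ (L - k) * epoch_length + k.-1 < rho ^ L * epoch_length by [].
apply: (@leq_trans ((i * rho ^ (L - k)).+1 * epoch_length)).
  by rewrite mulSn addnC ltn_add2r.
rewrite leq_mul2r; apply/orP; right.
apply: (@leq_trans (i.+1 * rho ^ (L - k))); first by rewrite mulSn addnC -addn1 leq_add2l.
by rewrite -(subnKC kL) expnD addKn leq_mul2r ik orbT.
Qed.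

Definition is_run k i := [&& 0 < k, k <= L & i < rho ^ k].

Lemma run_at_round k i : is_run k i -> run_at (round k i) = Some (k, i).
Proof. by case/and3P=> a b c; apply/eqP/run_atP. Qed.

Lemma run_at_Some r k i : run_at r = Some (k, i) -> is_run k i /\ r = round k i.
Proof. by move/eqP/run_atP => [a b c ->]; rewrite /is_run a b c. Qed.

Lemma round_ge k i : m <= round k i. Proof. by rewrite /round -addnA leq_addr. Qed.

Lemma round_lt k i : is_run k i -> round k i < last_round.
Proof. by move/run_at_round; rewrite /run_at; case: ifP => // /and4P[]. Qed.

Lemma cert_step r x k i : x < n -> cert (st r.+1 x) k i != cert (st r x) k i ->
  run_at r = Some (k, i).
Proof.
move=> xn; case: (st_cases r xn) => [->|[_ _ c [msg -> _]]]; first by rewrite eqxx.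
rewrite /nrecv c; case: ifP => _ /=; first by rewrite eqxx.
case: run_at => [[k' i']|] /=; last by case: ifP => _ /=; rewrite eqxx.
by case: ifP => [/andP[/eqP-> /eqP->]|]; rewrite ?eqxx.
Qed.

Lemma cert_const r x k i : x < n -> round k i < r ->
  cert (st r x) k i = cert (st (round k i).+1 x) k i.
Proof.
move=> xn; elim: r => [//|r IH]; rewrite ltnS leq_eqVlt => /orP[/eqP->//|lt].
rewrite -(IH lt); apply/eqP.
by apply: contraLR lt => /(cert_step xn)/run_at_Some[_ ->]; rewrite ltnn.
Qed.

Lemma run_step k i x : x < n -> is_run k i -> up (round k i).+1 x ->
  cert (st (round k i).+1 x) k i = new_cert k i x (msgs (round k i) x) /\
  told (st (round k i).+1 x) =
    if (k == L) && (told (st (round k i) x) == None)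
    then cert (st (round k i).+1 x) k i else told (st (round k i) x).
Proof.
move=> xn run ux; have rT := ltnW (round_lt run).
have [msg -> E] := st_step rT xn ux.
rewrite /nrecv (clock_up (leqW rT) (up_le (leqnSn _) ux)) ltnNge round_ge /= run_at_round //=.
rewrite !eqxx /= me_st //; split=> //.
have vE v : votes k i x msg v = votes k i x (msgs (round k i) x) v.
  by apply: eq_bigr => y _; apply: eq_bigr => a _; rewrite E.
by rewrite /new_cert !vE.
Qed.

Hypothesis L0 : 0 < L.
Hypothesis s0 : s 0 = m.
Hypothesis host0 : forall i y, host 0 i y = y.
Hypothesis host_lt : forall k i y, k <= L -> i < rho ^ k -> y < s k -> host k i y < m.
Hypothesis host_block : forall k i y, k <= L -> i < rho ^ k -> y < s k -> host k i y %/ 2 ^ k = y.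
Hypothesis out_lt : forall k b y a, 0 < k -> k <= L -> b < rho -> y < s k.-1 -> a < d ->
  out k b y a < s k.
Hypothesis h0 : forall b, 0 < h b.

(** * Certificates and their senders *)

Definition source k i y := host k.-1 (i %/ rho) y.

Definition offers (t : nat) (u : bool) k i y :=
  [&& up t (source k i y), told (st (round k i) (source k i y)) == None
    & cert_of (st (round k i) (source k i y)) k.-1 (i %/ rho) == Some u].

(* Members of [senders] may crash while sending; those of [full_senders] reach everybody. *)
Definition senders u k i := offers (round k i) u k i.

Definition full_senders u k i := offers (round k i).+1 u k i.

Definition holds (u : bool) k i y :=
  if k == 0 then up m y && (bit (st m y) == u)
  else up (round k i).+1 (host k i y) &&
    (cert (st (round k i).+1 (host k i y)) k i == Some u).

Definition deg k b (W : pred nat) x : nat :=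
  \sum_(y < s k.-1) \sum_(a < d) (W y && (out k b y a == x)).

Lemma parent_run k i : is_run k i -> k.-1 <= L /\ i %/ rho < rho ^ k.-1.
Proof.
case/and3P=> k0 kL ik; split; first exact: leq_trans (leq_pred _) kL.
by rewrite ltn_divLR // -expnSr prednK.
Qed.

Lemma source_lt k i y : is_run k i -> y < s k.-1 -> source k i y < m.
Proof. by move=> /parent_run[a b] ys; apply: host_lt. Qed.

Lemma run_host_lt k i y : is_run k i -> y < s k -> host k i y < m.
Proof. by case/and3P=> _ a b; apply: host_lt. Qed.

Lemma nsend_run k i x z : is_run k i -> up (round k i) x -> x < n ->
  nsend (st (round k i) x) z =
    if (told (st (round k i) x) == None) && linked k i x z
    then cert_of (st (round k i) x) k.-1 (i %/ rho) else None.
Proof.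
move=> run ux xn; rewrite /nsend clock_up //; last by rewrite leqW // ltnW // round_lt.
by rewrite ltnNge round_ge /= run_at_round // me_st.
Qed.

(** A sender that crashes in this round may still be heard, so the upper bound counts all [senders],
    while [le_votes] can rely on [full_senders] only. *)
Lemma votes_le k i x u : is_run k i -> up (round k i).+1 x -> x < n ->
  votes k i x (msgs (round k i) x) u <= deg k (i %% rho) (senders u k i) (x %/ 2 ^ k).
Proof.
move=> run ux xn; apply: leq_sum => y _; apply: leq_sum => a _.
rewrite [in leqRHS]andbC; case: eqP => //= _.
case: eqP => // e; have rT := ltnW (round_lt run).
have xsn : source k i y < n := leq_trans (source_lt run (ltn_ord y)) mn.
have [us] := msgs_some rT xn ux e; rewrite nsend_run //.
case: ifP => // /andP[t _] c; rewrite /senders /offers -/(source k i y) in us t c *.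
by rewrite us t c eqxx.
Qed.

Lemma le_votes k i x u : is_run k i -> up (round k i).+1 x -> x < n ->
  host k i (x %/ 2 ^ k) = x ->
  deg k (i %% rho) (full_senders u k i) (x %/ 2 ^ k) <= votes k i x (msgs (round k i) x) u.
Proof.
move=> run ux xn hx; apply: leq_sum => y _; apply: leq_sum => a _.
rewrite andbC; case: eqP => //= oe; case: (boolP (full_senders _ _ _ _)) => // /and3P[us t c].
have rT := ltnW (round_lt run).
have xsn : source k i y < n := leq_trans (source_lt run (ltn_ord y)) mn.
rewrite msgs_full // nsend_run ?(up_le (leqnSn _) us) // t.
suff -> : linked k i (source k i y) x by rewrite /= (eqP c) eqxx.
by apply/existsP; exists y; apply/existsP; exists a; rewrite /source eqxx oe hx eqxx.
Qed.

Lemma holds_deg u k i x : is_run k i -> x < s k -> holds u k i x ->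
  h (i %% rho) <= deg k (i %% rho) (senders u k i) x.
Proof.
move=> run xs; have [k0 kL ik] := and3P run; rewrite /holds eqn0Ngt k0 /=.
have hm := run_host_lt run xs; have hn := leq_trans hm mn.
case/andP=> ux; have [-> _] := run_step hn run ux; rewrite /new_cert host_block // eqxx.
have V v := votes_le v run ux hn; rewrite host_block // in V.
case: ifP => [le /eqP[<-]|_]; first exact: leq_trans le (V _).
by case: ifP => [le /eqP[<-]|//]; exact: leq_trans le (V _).
Qed.

Lemma deg_holds u k i x : is_run k i -> x < s k -> up (round k i).+1 (host k i x) ->
  h (i %% rho) <= deg k (i %% rho) (full_senders u k i) x ->
  deg k (i %% rho) (senders (~~ u) k i) x < h (i %% rho) -> holds u k i x.
Proof.
move=> run xs ux le1 lt2; have [k0 kL ik] := and3P run.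
rewrite /holds eqn0Ngt k0 /= ux.
have hm := run_host_lt run xs; have hn := leq_trans hm mn.
have [-> _] := run_step hn run ux; rewrite /new_cert host_block // eqxx.
have := le_votes u run ux hn; rewrite host_block // => /(_ erefl) /(leq_trans le1) v1.
have := votes_le (~~ u) run ux hn; rewrite host_block // => /leq_ltn_trans /(_ lt2).
by case: u v1 {le1 lt2} => v1 /= v2; rewrite v1 // leqNgt v2.
Qed.

Lemma cert_ofS r x k i : 0 < k -> cert_of (st r x) k i = cert (st r x) k i.
Proof. by rewrite /cert_of eqn0Ngt => ->. Qed.

Lemma round_parent k i : is_run k i -> 1 < k -> round k.-1 (i %/ rho) < round k i.
Proof.
case: k => [|[|k]] // /and3P[_ kL _] _; rewrite /round /= -addnA -[ltnRHS]addnA ltn_add2l.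
rewrite addnS ltnS leq_add2r leq_mul2r; apply/orP; right.
by rewrite -(subnSK kL) expnS mulnA leq_mul2r leq_trunc_div orbT.
Qed.

Lemma round_mono k i j : is_run k i -> is_run k j -> i < j -> round k i < round k j.
Proof.
move=> /and3P[k0 kL _] _ ij; rewrite /round ltn_add2r ltn_add2l ltn_mul2r ltn_mul2r ij andbT.
by rewrite expn_gt0 rho0 (leq_trans L0) // leq_addr.
Qed.

Lemma cert_of_fixed k i x r : is_run k i -> x < n -> round k i <= r ->
  cert_of (st r x) k.-1 (i %/ rho) = cert_of (st (round k i) x) k.-1 (i %/ rho).
Proof.
move=> run xn le; case: (ltnP 1 k) => k1.
  have lt := round_parent run k1; rewrite !cert_ofS; try by case: (k) k1 => [|[]].
  by rewrite (cert_const xn (leq_trans lt le)) (cert_const xn lt).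
have -> : k = 1 by case/and3P: run; lia.
rewrite /cert_of /= (bit_const xn (leq_trans (round_ge _ _) le)).
by rewrite (bit_const xn (round_ge _ _)).
Qed.

Lemma senders_hold u k i y : is_run k i -> y < s k.-1 -> senders u k i y ->
  holds u k.-1 (i %/ rho) y.
Proof.
move=> run ys /and3P[us _]; have sm := source_lt run ys; have sn := leq_trans sm mn.
case: (ltnP 1 k) => k1.
  have k10 : 0 < k.-1 by case: (k) k1 => [|[]].
  have lt := round_parent run k1; rewrite cert_ofS // (cert_const sn lt) => c.
  by rewrite /holds eqn0Ngt k10 /= (up_le lt us) c.
have k1E : k = 1 by case/and3P: run; lia.
move: us; rewrite k1E /holds /= /cert_of /= /source /= host0 => us.
rewrite (bit_const _ (round_ge _ _)); last by move: sn; rewrite /source k1E host0.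
by move/eqP=> [->]; rewrite eqxx andbT; apply: up_le us; exact: round_ge.
Qed.

Lemma hold_senders u k i y : is_run k i -> y < s k.-1 -> holds u k.-1 (i %/ rho) y ->
  up (round k i).+1 (source k i y) -> told (st (round k i) (source k i y)) = None ->
  full_senders u k i y.
Proof.
move=> run ys hy us t; rewrite /full_senders /offers us t eqxx /=.
have sm := source_lt run ys; have sn := leq_trans sm mn.
case: (ltnP 1 k) => k1.
  have k10 : 0 < k.-1 by case: (k) k1 => [|[]].
  have lt := round_parent run k1; rewrite cert_ofS // (cert_const sn lt).
  by move: hy; rewrite /holds eqn0Ngt k10 => /andP[].
have k1E : k = 1 by case/and3P: run; lia.
move: hy sn; rewrite k1E /holds /= /source /= /cert_of /= !host0 => /andP[_ /eqP<-] yn.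
by rewrite (bit_const yn (round_ge _ _)).
Qed.

(** * Final values and their floods *)

Lemma told_step r x : x < n -> told (st r x) != None -> told (st r.+1 x) = told (st r x).
Proof.
move=> xn t; case: (st_cases r xn) => [-> //|[_ _ c [msg -> _]]].
rewrite /nrecv c; case: ifP => _ //=; case: run_at => [[k i]|] /=.
  by rewrite (negbTE t) andbF.
by case: ifP => _ //=; rewrite (negbTE t).
Qed.

Lemma told_mono r r' x : x < n -> r <= r' -> told (st r x) != None ->
  told (st r' x) = told (st r x).
Proof.
move=> xn /subnKC <- t; elim: (r' - r) => [|j IH]; first by rewrite addn0.
by rewrite addnS told_step // IH.
Qed.

(** The certificates of the parent are fixed before its first child runs, final values are never
    lost, and a later sender has not crashed earlier; so senders only dwindle from sibling to
    sibling. *)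
Lemma senders_sibling u k i j y : is_run k i -> is_run k j -> i < j ->
  i %/ rho = j %/ rho -> y < s k.-1 -> senders u k j y -> full_senders u k i y.
Proof.
move=> ri rj ij ep ys; have lt := round_mono ri rj ij.
have sm := source_lt rj ys; have sn := leq_trans sm mn.
rewrite /senders /full_senders /offers (_ : source k i y = source k j y); last by rewrite /source ep.
case/and3P=> us /eqP t c; rewrite (up_le lt us) /=; apply/andP; split.
  by apply/eqP; apply/eqP; apply: contraT => t'; rewrite (told_mono sn (ltnW lt) t') in t; rewrite t in t'.
by move: c; rewrite -ep (cert_of_fixed ri sn (ltnW lt)).
Qed.

Lemma leaf_told u i x : is_run L i -> x < s L -> holds u L i x ->
  told (st (round L i).+1 (host L i x)) != None.
Proof.
move=> run xs; rewrite /holds eqn0Ngt L0 /= => /andP[ux /eqP c].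
have hn := leq_trans (run_host_lt run xs) mn.
have [_ ->] := run_step hn run ux; rewrite eqxx c /=.
by case: (told _).
Qed.

Lemma votes_pos k i x u msg : is_run k i -> 0 < votes k i x msg u -> x %/ 2 ^ k < s k.
Proof.
move=> /and3P[k0 kL ik]; rewrite lt0n sum_nat_eq0 negb_forall => /existsP[y].
rewrite implyTb sum_nat_eq0 negb_forall => /existsP[a]; rewrite implyTb.
rewrite -lt0n lt0b => /andP[/eqP<- _]; apply: out_lt => //; exact: ltn_pmod.
Qed.

(** A node acquires a final value only by a certificate in a leaf or from a node that has one
    already; trace it back by induction on the round. *)
Lemma told_holds r x u : x < n -> told (st r x) = Some u ->
  exists i y, [/\ i < rho ^ L, y < s L & holds u L i y].
Proof.
elim: r x => [//|r IH] x xn; case: (st_cases r xn) => [->|]; first exact: IH.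
case=> rT ux c [msg e E] tu.
case e0 : (told (st r x)) => [u'|].
  by move: tu; rewrite told_step ?e0 // => -[uE]; apply: IH xn _; rewrite e0 uE.
case er : (run_at r) => [[k i]|].
  have [run rE] := run_at_Some er; have := run_step xn run; rewrite -rE => /(_ ux)[cE tE].
  move: tu; rewrite tE e0 eqxx andbT; case: eqP => [kL|//] cu.
  have hx : host k i (x %/ 2 ^ k) = x.
    by move: cu; rewrite cE /new_cert; case: eqP.
  have xs : x %/ 2 ^ k < s k.
    move: cu; rewrite cE /new_cert hx eqxx; case: ifP => [le _|_].
      by apply: (votes_pos run); apply: leq_trans le.
    by case: ifP => // le _; apply: (votes_pos run); apply: leq_trans le.
  exists i, (x %/ 2 ^ L); rewrite -kL; split=> //; first by case/and3P: run.
  have [k0 _ _] := and3P run.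
  by rewrite /holds eqn0Ngt k0 /= hx -rE ux cu eqxx.
move: tu; rewrite e /nrecv c er; case: ifP => [_|rm] /=; first by rewrite e0.
case: ifP => [fl|_] /=; last by rewrite e0.
rewrite e0 eqxx; case: pickP => [y|//]; rewrite E => _ my.
have yn : y < n := leq_trans (ltn_ord y) mn.
have [uy] := msgs_some rT xn ux my.
by rewrite /nsend (clock_up (leqW rT) uy) rm er fl; case: ifP => // _; exact: IH.
Qed.

Lemma flood_run r : flood_at r -> run_at r = None.
Proof. by case/and3P=> _ _ Lr; rewrite /run_at (ltnNge _ L) Lr /= !andbF. Qed.

Lemma flood_send r x z : flood_at r -> up r.+1 x -> x < n ->
  ~~ told_sent (st r x) -> adjacent x z -> nsend (st r x) z = told (st r x).
Proof.
move=> fl ux xn ns xz; have [mr rl Lr] := and3P fl.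
rewrite /nsend (clock_up (leqW (ltnW rl)) (up_le (leqnSn r) ux)) ltnNge mr /= flood_run // fl.
by rewrite ns me_st // xz.
Qed.

Lemma flood_recv r x z : flood_at r -> up r.+1 z -> x < m -> z < n ->
  msgs r z x != None -> told (st r.+1 z) != None.
Proof.
move=> fl uz xm zn mx; have [mr rl Lr] := and3P fl; have rT := ltnW rl.
have [msg -> E] := st_step rT zn uz.
rewrite /nrecv (clock_up (leqW rT) (up_le (leqnSn r) uz)) ltnNge mr /= flood_run // fl /=.
case: ifP => [_|/negbT //].
by case: pickP => [//|/(_ (Ordinal xm))]; rewrite /= E ?mx // => y.
Qed.

Lemma told_sent_spread r x z : adjacent x z -> up r x -> up r z ->
  told_sent (st r x) -> told (st r z) != None.
Proof.
move=> xz; have [xm zm] := adjacent_lt xz.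
have xn := leq_trans xm mn; have zn := leq_trans zm mn.
elim: r => [//|r IH] ux uz sx.
have ux' := up_le (leqnSn r) ux; have uz' := up_le (leqnSn r) uz.
case: (boolP (told_sent (st r x))) => [sx'|ns].
  by rewrite told_step // IH.
case: (st_cases r xn) => [e|[rT _ c [msg e E]]]; first by rewrite e (negbTE ns) in sx.
have fl : flood_at r && (told (st r x) != None).
  move: sx; rewrite e /nrecv c; case: ifP => _ /=; first by rewrite (negbTE ns).
  case: run_at => [[k i]|] /=; first by rewrite (negbTE ns).
  by case: ifP => fl /=; rewrite (negbTE ns) // => ->.
case/andP: fl => fl t; apply: (flood_recv fl uz xm zn).
by rewrite msgs_full // (flood_send fl).
Qed.

Lemma flood_spread r x z : flood_at r -> adjacent x z -> up r.+1 x -> up r.+1 z ->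
  told (st r x) != None -> told (st r.+1 z) != None.
Proof.
move=> fl xz ux uz t; have [xm zm] := adjacent_lt xz.
have xn := leq_trans xm mn; have zn := leq_trans zm mn.
have ux' := up_le (leqnSn r) ux; have uz' := up_le (leqnSn r) uz.
have [_ rl _] := and3P fl; have rT := ltnW rl.
case: (boolP (told_sent (st r x))) => [sx|ns].
  by rewrite told_step // (told_sent_spread xz).
by apply: (flood_recv fl uz xm zn); rewrite msgs_full // (flood_send fl).
Qed.

Lemma run_last : run_at last_round = None.
Proof. by rewrite /run_at ltnn !andbF. Qed.

Lemma flood_last : flood_at last_round = false.
Proof. by rewrite /flood_at ltnn !andbF. Qed.

Lemma last_step x : x < n -> up last_round.+1 x ->
  verdict (st last_round.+1 x) =
    if x < m then told (st last_round x) else msgs last_round x (x %% m).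
Proof.
move=> xn ux; have [msg -> E] := st_step (leqnn _) xn ux.
rewrite /nrecv clock_up ?(up_le (leqnSn _) ux) // ltnNge last_round_ge run_last flood_last /=.
by rewrite eqxx me_st // E.
Qed.

Lemma clock_down r x : x < n -> ~~ up last_round.+1 x -> clock (st r x) <= last_round.
Proof.
move=> xn nu; elim: r => [//|r IH]; case: (st_cases r xn) => [-> //|[rT ux c [msg -> _]]].
rewrite clock_nrecv c; move: rT; rewrite leq_eqVlt => /orP[/eqP e|//].
by rewrite e in ux; rewrite ux in nu.
Qed.

Lemma clock_le r x : x < n -> clock (st r x) <= r.
Proof.
move=> xn; elim: r => [//|r IH]; case: (st_cases r xn) => [->|[_ _ c [msg -> _]]].
  exact: leqW.
by rewrite clock_nrecv c.
Qed.

Lemma halted_up r x : x < n -> last_round < clock (st r x) ->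
  up last_round.+1 x /\ st r x = st last_round.+1 x.
Proof.
move=> xn c; split.
  by apply: contraLR c => nu; rewrite -leqNgt clock_down.
by apply: st_end; apply: leq_trans c (clock_le r xn).
Qed.

Lemma verdict_told x v : x < n -> up last_round.+1 x ->
  verdict (st last_round.+1 x) = Some v ->
  exists2 y, y < m & told (st last_round y) = Some v.
Proof.
move=> xn ux; rewrite last_step //; case: ltnP => [xm|mx]; first by exists x.
move=> /(msgs_some (leqnn _) xn ux)[uy]; rewrite /nsend clock_up //.
rewrite ltnNge last_round_ge run_last flood_last /=; case: ifP => // _ t.
by exists (x %% m) => //; rewrite ltn_mod.
Qed.

Lemma verdict_little x : x < m -> up last_round.+1 x ->
  verdict (st last_round.+1 x) = told (st last_round x).
Proof. by move=> xm ux; rewrite last_step ?xm // (leq_trans xm). Qed.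

Lemma verdict_outsider x : x < n -> m <= x -> up last_round.+1 x ->
  up last_round.+1 (x %% m) -> verdict (st last_round.+1 x) = told (st last_round (x %% m)).
Proof.
move=> xn mx ux ur; have rm : x %% m < m by rewrite ltn_mod.
have rn := leq_trans rm mn; rewrite last_step // ltnNge mx /= msgs_full //.
rewrite /nsend clock_up ?(up_le (leqnSn _) ur) // ltnNge last_round_ge run_last flood_last /=.
by rewrite eqxx mx me_st // eqxx.
Qed.

(** * Counting messages *)

Definition bit_fire r x := [&& r < m, up r x, bit (st r x) & ~~ bit_sent (st r x)].

Definition told_fire r x := [&& flood_at r, up r x & ~~ told_sent (st r x) && (told (st r x) != None)].

Lemma bit_fire_once r r' x : x < n -> r < r' -> bit_fire r x -> ~~ bit_fire r' x.
Proof.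
move=> xn rr /and4P[rm _ b _]; apply/negP=> /and4P[r'm u' _ /negP[]].
case: r' rr r'm u' => // r' rr r'm u'; have [_ ->] := early_up xn (ltnW r'm) u'.
move: rr; rewrite ltnS => /subnKC <-; elim: (r' - r) => [|j IH]; first by rewrite addn0.
by rewrite addnS; exact: bit_mono.
Qed.

Lemma told_sent_mono r r' x : x < n -> r <= r' -> told_sent (st r x) -> told_sent (st r' x).
Proof.
move=> xn /subnKC <- t; elim: (r' - r) => [|j IH]; first by rewrite addn0.
rewrite addnS; case: (st_cases (r + j) xn) => [-> //|[_ _ c [msg -> _]]].
rewrite /nrecv; case: ifP => _ //=; case: run_at => [[k i]|] //=.
by case: ifP => //= _; rewrite IH.
Qed.

Lemma told_fire_once r r' x : x < n -> r < r' -> told_fire r x -> ~~ told_fire r' x.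
Proof.
move=> xn rr /and3P[fl u /andP[_ t]]; apply/negP=> /and3P[_ u' /andP[ns _]].
case/negP: ns; apply: (told_sent_mono xn rr); have [mr rl _] := and3P fl.
have [msg -> _] := st_step (ltnW rl) xn (up_le rr u').
rewrite /nrecv (clock_up (leqW (ltnW rl)) u) ltnNge mr /= flood_run // fl /=.
by rewrite t orbT.
Qed.

Lemma sum_once (T : nat) (P : pred nat) :
  (forall r r', r < r' -> P r -> ~~ P r') -> \sum_(r < T) P r <= 1.
Proof.
move=> once; elim: T => [|T IH]; first by rewrite big_ord0.
rewrite big_ord_recr /=; case: (boolP (P T)) => PT; last by rewrite addn0.
rewrite big1 // => r _; case: (boolP (P r)) => // Pr.
by have := once r T (ltn_ord r) Pr; rewrite PT.
Qed.

Definition links : nat := #|[set p : 'I_n * 'I_n | adjacent p.1 p.2]|.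

Lemma links_le : links <= 2 * (m * dg).
Proof.
pose f1 (p : 'I_m * 'I_dg) : 'I_n * 'I_n := (inord p.1, inord (g p.1 p.2)).
pose f2 (p : 'I_m * 'I_dg) : 'I_n * 'I_n := (inord (g p.1 p.2), inord p.1).
apply: (@leq_trans #|(f1 @: setT) :|: (f2 @: setT)|).
  apply: subset_leq_card; apply/subsetP=> -[x z]; rewrite inE /= => /and3P[xm zm /existsP[i]].
  case/orP=> /eqP e; rewrite inE; apply/orP; [left|right]; apply/imsetP.
    by exists (Ordinal xm, i); rewrite // /f1 /= e !inord_val.
  by exists (Ordinal zm, i); rewrite // /f2 /= e !inord_val.
apply: leq_trans (leq_card_setU _ _).1 _; rewrite mul2n -addnn.
have c : #|[set: 'I_m * 'I_dg]| = m * dg by rewrite cardsT card_prod !card_ord.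
by rewrite leq_add // -c leq_imset_card.
Qed.

Definition fire_links (fire : nat -> nat -> bool) r : nat :=
  #|[set p : 'I_n * 'I_n | fire r p.1 && adjacent p.1 p.2]|.

(** A node fires at most once, so each directed link is used at most once. *)
Lemma fire_links_le (fire : nat -> nat -> bool) T :
  (forall x, x < n -> forall r r', r < r' -> fire r x -> ~~ fire r' x) ->
  \sum_(r < T) fire_links fire r <= links.
Proof.
move=> once; rewrite /fire_links; under eq_bigr do rewrite -sum_bool_card.
rewrite exchange_big /links -sum_bool_card; apply: leq_sum => p _ /=.
case: (adjacent _ _); last by rewrite big1 // => r _; rewrite andbF.
under eq_bigr do rewrite andbT.
apply: (@sum_once T (fun r => fire r p.1)); exact: once (ltn_ord _).
Qed.

Definition run_cost k i : nat := d * (cnt (s k.-1) (senders true k i) + cnt (s k.-1) (senders false k i)).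

Definition push_cost r : nat := if run_at r is Some (k, i) then run_cost k i else 0.

Lemma run_messages k i : is_run k i ->
  #|[set p : 'I_n * 'I_n | isSome (sent_to (round k i) p.1 p.2)]| <= run_cost k i.
Proof.
move=> run; have rT := ltnW (round_lt run).
pose Y := [set y : 'I_(s k.-1) | senders true k i y || senders false k i y].
pose f (q : 'I_(s k.-1) * 'I_d) : 'I_n * 'I_n :=
  (inord (source k i q.1), inord (host k i (out k (i %% rho) q.1 q.2))).
apply: (@leq_trans #|f @: setX Y setT|).
  apply: subset_leq_card; apply/subsetP=> -[x z]; rewrite inE /=.
  case e : (sent_to _ _ _) => [v|] // _.
  have [ux] := sent_to_some rT (ltn_ord z) e; rewrite nsend_run //.
  case: ifP => // /andP[t /existsP[y /existsP[a /andP[/eqP ye /eqP ze]]]] c.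
  apply/imsetP; exists (y, a); last by rewrite /f /= /source ye ze !inord_val.
  rewrite !inE andbT /senders /offers /source ye ux t c /=.
  by case: v {c e}.
apply: leq_trans (leq_imset_card _ _) _; rewrite cardsX cardsT card_ord mulnC.
rewrite /run_cost leq_mul2l; apply/orP; right.
rewrite /cnt -big_split -sum_bool_card; apply: leq_sum => y _ /=.
by case: (senders true k i y); case: (senders false k i y).
Qed.

Lemma final_messages :
  #|[set p : 'I_n * 'I_n | isSome (sent_to last_round p.1 p.2)]| <= n.
Proof.
apply: (@leq_trans #|(fun z : 'I_n => (inord (z %% m) : 'I_n, z)) @: setT|); last first.
  by apply: leq_trans (leq_imset_card _ _) _; rewrite cardsT card_ord.
apply: subset_leq_card; apply/subsetP=> -[x z]; rewrite inE /=.
case e : (sent_to _ _ _) => [v|] // _.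
have [ux] := sent_to_some (leqnn _) (ltn_ord z) e.
rewrite /nsend clock_up // ltnNge last_round_ge run_last flood_last /= eqxx /=.
case: ifP => // /andP[_ /eqP zx] _; apply/imsetP; exists z => //.
by rewrite zx me_st // inord_val.
Qed.

Lemma messages_round r : messages_in_round A adv inp r <=
  fire_links bit_fire r + fire_links told_fire r + push_cost r + (r == last_round) * n.
Proof.
have E : messages_in_round A adv inp r =
    #|[set p : 'I_n * 'I_n | isSome (sent_to r p.1 p.2)]|.
  by apply: eq_card => -[i j]; rewrite !inE /= /sent_to !inord_val.
have [rT|rT] := leqP r last_round; last first.
  rewrite /messages_in_round (_ : [set _ | _] = set0) ?cards0 //.
  by apply/setP=> p; rewrite !inE (sent_to_end _ _ rT).
rewrite E; have [e|rl] := eqVneq r last_round.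
  by rewrite e mul1n; apply: leq_trans final_messages (leq_addl _ _).
rewrite mul0n addn0.
case er : (run_at r) => [[k i]|].
  have [run rE] := run_at_Some er; rewrite /push_cost er rE.
  exact: leq_trans (run_messages run) (leq_addl _ _).
rewrite /push_cost er addn0.
have [rm|mr] := ltnP r m.
  apply: (@leq_trans (fire_links bit_fire r)); last exact: leq_addr.
  apply: subset_leq_card; apply/subsetP=> -[x z]; rewrite !inE /=.
  case e : (sent_to _ _ _) => [v|] // _; have [ux] := sent_to_some rT (ltn_ord z) e.
  rewrite /nsend clock_up ?(leqW rT) // rm; case: ifP => // /and3P[b nb].
  by rewrite me_st // /bit_fire rm ux b nb => ->.
apply: (@leq_trans (fire_links told_fire r)); last exact: leq_addl.
apply: subset_leq_card; apply/subsetP=> -[x z]; rewrite !inE /=.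
case e : (sent_to _ _ _) => [v|] // _; have [ux] := sent_to_some rT (ltn_ord z) e.
rewrite /nsend clock_up ?(leqW rT) // ltnNge mr er /= (negbTE rl) /=.
case: ifP => // fl; case: ifP => // /andP[ns]; rewrite me_st // => -> t.
by rewrite /told_fire fl ux ns t.
Qed.

Lemma push_cost_sum T : \sum_(r < T) push_cost r <=
  \sum_(k < L) \sum_(i < rho ^ k.+1) run_cost k.+1 i.
Proof.
apply: (@leq_trans (\sum_(r < T) \sum_(k < L) \sum_(i < rho ^ k.+1)
    (run_at r == Some (k.+1, i : nat)) * run_cost k.+1 i)).
  apply: leq_sum => r _; rewrite /push_cost; case er : (run_at r) => [[k i]|] //.
  have [/and3P[k0 kL ik] _] := run_at_Some er.
  case: k k0 kL ik er => // k _ kL ik er.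
  rewrite (bigD1 (Ordinal kL)) //= (bigD1 (Ordinal ik)) //= eqxx mul1n -addnA.
  exact: leq_addr.
rewrite exchange_big; apply: leq_sum => k _; rewrite exchange_big; apply: leq_sum => i _ /=.
rewrite -big_distrl /=; apply: leq_trans (_ : 1 * run_cost k.+1 i <= _); last by rewrite mul1n.
rewrite leq_mul2r; apply/orP; right; apply: (@sum_once T (fun r => run_at r == Some (k.+1, i : nat))).
move=> r r' lt /eqP/run_at_Some[_ rE]; apply/negP=> /eqP/run_at_Some[_ r'E].
by rewrite rE r'E ltnn in lt.
Qed.

Lemma messages_le T : messages_before A adv inp T <=
  4 * (m * dg) + \sum_(k < L) \sum_(i < rho ^ k.+1) run_cost k.+1 i + n.
Proof.
apply: leq_trans (_ : \sum_(r < T) (fire_links bit_fire r + fire_links told_fire r + push_cost r + (r == last_round :> nat) * n) <= _).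
  by apply: leq_sum => r _; exact: messages_round.
rewrite !big_split /=; apply: leq_add; last first.
  rewrite -big_distrl /=; apply: leq_trans (_ : 1 * n <= _); last by rewrite mul1n.
  rewrite leq_mul2r; apply/orP; right; apply: (@sum_once T (fun r => r == last_round)).
  by move=> r r' lt /eqP e; apply: contraTN lt => /eqP->; rewrite -e ltnn.
apply: leq_add (push_cost_sum T).
have l1 := fire_links_le T (fun x xn r r' => @bit_fire_once r r' x xn).
have l2 := fire_links_le T (fun x xn r r' => @told_fire_once r r' x xn).
by apply: leq_trans (leq_add l1 l2) _; have := links_le; lia.
Qed.

(** * Analysis of an execution *)

Section Analysis.

Variables (kappa D a b J : nat) (K : {set 'I_m}).

Hypothesis rho16 : 16 <= rho.
Hypothesis D_rho : 2 * rho <= D.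
Hypothesis D_h : forall c e, c < rho -> e < rho -> 2 * h c <= D * h e.
Hypothesis h_step : forall c e, c < e -> e < rho -> kappa * kappa * h c <= h e.
Hypothesis d_large : forall c, c < rho -> 16 * kappa * h c <= d.
Hypothesis b_large : 2 * d * kappa <= b.
Hypothesis a_large : 4 ^ b <= a.
Hypothesis a128 : 128 <= a.
Hypothesis D_depth : m <= D ^ L * a.
Hypothesis s_half : forall k, k < L -> s k = 2 * s k.+1.
Hypothesis J_m : m <= 2 ^ J.
Hypothesis lenE : len = 2 * J + 3.

Hypothesis shrink : forall k c (W : pred nat), 0 < k -> k <= L -> c < rho ->
  cnt (s k.-1) W * d * kappa <= h c * s k ->
  cnt (s k) (fun x => h c <= deg k c W x) * D <= cnt (s k.-1) W.
Hypothesis amplify : forall k c (Y : pred nat), 0 < k -> k <= L -> c < rho ->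
  kappa * h c * s k <= cnt (s k.-1) Y * d ->
  16 * cnt (s k) (fun x => deg k c Y x < h c) <= s k.
Hypothesis spread_hosts : forall Q : {set 'I_m},
  (4 * #|Q| <= m -> tsum rho L (fun k i =>
     (7 * s k <= 8 * cnt (s k) (fun y => in_set Q (host k i y))) * s k) <= 2 * m) /\
  (4 ^ b * #|Q| <= m -> tsum rho L (fun k i =>
     (1 * s k <= b * cnt (s k) (fun y => in_set Q (host k i y))) * s k) <= 2 * m).

Let adj : rel 'I_m := fun x y => adjacent x y.

Hypothesis joined : forall A B : {set 'I_m}, m <= a * #|A| -> m <= a * #|B| ->
  exists x y, [/\ x \in A, y \in B & adj x y].
Hypothesis K_exp : expanding a adj K.
Hypothesis K_large : 4 * #|~: K| <= m.
Hypothesis K_up : forall x : 'I_m, x \in K -> up last_round.+1 x.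

Let adjC : symmetric adj. Proof. by move=> x y; exact: adjacentC. Qed.

Let a0 : 0 < a. Proof. exact: leq_trans a128. Qed.

(** * The bit of the core, and the decline of the other bit *)

Lemma K_big : m <= a * #|K|.
Proof.
have := cardsC K; rewrite card_ord => c.
have : 4 * #|K| <= a * #|K| by rewrite leq_mul2r (leq_trans _ a128) ?orbT.
move: K_large c; lia.
Qed.

Lemma K_nonempty : exists x : 'I_m, x \in K.
Proof. by apply/set0Pn; rewrite -card_gt0; have := K_big; move: m0; case: #|K| => //; rewrite muln0; lia. Qed.

Lemma K_up_le r (x : 'I_m) : r <= last_round.+1 -> x \in K -> up r x.
Proof. by move=> rT /K_up; exact: up_le. Qed.

(** [core_flooded] is applied to a constant family: the core nodes that share the bit of x are
    closed under links in the core, whose ends both survive. *)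
Lemma K_bits (x y : 'I_m) : x \in K -> y \in K -> bit (st m x) = bit (st m y).
Proof.
move=> xK yK; pose B := [set z in K | bit (st m z) == bit (st m x)].
have BK : B = K.
  apply: (core_flooded (B := fun=> B) adjC joined K_exp J_m a0) => //.
  - by move=> _; apply/subsetP=> z; rewrite inE => /andP[].
  - by apply/set0Pn; exists x; rewrite inE xK eqxx.
  move=> _ z w _; rewrite !inE => /andP[zK /eqP<-] wK zw; rewrite wK /=.
  have uz := K_up_le (leqW last_round_ge) zK; have uw := K_up_le (leqW last_round_ge) wK.
  have wz : adjacent w z by rewrite adjacentC.
  by apply/eqP; apply/idP/idP; [exact: bits_spread wz uw uz | exact: bits_spread zw uz uw].
by move: yK; rewrite -BK inE => /andP[_ /eqP->].
Qed.

Definition v : bool := bit (st m (xchoose K_nonempty)).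

Lemma K_v (x : 'I_m) : x \in K -> bit (st m x) = v.
Proof. by move=> xK; apply: K_bits => //; exact: (xchooseP K_nonempty). Qed.

(** Otherwise some surviving holder of the wrong bit would be linked to the core, and the initial
    flood gives linked survivors the same bit. *)
Lemma wrong_few : a * cnt m (holds (~~ v) 0 0) < m.
Proof.
pose W := [set x : 'I_m | holds (~~ v) 0 0 x].
have -> : cnt m (holds (~~ v) 0 0) = #|W| by rewrite -sum_bool_card.
rewrite ltnNge; apply/negP=> big; have [x [y [xW yK xy]]] := joined big K_big.
move: xW; rewrite inE /holds /= => /andP[ux /eqP bx].
have uy := K_up_le (leqW last_round_ge) yK; have := K_v yK.
case: v bx => /= bx by_.
  by rewrite (bits_spread _ uy ux by_) // adjacentC in bx.
by rewrite (bits_spread xy ux uy bx) in by_.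
Qed.

Lemma s_pow k : k <= L -> s 0 = 2 ^ k * s k.
Proof.
elim: k => [|k IH] kL; first by rewrite mul1n.
by rewrite IH ?(ltnW kL) // (s_half kL) expnSr mulnA.
Qed.

Lemma mod_rho i : i %% rho < rho. Proof. by rewrite ltn_mod. Qed.

Lemma a_b : b < a. Proof. exact: leq_trans (ltn_expl b (isT : 1 < 4)) a_large. Qed.

(** A fraction 1/b of the senders is small enough for [shrink] at any threshold, since b >= 2 d
    kappa and thresholds are positive. *)
Lemma few_small k c (W : pred nat) : 0 < k -> k <= L ->
  cnt (s k.-1) W * b <= s k.-1 -> cnt (s k.-1) W * d * kappa <= h c * s k.
Proof.
case: k => // k _ kL /= le; have := s_half kL.
have := leq_mul (leqnn (cnt (s k) W)) b_large => le2 sE.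
apply: (@leq_trans (1 * s k.+1)); last by rewrite leq_mul2r h0 orbT.
rewrite mul1n; move: le le2; rewrite sE.
have -> : cnt (2 * s k.+1) W * (2 * d * kappa) = 2 * (cnt (2 * s k.+1) W * d * kappa) by ring.
lia.
Qed.

(** The wrong holders decrease by a factor D per level while sizes only halve, so they remain few
    enough for [shrink] to apply again. *)
Lemma wrong_shrinks k i : k <= L -> i < rho ^ k ->
  cnt (s k) (holds (~~ v) k i) * D ^ k * a < m.
Proof.
have D2 : 2 <= D by apply: leq_trans D_rho; lia.
elim: k i => [|k IH] i kL ik.
  have -> : i = 0 by move: (ik : i < 1); case: (i).
  by rewrite expn0 muln1 s0 mulnC wrong_few.
have run : is_run k.+1 i by rewrite /is_run kL.
have [_ ip] := parent_run run; have := IH _ (ltnW kL) ip => IHp.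
have Sle : cnt (s k) (senders (~~ v) k.+1 i) <= cnt (s k) (holds (~~ v) k (i %/ rho)).
  by apply: cntS_le => y ys; apply: (senders_hold run).
have small : cnt (s k) (senders (~~ v) k.+1 i) * b <= s k.
  have pD : 2 ^ k <= D ^ k by case: (k) => // j; rewrite leq_exp2r.
  have : cnt (s k) (senders (~~ v) k.+1 i) * 2 ^ k * b < 2 ^ k * s k.
    rewrite -(s_pow (ltnW kL)) s0; apply: leq_ltn_trans IHp.
    by apply: leq_mul (ltnW a_b); exact: leq_mul.
  by rewrite mulnAC mulnC ltn_mul2l => /andP[_ /ltnW].
have := @shrink k.+1 _ (senders (~~ v) k.+1 i) isT kL (mod_rho i)
  (@few_small k.+1 _ _ isT kL small).
have Hle : cnt (s k.+1) (holds (~~ v) k.+1 i) <=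
    cnt (s k.+1) (fun x => h (i %% rho) <= deg k.+1 (i %% rho) (senders (~~ v) k.+1 i) x).
  by apply: cntS_le => y ys; apply: holds_deg.
move=> sh; apply: leq_ltn_trans IHp; rewrite expnS mulnA leq_mul2r; apply/orP; right.
rewrite leq_mul2r; apply/orP; right; apply: leq_trans Sle; apply: leq_trans sh.
by rewrite leq_mul2r Hle orbT.
Qed.

(** At depth L the bound of [wrong_shrinks] drops below one node by [D_depth]. *)
Lemma leaf_right i y : i < rho ^ L -> y < s L -> ~~ holds (~~ v) L i y.
Proof.
move=> iL ys; apply/negP=> hy; have := wrong_shrinks (leqnn L) iL.
rewrite -mulnA ltnNge => /negP[]; apply: leq_trans D_depth _; rewrite leq_pmull //.
rewrite /cnt (bigD1 (Ordinal ys)) //=; by rewrite hy.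
Qed.

Lemma told_v r x u : x < n -> told (st r x) = Some u -> u = v.
Proof.
move=> xn /(told_holds xn)[i [y [iL ys hy]]].
have [//|uv] := eqVneq u v.
have uE : u = ~~ v by move: uv; case: (u); case: v.
by have := leaf_right iL ys; rewrite -uE hy.
Qed.

(** * Isolated nodes and damaged runs *)

Definition isolated : {set 'I_m} := [set x | (x \notin K) && [forall y in K, ~~ adj y x]].

Lemma isolated_few : a * #|isolated| < m.
Proof.
rewrite ltnNge; apply/negP=> big; have [x [y [xK yI xy]]] := joined K_big big.
by move: yI; rewrite inE => /andP[_ /forallP/(_ x)]; rewrite xK xy.
Qed.

Definition many_outside k i := 7 * s k <= 8 * cnt (s k) (fun y => in_set (~: K) (host k i y)).
Definition many_isolated k i := 1 * s k <= b * cnt (s k) (fun y => in_set isolated (host k i y)).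
(** With too many hosts outside the core a full run may certify at too few core nodes; with too many
    isolated hosts its children may stay big after the first success. *)
Definition dam k i := many_outside k i || many_isolated k i.

Lemma in_setE (Q : {set 'I_m}) (x : 'I_m) : in_set Q x = (x \in Q).
Proof.
apply/existsP/idP => [[z /andP[zQ /eqP/val_inj <-]] //|xQ]; by exists x; rewrite xQ eqxx.
Qed.

Lemma in_setP (Q : {set 'I_m}) x (xm : x < m) : in_set Q x = (Ordinal xm \in Q).
Proof. exact: (in_setE Q (Ordinal xm)). Qed.

Lemma dam_mass : tsum rho L (fun k i => dam k i * s k) <= 4 * s 0.
Proof.
have [P1 _] := spread_hosts (~: K); have [_ P2] := spread_hosts isolated.
have l1 := P1 K_large; have l2 := P2 _.
have {}l2 : tsum rho L (fun k i => many_isolated k i * s k) <= 2 * m.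
  apply: l2; apply: ltnW; apply: leq_ltn_trans isolated_few.
  by rewrite leq_mul2r a_large orbT.
rewrite s0 (_ : 4 * m = 2 * m + 2 * m); last by rewrite -mulnDl.
apply: leq_trans (leq_add l1 l2); rewrite -tsumD; apply: leq_tsum => k i _ _ _.
rewrite -mulnDl leq_mul2r /dam; apply/orP; right.
by rewrite -/(many_outside k i); case: (many_outside k i); case: (many_isolated k i).
Qed.

Lemma cnt0_host (P : pred nat) : cnt (s 0) (fun y => P (host 0 0 y)) = cnt m P.
Proof. by rewrite s0; apply: eq_bigr => y _; rewrite host0. Qed.

Lemma cnt_in_set (Q : {set 'I_m}) : cnt m (in_set Q) = #|Q|.
Proof.
by rewrite /cnt sum_bool_card; apply: eq_card => x; rewrite inE in_setE.
Qed.

Lemma root_undamaged : ~~ dam 0 0.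
Proof.
rewrite /dam /many_outside /many_isolated !cnt0_host !cnt_in_set s0 negb_or -!ltnNge.
apply/andP; split; first by move: K_large m0; lia.
rewrite mul1n; apply: leq_ltn_trans isolated_few.
by rewrite leq_mul2r ltnW ?a_b ?orbT.
Qed.

(** * From full runs to the first success *)

Lemma inK_up r x : r <= last_round.+1 -> x < m -> in_set K x -> up r x.
Proof. by move=> rT xm; rewrite (in_setP _ xm); exact: (K_up_le rT). Qed.

Lemma wrong_senders_few k i : is_run k i ->
  cnt (s k.-1) (senders (~~ v) k i) * a < 2 * s k.
Proof.
case: k => // k run; have [_ kL _] := and3P run; have [_ ip] := parent_run run.
have D2 : 2 <= D by apply: leq_trans D_rho; move: rho16; lia.
have Sle : cnt (s k) (senders (~~ v) k.+1 i) <= cnt (s k) (holds (~~ v) k (i %/ rho)).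
  by apply: cntS_le => y ys; apply: (senders_hold run).
have pD : 2 ^ k <= D ^ k by case: (k) => // j; rewrite leq_exp2r.
have : cnt (s k) (senders (~~ v) k.+1 i) * 2 ^ k * a < 2 ^ k * s k.
  rewrite -(s_pow (ltnW kL)) s0; apply: leq_ltn_trans (wrong_shrinks (ltnW kL) ip).
  by rewrite leq_mul2r leq_mul ?orbT.
by rewrite mulnAC mulnC ltn_mul2l -(s_half kL) => /andP[_].
Qed.

Lemma wrong_senders_small k i : is_run k i ->
  cnt (s k.-1) (senders (~~ v) k i) * d * kappa <= h (i %% rho) * s k.
Proof.
move=> run; have [k0 kL _] := and3P run; apply: few_small => //.
have := wrong_senders_few run; have := a_b.
case: k k0 kL run => // k _ kL run /=; rewrite -(s_half kL) => ab /ltnW; apply: leq_trans.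
by rewrite leq_mul2l (ltnW ab) orbT.
Qed.

(** These are the two sampler thresholds, a factor kappa^2 apart: [amplify] applies to a full run
    and [shrink] to one that is not big. *)
Definition full k i := kappa * h (i %% rho) * s k <= cnt (s k.-1) (full_senders v k i) * d.
Definition big k i := h (i %% rho) * s k < cnt (s k.-1) (senders v k i) * d * kappa.

Definition core_holds k i y := in_set K (host k i y) && holds v k i y.

(** Fewer than 7/8 of the virtual nodes live outside the core, at most 1/16 lack votes for [v] and
    at most 1/64 get enough votes for the other bit. More than 3/64 are left. *)
Lemma full_solid k i : is_run k i -> full k i -> ~~ dam k i ->
  s k < 32 * cnt (s k) (core_holds k i).
Proof.
move=> run fk; rewrite negb_or => /andP[nd _]; have [k0 kL ik] := and3P run.
have exc := @amplify k _ (full_senders v k i) k0 kL (mod_rho i) fk.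
have confl := @shrink k _ (senders (~~ v) k i) k0 kL (mod_rho i) (wrong_senders_small run).
have few := wrong_senders_few run.
set E := cnt (s k) _ in exc; set W := cnt (s k) _ in confl.
have W64 : 64 * W <= s k.
  have : W * D * 128 <= cnt (s k.-1) (senders (~~ v) k i) * a by exact: leq_mul.
  have : W * 1 <= W * D by rewrite leq_mul2l (leq_trans _ D_rho) ?orbT // muln_gt0 rho0.
  by move: few; lia.
have cover : s k <= cnt (s k) (core_holds k i) + E + W
    + cnt (s k) (fun y => in_set (~: K) (host k i y)).
  rewrite /E /W /cnt -!big_split /= -[leqLHS](card_ord (s k)) -sum1_card.
  apply: leq_sum => y _; have hm := run_host_lt run (ltn_ord y).
  rewrite (in_setP (~: K) hm) inE -(in_setP K hm) /core_holds.
  rewrite !addn_gt0 !lt0b.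
  case: (boolP (in_set K _)) => [hK|]; last by rewrite !orbT.
  case: (ltnP (deg k _ (full_senders v k i) y)) => [_|ge1]; first by rewrite orbT.
  case: (leqP _ (deg k _ (senders (~~ v) k i) y)) => [_|lt2]; first by rewrite !orbT.
  rewrite (deg_holds run (ltn_ord y) _ ge1 lt2) // (inK_up _ hm hK) //.
  by rewrite ltnS ltnW // round_lt.
by move: nd; rewrite /many_outside -ltnNge; lia.
Qed.

(** More than s k / 32 = s k.+1 / 16 core hosts send, and [d_large] supplies the factor 16 kappa
    h. *)
Lemma full_child k i j : (k = 0 \/ is_run k i) -> is_run k.+1 j -> j %/ rho = i ->
  s k < 32 * cnt (s k) (core_holds k i) ->
  (forall x : 'I_m, x \in K -> told (st (round k.+1 j) x) = None) -> full k.+1 j.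
Proof.
move=> kr run ji many none; have [_ kL _] := and3P run.
have le : cnt (s k) (core_holds k i) <= cnt (s k) (full_senders v k.+1 j).
  apply: cntS_le => y ys /andP[hK hy].
  have sE : source k.+1 j y = host k i y by rewrite /source /= ji.
  have hm := source_lt run ys; rewrite sE in hm.
  apply: (hold_senders run ys); rewrite ?sE ?ji //.
    by apply: (inK_up _ hm hK); rewrite ltnS ltnW // round_lt.
  by rewrite (in_setP K hm) in hK; exact: (none (Ordinal hm)).
rewrite /full /=; apply: leq_trans (_ : cnt (s k) (core_holds k i) * d <= _); last first.
  by rewrite leq_mul2r le orbT.
have := leq_mul (ltnW many) (d_large (mod_rho j)); rewrite (s_half kL).
set c := cnt _ _; set e := h _ => le2.
have : 32 * (kappa * e * s k.+1) <= 32 * (c * d) by move: le2; lia.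
by rewrite leq_mul2l.
Qed.

Definition told_by e := [exists x in K, told (st (m + e * epoch_length + L) x) != None].

Lemma root_solid : s 0 < 32 * cnt (s 0) (core_holds 0 0).
Proof.
have -> : cnt (s 0) (core_holds 0 0) = #|K|.
  rewrite -cnt_in_set s0; apply: eq_bigr => y _; rewrite /core_holds host0 in_setE.
  case: (boolP (y \in K)) => // yK; rewrite /holds /= (K_v yK) eqxx andbT.
  by rewrite (K_up_le _ yK) // leqW // last_round_ge.
by have := cardsC K; rewrite card_ord s0; move: K_large m0; lia.
Qed.

Lemma child_is_run k i c : k < L -> i < rho ^ k -> c < rho -> is_run k.+1 (i * rho + c).
Proof.
move=> kL ik cr; rewrite /is_run /= kL expnSr.
apply: (@leq_trans (i * rho + rho)); first by rewrite ltn_add2l.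
by rewrite addnC -mulSn leq_mul2r ik orbT.
Qed.

Lemma round_start k i : 0 < k -> round k i = m + start rho L k i * epoch_length + k.-1.
Proof. by []. Qed.

Lemma told_later (x : 'I_m) r r' : r <= r' -> told (st r x) != None -> told (st r' x) != None.
Proof. by move=> le t; rewrite (told_mono _ le t) // (leq_trans (ltn_ord x)). Qed.

Lemma told_by_round k i (x : 'I_m) : 0 < k -> k <= L -> x \in K ->
  told (st (round k i) x) != None -> told_by (start rho L k i).
Proof.
move=> k0 kL xK t; apply/existsP; exists x; rewrite xK /=.
by apply: told_later t; rewrite round_start // leq_add2l (leq_trans (leq_pred _)).
Qed.

Lemma window k i c : k < L -> c < rho ->
  start rho L k i <= start rho L k.+1 (i * rho + c) /\
  start rho L k.+1 (i * rho + c) + rho ^ (L - k.+1) <= start rho L k i + rho ^ (L - k).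
Proof.
move=> kL cr; rewrite /start -(subnSK kL) expnS mulnDl -mulnA leq_addr; split=> //.
rewrite -addnA leq_add2l addnC -mulSn leq_mul2r cr orbT //.
Qed.

(* Induction down a path of undamaged runs: a run whose certificates reach a constant
   fraction of the virtual nodes makes its children full, hence solid again. *)
Lemma good_succeeds k i : k <= L -> (k = 0 /\ i = 0 \/ is_run k i) ->
  s k < 32 * cnt (s k) (core_holds k i) -> ~~ bad rho L dam k i ->
  exists2 e, start rho L k i <= e < start rho L k i + rho ^ (L - k) & told_by e.
Proof.
move=> kL; have [n kn] : exists n, n = L - k by exists (L - k).
elim: n k i kn kL => [|n IH] k i kn kL kr many nb.
  have kE : k = L by lia.
  move: kr many; rewrite kE => -[[L00 _]|run] many; first by move: L0; rewrite L00.
  exists i; first by rewrite /start subnn expn0 muln1 leqnn addn1 leqnn.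
  have : 0 < cnt (s L) (core_holds L i) by case: (cnt _ _) many; rewrite ?muln0.
  rewrite lt0n sum_nat_eq0 negb_forall => /existsP[y]; rewrite implyTb -lt0n lt0b => /andP[yK yh].
  have t := leaf_told run (ltn_ord y) yh; have hm := run_host_lt run (ltn_ord y).
  rewrite (in_setP K hm) in yK; apply/existsP; exists (Ordinal hm); rewrite yK /=.
  apply: (told_later (x := Ordinal hm)) t.
  by rewrite /round subnn expn0 muln1 -addnS prednK.
have kL' : k < L by lia.
have ik : i < rho ^ k by case: kr => [[-> ->]|/and3P[]] //.
move: nb; rewrite badE // negb_or negb_forall => /andP[nd /existsP[c nc]].
have run := child_is_run kL' ik (ltn_ord c).
have [w1 w2] := window i kL' (ltn_ord c).
have cd : (i * rho + c) %/ rho = i by rewrite divnMDl // divn_small ?addn0.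
(* Either a core node has a final value by now, so the first epoch of this child is a success, or
   the whole core is still untold and the child is full. *)
have [/existsP[x /andP[xK t]]|none] :=
  boolP [exists x in K, told (st (round k.+1 (i * rho + c)) x) != None].
  exists (start rho L k.+1 (i * rho + c)); last exact: told_by_round t.
  by rewrite w1 (leq_trans _ w2) // -addn1 leq_add2l expn_gt0 rho0.
have fc : full k.+1 (i * rho + c).
  apply: (@full_child k i) => //; first by case: kr => [[]|]; [left|right].
  move=> x xK; apply/eqP; apply: contraNT none => t; apply/existsP; exists x; by rewrite xK.
have nk : n = L - k.+1 by lia.
have nd' : ~~ dam k.+1 (i * rho + c) by apply: contra nc; exact: dam_bad.
have [e /andP[e1 e2] te] := IH k.+1 _ nk kL' (or_intror run) (full_solid run fc nd') nc.
by exists e => //; rewrite (leq_trans w1 e1) (leq_trans e2 w2).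
Qed.

Lemma some_success : exists e, (e < rho ^ L) && told_by e.
Proof.
have s0p : 0 < s 0 by rewrite s0.
have nb : ~~ bad rho L dam 0 0 by exact (root_not_bad rho16 D_rho s_half s0p root_undamaged dam_mass).
have [e /andP[_ le] te] := good_succeeds (leq0n L) (or_introl (conj erefl erefl)) root_solid nb.
by exists e; rewrite te andbT; rewrite /start mul0n subn0 in le.
Qed.

Lemma flood_atP e j : e < rho ^ L -> j <= 2 * J + 2 -> flood_at (m + e * epoch_length + L + j).
Proof.
move=> eL jJ; have jE : L + j < epoch_length by rewrite /epoch_length lenE; lia.
rewrite /flood_at -!addnA leq_addr addKn modnMDl modn_small // leq_addr andbT /=.
rewrite /last_round ltn_add2l; apply: (@leq_trans (e.+1 * epoch_length)).
  by rewrite mulSn addnC ltn_add2r.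
by rewrite leq_mul2r eL orbT.
Qed.

Lemma flood_at_up r (x : 'I_m) : flood_at r -> x \in K -> up r.+1 x.
Proof. by case/and3P=> _ rT _; apply: K_up_le; rewrite ltnS ltnW. Qed.

Lemma flood_end e : m + e.+1 * epoch_length = (m + e * epoch_length + L + (2 * J + 2)).+1.
Proof. by rewrite /epoch_length lenE; lia. Qed.

Lemma core_told e (x : 'I_m) : e < rho ^ L -> told_by e -> x \in K ->
  told (st (m + e * epoch_length + L + (2 * J + 2)) x) != None.
Proof.
move=> eL te xK; set r := fun j => m + e * epoch_length + L + j.
pose B j := [set x in K | told (st (r j) x) != None].
suff BK : B (2 * J + 2) = K by move: xK; rewrite -BK inE => /andP[].
apply: (core_flooded adjC joined K_exp J_m a0).
- by move=> j; apply/subsetP=> z; rewrite inE => /andP[].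
- by case/existsP: te => z zt; apply/set0Pn; exists z; rewrite inE /r addn0.
- move=> j _; apply/subsetP=> z; rewrite !inE => /andP[-> t].
  by apply: told_later t; rewrite /r addnS.
move=> j y z jJ; rewrite !inE => /andP[yK t] zK yz; rewrite zK /=.
have fl : flood_at (r j) by apply: flood_atP => //; lia.
by rewrite /r addnS; apply: (flood_spread fl yz) => //; apply: flood_at_up.
Qed.

(** The core is informed after 2J + 2 flooding rounds, and the last of the 2J + 3 rounds reaches its
    neighbours. *)
Lemma near_told e r (x : 'I_m) : e < rho ^ L -> told_by e -> m + e.+1 * epoch_length <= r ->
  up r x -> x \notin isolated -> told (st r x) != None.
Proof.
move=> eL te; rewrite flood_end => rl ux; rewrite inE negb_and negbK negb_forall.
case/orP=> [xK|/existsP[y]].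
  by apply: told_later (core_told eL te xK); exact: ltnW.
rewrite negb_imply negbK => /andP[yK yx].
have fl : flood_at (m + e * epoch_length + L + (2 * J + 2)) by exact: flood_atP.
apply: (told_later rl); apply: (flood_spread fl yx); last exact: core_told.
  exact: flood_at_up.
exact: up_le rl ux.
Qed.

Definition first_success : nat := ex_minn some_success.
Local Notation ts := first_success.

Lemma first_success_lt : ts < rho ^ L.
Proof. by rewrite /ts; case: ex_minnP => e /andP[]. Qed.

Lemma first_success_told : told_by ts.
Proof. by rewrite /ts; case: ex_minnP => e /andP[]. Qed.

Lemma before_success e : e < ts -> ~~ told_by e.
Proof.
move=> et; apply: contraL et => te; rewrite -leqNgt.
case: (ltnP e (rho ^ L)) => [eL|]; last exact: leq_trans (ltnW first_success_lt).
by rewrite /ts; case: ex_minnP => e' _; apply; rewrite eL.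
Qed.

Lemma core_silent k i (x : 'I_m) : 0 < k -> k <= L -> start rho L k i < ts -> x \in K ->
  told (st (round k i) x) = None.
Proof.
move=> k0 kL lt xK; apply/eqP; apply: contraTT (before_success lt) => t.
by rewrite negbK (told_by_round k0 kL xK t).
Qed.

(** * The total number of senders *)

Let sz u k i := cnt (s k.-1) (senders u k i).

Lemma senders_shrink u k i : 0 < k -> k < L -> i < rho ^ k.+1 ->
  sz u k (i %/ rho) * d * kappa <= h (i %/ rho %% rho) * s k ->
  sz u k.+1 i * D <= sz u k (i %/ rho).
Proof.
move=> k0 kL ik small.
have run : is_run k.+1 i by rewrite /is_run kL.
have runp : is_run k (i %/ rho) by rewrite /is_run k0 (ltnW kL) ltn_divLR // -expnSr.
have := @shrink k _ (senders u k (i %/ rho)) k0 (ltnW kL) (mod_rho _) small.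
apply: leq_trans; rewrite leq_mul2r; apply/orP; right; apply: cntS_le => y ys sy.
by apply: holds_deg => //; apply: (senders_hold run).
Qed.

Lemma senders_le u k i : sz u k i <= s k.-1. Proof. exact: cnt_le. Qed.

Lemma run_of k i : 0 < k -> k <= L -> i < rho ^ k -> is_run k i.
Proof. by rewrite /is_run => -> ->. Qed.

(** The senders decrease by a factor D, which makes up for the halved size and, by [D_h], for a
    possibly lower threshold. *)
Lemma big_child k i : 0 < k -> k < L -> i < rho ^ k.+1 ->
  ~~ big k (i %/ rho) -> ~~ big k.+1 i.
Proof.
move=> k0 kL ik; rewrite /big -!leqNgt -/(sz v k _) -/(sz v k.+1 i) => small.
have sh := senders_shrink k0 kL ik small.
have D0 : 0 < D by apply: leq_trans D_rho; rewrite muln_gt0 rho0.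
rewrite -(leq_pmul2l D0); apply: (@leq_trans (h (i %/ rho %% rho) * s k)).
  apply: leq_trans small; apply: leq_trans (leq_mul (leq_mul sh (leqnn d)) (leqnn kappa)).
  by apply/eq_leq; ring.
rewrite (s_half kL); have := D_h (mod_rho (i %/ rho)) (mod_rho i) => le.
have := leq_mul le (leqnn (s k.+1)); lia.
Qed.

(** After the epoch of the first success only isolated survivors are still untold. A parent with few
    isolated hosts leaves too few senders for a big run. *)
Lemma late_damaged k i : 0 < k -> k <= L -> i < rho ^ k ->
  ts < start rho L k i -> big k i -> dam k.-1 (i %/ rho).
Proof.
move=> k0 kL ik late; apply: contraLR; rewrite /dam negb_or => /andP[_].
rewrite /many_isolated -ltnNge mul1n /big -leqNgt => few.
have run := run_of k0 kL ik; apply: few_small => //.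
rewrite mulnC; apply: leq_trans (ltnW few); rewrite leq_mul2l; apply/orP; right.
apply: cntS_le => y ys /and3P[us /eqP t _]; have hm := source_lt run ys.
rewrite -/(source k i y) (in_setP isolated hm); apply: contraLR (isT) => iso.
have := @near_told ts (round k i) (Ordinal hm) first_success_lt first_success_told.
rewrite /= t eqxx; apply=> //.
by rewrite round_start // -[X in X <= _]addn0 leq_add // leq_add2l leq_mul2r late orbT.
Qed.

(** Before the first success the core is untold, so the children of the root are full, and so are
    those of a full undamaged run. *)
Lemma early_full k i : 0 < k -> k <= L -> i < rho ^ k ->
  start rho L k i < ts -> ~~ full k i ->
  (1 < k) && (dam k.-1 (i %/ rho) || ~~ full k.-1 (i %/ rho)).
Proof.
case: k => // k _ kL ik early nf; have run := run_of (isT : 0 < k.+1) kL ik.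
have silent := fun x => @core_silent k.+1 i x isT kL early.
have [k0|k0] := posnP k.
  case/negP: nf; move: ik run silent; rewrite k0 expn1 => ik run silent.
  apply: (@full_child 0 0 i) => //; [by left | by rewrite divn_small | exact: root_solid].
rewrite /= ltnS k0 /=; apply: contraNT nf; rewrite negb_or negbK => /andP[nd fp].
have runp : is_run k (i %/ rho) by apply: run_of; rewrite ?(ltnW kL) // ltn_divLR // -expnSr.
by apply: (@full_child k (i %/ rho) i) => //; [right | exact: full_solid].
Qed.

(** Every sender of the later sibling was a full sender of the earlier one. These were too few for
    the latter to be full, and the threshold has since grown by kappa^2. *)
Lemma big_after_full k i j : 0 < k -> k <= L -> j < rho ^ k -> i < j -> i %/ rho = j %/ rho ->
  ~~ full k i -> ~~ big k j.
Proof.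
move=> k0 kL jk ij e; rewrite /full /big -ltnNge -leqNgt => nf.
have ri := run_of k0 kL (ltn_trans ij jk); have rj := run_of k0 kL jk.
have lt : i %% rho < j %% rho.
  by move: ij; rewrite {1}(divn_eq i rho) {1}(divn_eq j rho) e ltn_add2l.
have le : sz v k j <= cnt (s k.-1) (full_senders v k i).
  by apply: cntS_le => y ys; apply: senders_sibling.
have step := leq_mul (h_step lt (mod_rho j)) (leqnn (s k)).
apply: leq_trans step.
have : sz v k j * d * kappa <= cnt (s k.-1) (full_senders v k i) * d * kappa.
  by rewrite !leq_mul2r le !orbT.
move/leq_trans; apply; apply: leq_trans (leq_mul (ltnW nf) (leqnn kappa)) _.
by apply/eq_leq; ring.
Qed.

(** A full run that is not bad succeeds within its own window, which would be before the first
    success. *)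
Lemma full_bad k i : 0 < k -> k <= L -> i < rho ^ k ->
  start rho L k i + rho ^ (L - k) <= ts -> full k i -> bad rho L dam k i.
Proof.
move=> k0 kL ik early fk; apply: contraT => nb; have run := run_of k0 kL ik.
have nd : ~~ dam k i by apply: contra nb; exact: dam_bad.
have [e /andP[_ le] te] := good_succeeds kL (or_intror run) (full_solid run fk nd) nb.
by case/negP: (before_success (leq_trans le early)).
Qed.

Lemma right_senders_total : tsum rho L (sz v) <= 2 * (rho + 1) * (3 + (rho + 3) * 4) * m.
Proof.
rewrite -s0; apply: (@senders_bound rho L D s rho16 D_rho s_half dam (sz v) big full ts).
- by move=> k i _ _ _; exact: senders_le.
- by move=> k i k0 kL ik; rewrite /big -leqNgt; exact: senders_shrink.
- exact: big_child.
- exact: late_damaged.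
- by move=> k i k0 kL ik early _; exact: early_full.
- by move=> k i j k0 kL jk ij e _; exact: big_after_full e.
- exact: full_bad.
- exact: root_undamaged.
exact: dam_mass.
Qed.

(** No run is big for the wrong bit, so its senders shrink throughout the tree. *)
Lemma wrong_senders_total : tsum rho L (sz (~~ v)) <= 2 * (rho + 1) * m.
Proof.
have := @total_senders rho L D s rho16 D_rho s_half (fun _ _ => false) (sz (~~ v)) (fun _ _ => false).
rewrite s0 (_ : tsum rho L (fun k _ => false * s k) = 0) ?addn0; last first.
  by rewrite /tsum big1 // => k _; rewrite big1.
apply.
  by move=> k i _ _ _; exact: senders_le.
move=> k i k0 kL ik _; apply: senders_shrink => //.
by apply: wrong_senders_small; apply: run_of; rewrite ?(ltnW kL) // ltn_divLR // -expnSr.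
Qed.

Lemma messages_bound T : messages_before A adv inp T <=
  4 * (m * dg) + d * (2 * (rho + 1) * (4 + (rho + 3) * 4) * m) + n.
Proof.
apply: leq_trans (messages_le T) _; rewrite leq_add2r leq_add2l.
have -> : \sum_(k < L) \sum_(i < rho ^ k.+1) run_cost k.+1 i =
    d * (tsum rho L (sz v) + tsum rho L (sz (~~ v))).
  rewrite -tsumD /tsum big_distrr; apply: eq_bigr => k _; rewrite big_distrr.
  by apply: eq_bigr => i _; rewrite /run_cost /sz; case: v; rewrite // addnC.
rewrite leq_mul2l; apply/orP; right.
apply: leq_trans (leq_add right_senders_total wrong_senders_total) _.
by apply/eq_leq; ring.
Qed.

(** * Agreement, validity and coverage *)

Lemma core_decides (x : 'I_m) : x \in K -> told (st last_round x) = Some v.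
Proof.
move=> xK; have xn := leq_trans (ltn_ord x) mn.
have := core_told first_success_lt first_success_told xK.
have [_ /ltnW lt _] := and3P (flood_atP first_success_lt (leqnn (2 * J + 2))).
by move/(told_later lt); case e : (told _) => [u|] // _; rewrite (told_v xn e).
Qed.

Lemma down_faulty (i : 'I_n) : ~~ up last_round.+1 i -> faulty A adv inp i.
Proof.
move=> nu; have := fun r => clock_down r (ltn_ord i) nu; move: nu.
rewrite /up /faulty /st inord_val; case: (crash_time adv i) => // c _ /(_ c) le.
by rewrite /= -leqNgt.
Qed.

Lemma up_halted (i : 'I_n) : up last_round.+1 i -> halted (@config n A adv inp last_round.+1 i).
Proof. by move=> u; have := clock_up (leqnn _) u; rewrite /st inord_val /= => ->. Qed.

Lemma halts_by_end : all_halted A adv inp last_round.+1.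
Proof. by move=> i; apply: contraR => nh; apply: down_faulty; apply: contra nh; exact: up_halted. Qed.

Lemma decides_verdict (i : 'I_n) u : decides A adv inp i u ->
  up last_round.+1 i /\ verdict (st last_round.+1 i) = Some u.
Proof.
case=> r /=; have := @halted_up r i (ltn_ord i); rewrite /st inord_val.
by case: ifP => // lt /(_ isT)[u' ->].
Qed.

Lemma verdict_decides (i : 'I_n) u : up last_round.+1 i ->
  verdict (st last_round.+1 i) = Some u -> decides A adv inp i u.
Proof.
move=> ui; have := clock_up (leqnn _) ui; rewrite /st inord_val => c e.
by exists last_round.+1; rewrite [output _]/= c ltnSn.
Qed.

Lemma decides_v (i : 'I_n) u : decides A adv inp i u -> u = v.
Proof.
case/decides_verdict=> ui /(verdict_told (ltn_ord i) ui)[y ym].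
by apply: told_v; exact: leq_trans mn.
Qed.

Lemma v_valid : exists j, inp j = v.
Proof.
have [x xK] := K_nonempty; have xn := leq_trans (ltn_ord x) mn.
have := K_v xK; case: v => bx; first by have [j ij] := bit_valid xn bx; exists j.
by exists (inord x); apply: contraFF bx; exact: bit_init.
Qed.

Definition crashed_little : {set 'I_m} := [set x : 'I_m | ~~ up last_round.+1 x].

Definition covered : {set 'I_n} := [set z : 'I_n | in_set K (z %% m) || ~~ up last_round.+1 z].

Lemma covered_decides (i : 'I_n) : i \in covered ->
  faulty A adv inp i \/ exists u, decides A adv inp i u.
Proof.
rewrite inE; case: (boolP (up last_round.+1 i)) => [ui|nu _]; last by left; exact: down_faulty.
have rm : i %% m < m by rewrite ltn_mod.
rewrite orbF (in_setP K rm) => rK; have := core_decides rK; rewrite /= => t.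
right; exists v; apply: verdict_decides => //.
have [im|mi] := ltnP i m; first by rewrite verdict_little // -t modn_small.
by rewrite verdict_outsider // (K_up rK).
Qed.

Hypothesis K_rest : a * #|~: crashed_little :\: K| <= m.
Hypothesis crashed_few : 4 * #|crashed_little| <= m.

(** A class modulo m has at most n/m uncovered nodes if its little node crashed, and one more if it
    survived outside K. With at most m/4 and m/128 such classes, this gives at most n/4 + n/64 <=
    2n/5. *)
Lemma covered_many : 3 * n <= 5 * #|covered|.
Proof.
have K_rest0 := K_rest; set R := ~: crashed_little :\: K in K_rest0.
(* The shift by one skips the crashed little node, which counts as covered. *)
pose f1 (p : 'I_m * 'I_(n %/ m)) : 'I_n := inord (p.1 + p.2.+1 * m).
pose f2 (p : 'I_m * 'I_(n %/ m).+1) : 'I_n := inord (p.1 + p.2 * m).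
have sub : ~: covered \subset (f1 @: setX crashed_little setT) :|: (f2 @: setX R setT).
  apply/subsetP=> z; rewrite !inE negb_or negbK => /andP[zK uz].
  have rm : z %% m < m by rewrite ltn_mod.
  rewrite (in_setP K rm) in zK; have le := leq_div2r m (ltnW (ltn_ord z)).
  have zE : z = z %% m + z %/ m * m :> nat by rewrite addnC -divn_eq.
  case: (boolP (Ordinal rm \in crashed_little)) => cr; apply/orP; [left|right]; last first.
    apply/imsetP; exists (Ordinal rm, Ordinal (le : z %/ m < (n %/ m).+1)).
      by rewrite in_setX in_setT andbT in_setD in_setC zK cr.
    by rewrite /f2 /= -zE inord_val.
  have z0 : 0 < z %/ m.
    rewrite divn_gt0 // leqNgt; apply: contraL cr => zm.
    by rewrite inE /= modn_small // uz.
  have lt : (z %/ m).-1 < n %/ m by rewrite prednK.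
  apply/imsetP; exists (Ordinal rm, Ordinal lt); first by rewrite in_setX in_setT andbT.
  by rewrite /f1 /= prednK // -zE inord_val.
have le : #|~: covered| <= #|crashed_little| * (n %/ m) + #|R| * (n %/ m).+1.
  apply: leq_trans (subset_leq_card sub) _; apply: leq_trans (leq_card_setU _ _).1 _.
  apply: leq_add; apply: leq_trans (leq_imset_card _ _) _; by rewrite cardsX cardsT card_ord.
have c := cardsC covered; rewrite card_ord in c.
have dm : n %/ m * m <= n by exact: leq_trunc_div.
have {}le : m * #|~: covered| <= #|crashed_little| * n + #|R| * (n + m).
  apply: leq_trans (leq_mul (leqnn m) le) _; rewrite mulnDr.
  rewrite mulnCA [m * (#|R| * _)]mulnCA leq_add // leq_mul2l; apply/orP; right.
    by rewrite mulnC.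
  by rewrite mulnS mulnC addnC leq_add2r.
have R128 : 128 * #|R| <= m by apply: leq_trans K_rest0; rewrite leq_mul2r a128 orbT.
have l1 : 4 * #|crashed_little| * n <= m * n by rewrite leq_mul2r crashed_few orbT.
have l2 : 128 * #|R| * (n + m) <= m * (2 * n).
  by rewrite leq_mul // mul2n -addnn leq_add2l.
have : m * (5 * #|~: covered|) <= m * (2 * n).
  set X := #|~: covered| in le *; set Y := #|crashed_little| in le l1 *.
  set W := #|R| in le l2 *; have : m * (2 * n) = 2 * (m * n) by rewrite mulnCA.
  have : m * (5 * X) = 5 * (m * X) by rewrite mulnCA.
  move: le l1 l2; rewrite -!mulnA; lia.
by rewrite leq_pmul2l // => le5; move: c le5; lia.
Qed.

Lemma protocol_correct : ae_agreement A adv inp (3%:R / 5%:R)%R.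
Proof.
split.
- by move=> i nf; exists last_round.+1; exact: halts_by_end.
- move=> i r u /=; case: ifP => // h' e; rewrite /= h'; exact: e.
- exists covered; split; last exact: covered_decides.
  rewrite mulrAC ler_pdivrMr ?ltr0n // -!natrM ler_nat [leqRHS]mulnC; exact: covered_many.
- by move=> i j u w /decides_v -> /decides_v ->.
by move=> i u /decides_v ->; exact: v_valid.
Qed.

End Analysis.

End Protocol.

(** * Existence of the tables *)

(* 0 outside the range of the table *)
Definition table (p q r : nat) (f : {ffun 'I_p * 'I_q -> 'I_r}) (x y : nat) : nat :=
  if (insub x, insub y) is (Some x', Some y') then val (f (x', y')) else 0.

Lemma tableE (p q r : nat) (f : {ffun 'I_p * 'I_q -> 'I_r}) (x : 'I_p) (y : 'I_q) : table f x y = f (x, y).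
Proof. by rewrite /table !valK. Qed.

Lemma joining_table (a m : nat) : 0 < a -> 0 < m ->
  exists g : nat -> nat -> nat, forall A B : {set 'I_m}, m <= a * #|A| -> m <= a * #|B| ->
    exists x y, [/\ x \in A, y \in B & adjacent m (3 * a ^ 2) g x y].
Proof.
move=> a0 m0; have [f fP] := joining_graph a0 m0; exists (table f) => A B mA mB.
have [x [i [xA yB]]] := fP A B mA mB; exists x, (f (x, i)); split=> //.
rewrite /adjacent !ltn_ord /=; apply/existsP; exists i.
by rewrite tableE eqxx.
Qed.

Lemma cnt_card (m : nat) (P : pred nat) : cnt m P = #|[set x : 'I_m | P x]|.
Proof. exact: sum_bool_card. Qed.

Lemma table_deg (p q r : nat) (f : {ffun 'I_p * 'I_q -> 'I_r}) (W : pred nat) (x : 'I_r) :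
  \sum_(y < p) \sum_(a < q) (W y && (table f y a == x)) = fdeg f [set y : 'I_p | W y] x.
Proof.
rewrite pair_bigA /= /fdeg -sum_bool_card; apply: eq_bigr => -[y c] _ /=.
by rewrite tableE inE.
Qed.

Lemma sampler_table (kappa D c h d s : nat) : 128 <= kappa -> 0 < D -> 0 < c ->
  D + 8 + 2 * (c * D * kappa) * D.+1 <= h -> d <= c * h -> 0 < s ->
  exists f : nat -> nat -> nat,
  [/\ forall y a, y < 2 * s -> a < d -> f y a < s,
      forall W : pred nat, cnt (2 * s) W * d * kappa <= h * s ->
        cnt s (fun x => h <= \sum_(y < 2 * s) \sum_(a < d) (W y && (f y a == x))) * D
          <= cnt (2 * s) W &
      forall Y : pred nat, kappa * h * s <= cnt (2 * s) Y * d ->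
        16 * cnt s (fun x => \sum_(y < 2 * s) \sum_(a < d) (Y y && (f y a == x)) < h) <= s].
Proof.
move=> k128 D0 c0 hl dc s0; have [f [fS fA]] := sampler_exists k128 D0 c0 hl dc s0.
exists (table f); rewrite mul2n; split.
- by move=> y z ys zd; have /= -> := tableE f (Ordinal ys) (Ordinal zd).
- move=> W; rewrite !cnt_card => /fS; apply: leq_trans; rewrite leq_mul2r; apply/orP; right.
  by apply/eq_leq/eq_card => x; rewrite !inE table_deg.
move=> Y; rewrite !cnt_card => /fA; apply: leq_trans; rewrite leq_mul2l; apply/orP; right.
by apply/eq_leq/eq_card => x; rewrite !inE table_deg.
Qed.

Lemma hosts_table (q L rho b : nat) (s : nat -> nat) (m := q * 2 ^ L) :
  0 < q -> 0 < rho -> 0 < b -> 36 <= m ->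
  (forall k, k <= L -> s k = q * 2 ^ (L - k)) ->
  ((L * rho ^ L)%:R * (3%:R / 4%:R) ^+ q <= 1 :> rat)%R ->
  exists host : nat -> nat -> nat -> nat,
  [/\ forall i y, host 0 i y = y,
      forall k i y, k <= L -> i < rho ^ k -> y < s k -> host k i y < m,
      forall k i y, k <= L -> i < rho ^ k -> y < s k -> host k i y %/ 2 ^ k = y &
      forall Q : {set 'I_m},
      (4 * #|Q| <= m -> tsum rho L (fun k i =>
        (7 * s k <= 8 * cnt (s k) (fun y => in_set Q (host k i y))) * s k) <= 2 * m) /\
      (4 ^ b * #|Q| <= m -> tsum rho L (fun k i =>
        (1 * s k <= b * cnt (s k) (fun y => in_set Q (host k i y))) * s k) <= 2 * m)].
Proof.
(* Every level is padded to rho^L runs, whence the factor L rho^L in the hypothesis. *)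
move=> q0 rho0 b0 m36 sE UL; pose U := ('I_L * 'I_(rho ^ L))%type.
pose lev (u : U) := u.1.+1.
have levL u : lev u <= L by exact: ltn_ord.
have Uq : (#|{: U}|%:R * (3%:R / 4%:R) ^+ q <= 1 :> rat)%R by rewrite card_prod !card_ord.
have [r rP] := hosts_exist levL q0 b0 m36 Uq.
pose off k i y : nat := if (insub k, insub i, insub y) is (Some k', Some i', Some y')
  then val (r (k', i', y')) else 0.
pose host k i y := if k is k'.+1 then block_host k y (off k' i y) else y.
have mass c e (Q : {set 'I_m}) : tsum rho L (fun k i =>
    (c * s k <= e * cnt (s k) (fun y => in_set Q (host k i y))) * s k)
    <= damaged_mass lev Q c e r.
  pose G (u : U) := if c * (q * 2 ^ (L - lev u)) <= e * bad_hosts lev Q r u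
    then q * 2 ^ (L - lev u) else 0.
  have -> : damaged_mass lev Q c e r = \sum_(k < L) \sum_(i < rho ^ L) G (k, i).
    by rewrite /damaged_mass big_mkcond pair_bigA; apply: eq_bigr => -[].
  apply: leq_sum => k _; have kL := ltn_ord k.
  have le : rho ^ k.+1 <= rho ^ L by rewrite leq_pexp2l.
  rewrite (big_ord_widen _ (fun i => (c * s k.+1 <= e * cnt (s k.+1)
     (fun y => in_set Q (host k.+1 i y))) * s k.+1) le) big_mkcond /=.
  apply: leq_sum => i _; case: ifP => // _; rewrite /G /lev /= sE //.
  suff -> : cnt (q * 2 ^ (L - k.+1)) (fun y => in_set Q (block_host k.+1 y (off k i y))) =
      bad_hosts lev Q r (k, i) by case: ifP; rewrite ?mul1n.
  have sm : q * 2 ^ (L - k.+1) <= m by rewrite leq_mul2l leq_pexp2l ?orbT // leq_subr.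
  rewrite /cnt (big_ord_widen _ (fun y => in_set Q (block_host k.+1 y (off k i y)) : nat) sm).
  rewrite big_mkcond /= /bad_hosts -sum_bool_card; apply: eq_bigr => y _.
  by rewrite /off !valK /lev /=; case: (_ < _).
have offs k i y : off k i y < 2 ^ L.
  by rewrite /off; case: (insub k : option 'I_L) => [?|];
    case: (insub i : option 'I_(rho ^ L)) => [?|]; case: (insub y : option 'I_m) => [?|]; rewrite ?expn_gt0 ?ltn_ord.
have div k i y : 0 < k -> host k i y %/ 2 ^ k = y.
  case: k => // k _; rewrite /host /block_host divnMDl ?expn_gt0 // divn_small ?addn0 //.
  by rewrite ltn_mod expn_gt0.
exists host; split=> // [k i y kL ik ys|k i y kL ik ys|Q].
- have [k0|k0] := posnP k; first by move: ys; rewrite k0 sE // subn0.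
  have mE : m = s k * 2 ^ k by rewrite sE // -mulnA -expnD subnK.
  by rewrite mE -ltn_divLR ?expn_gt0 // div.
- by have [->|k0] := posnP k; [rewrite divn1 | exact: div].
have [H1 H2] := rP Q; split=> [/H1|/H2]; exact: leq_trans (mass _ _ Q).
Qed.

(** * Choice of the parameters *)

(** From 2 * 27 <= 64 follows (4/3)^(9w) >= 8^w >= (w+1)^3. With w = q %/ 9, the left factor is at
    most 128 * 81 (w+1)^2, hence at most (w+1)^3 once w >= 128 * 81. *)
Lemma poly_le_exp : exists q0, forall q, q0 <= q -> 128 * q.+1 ^ 2 * 3 ^ q <= 4 ^ q.
Proof.
have [w0 w0E] : exists w0, w0 = 128 * 81 by exists (128 * 81).
exists (9 * w0) => q le; pose w := q %/ 9.
have w0w : w0 <= w by rewrite leq_divRL // mulnC.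
have qw : 9 * w <= q < 9 * w.+1 by rewrite mulnC leq_trunc_div mulnC ltn_ceil.
have pow : 2 ^ (3 * w) * 3 ^ (9 * w) <= 4 ^ (9 * w).
  rewrite (_ : 9 * w = 3 * (3 * w)); last by rewrite mulnA.
  by rewrite ![_ ^ (3 * (3 * w))]expnM -expnMn; case: (3 * w) => // j; rewrite leq_exp2r.
have w2 : w.+1 ^ 3 <= 2 ^ (3 * w) by rewrite mulnC expnM leq_exp2r // ltn_expl.
case/andP: qw => qw1 qw2.
have poly : 128 * q.+1 ^ 2 <= w.+1 ^ 3.
  apply: (@leq_trans (128 * (9 * w.+1) ^ 2)); first by rewrite leq_mul2l leq_exp2r ?orbT.
  rewrite expnMn mulnA [w.+1 ^ 3]expnS leq_mul2r; apply/orP; right.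
  rewrite (_ : 128 * 9 ^ 2 = w0); [exact: leqW | rewrite w0E; congr muln].
rewrite -(subnKC qw1) (expnD 3) (expnD 4) mulnA.
apply: leq_mul; last by case: (q - 9 * w) => // j; rewrite leq_exp2r.
rewrite subnKC //; apply: leq_trans pow; rewrite leq_mul2r (leq_trans poly w2) orbT //.
Qed.

(** The order of choice avoids circularity: [kappa], [D], [c], then the least threshold [h0], which
    determines [d], [b] and [a]. Sixteen thresholds with ratio kappa^2 stay within a factor kappa^30
    of [h0]. *)
Lemma parameters : exists (kappa D e d b a c : nat) (h : nat -> nat),
  [/\ 128 <= kappa, 32 <= D, D = 2 ^ e & 0 < c] /\
  [/\ forall i, 0 < h i,
      forall i, D + 8 + 2 * (c * D * kappa) * D.+1 <= h i,
      forall i, d <= c * h i,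
      forall i j, i < 16 -> j < 16 -> 2 * h i <= D * h j &
      forall i j, i < j -> j < 16 -> kappa * kappa * h i <= h j] /\
  [/\ forall i, i < 16 -> 16 * kappa * h i <= d, 2 * d * kappa <= b, 4 ^ b <= a, 128 <= a & 0 < b].
Proof.
have [kappa k128] : exists kappa, 128 <= kappa by exists 128.
have k0 : 0 < kappa by apply: leq_trans k128.
(* As a power of two, D gives D^L = 2^(eL) and thus a bound on the flooding time; D > e exceeds
   twice the ratio of any two thresholds. *)
pose e := 32 + 2 * kappa ^ 30; pose D := 2 ^ e.
have eD : e < D by exact: ltn_expl.
(* Then [c * h0], the later [d], is 16 kappa times the bound h0 kappa^30 on the thresholds. *)
have [c cE] : exists c, c = 16 * kappa * kappa ^ 30 by exists (16 * kappa * kappa ^ 30).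
have k30 : 0 < kappa ^ 30 by rewrite expn_gt0 k0.
have c0 : 0 < c by rewrite cE muln_gt0 k30 andbT muln_gt0 k0.
have [h0 h0E] : exists h0, h0 = D + 8 + 2 * (c * D * kappa) * D.+1
  by exists (D + 8 + 2 * (c * D * kappa) * D.+1).
have h00 : 0 < h0 by rewrite h0E; case: (D) eD.
pose h i := h0 * kappa ^ (2 * i).
have hh i : h0 <= h i by rewrite leq_pmulr // expn_gt0 k0.
have top i : i < 16 -> h i <= h0 * kappa ^ 30.
  by move=> i16; rewrite leq_mul2l leq_pexp2l ?orbT //; lia.
pose d := c * h0; pose b := 2 * d * kappa.
exists kappa, D, e, d, b, (4 ^ b + 128), c, h; do !split => //.
- by apply: leq_trans (ltnW eD); rewrite leq_addr.
- by move=> i; apply: leq_trans (hh i).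
- by move=> i; rewrite -h0E.
- by move=> i; rewrite leq_mul2l hh orbT.
- move=> i j i16 _; apply: (@leq_trans (D * h0)); last by rewrite leq_mul2l hh orbT.
  apply: (@leq_trans (2 * kappa ^ 30 * h0)).
    by rewrite -mulnA leq_mul2l [_ * h0]mulnC top.
  by rewrite leq_mul2r (leq_trans _ (ltnW eD)) ?orbT // leq_addl.
- move=> i j ij _; rewrite /h mulnCA leq_mul2l mulnn -expnD leq_pexp2l ?orbT //; lia.
- move=> i i16; rewrite /d cE -[_ * kappa ^ 30 * h0]mulnA leq_mul2l [kappa ^ 30 * _]mulnC top //.
  by rewrite orbT.
- by rewrite leq_addr.
- by rewrite leq_addl.
by rewrite /b /d !muln_gt0 c0 h00 k0.
Qed.

Lemma large_crashes : exists t0 C, 0 < t0 /\ forall n t, t0 <= t -> 5 * t < n ->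
  exists A : algorithm n, [/\ solves_aea (3%:R / 5%:R)%R t A, runs_within t A (C * t)
    & sends_at_most t A (C * n)].
Proof.
have [kappa [D [e [d [b [a [c [h [[k128 D32 De c0] [[h0 h_min d_ch D_h h_step] [d_large b_large a_large a128 b0]]]]]]]]]]] := parameters.
have [q0 q0P] := poly_le_exp.
have [rho rhoE] : exists rho, rho = 16 by exists 16.
have rho16 : 16 <= rho by rewrite rhoE.
have rho0 : 0 < rho by apply: leq_trans rho16.
have D_rho : 2 * rho <= D by rewrite rhoE.
rewrite -rhoE in D_h h_step.
have {}d_large i : i < rho -> 16 * kappa * h i <= d by rewrite rhoE; exact: d_large.
have a0 : 0 < a by apply: leq_trans a128.
have D0 : 0 < D by apply: leq_trans D32.
have D1 : 1 < D by apply: leq_trans D32.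
pose q1 := q0 + 100; pose C1 := 7 + 192 * (2 * e + 4).
pose dg := 3 * a ^ 2; pose C2 := 4 * dg + d * (2 * (rho + 1) * (4 + (rho + 3) * 4)) + 1.
exists (4 * q1.+1 ^ 2), (C1 + C2); split; first by rewrite muln_gt0 expn_gt0.
move=> n t t0 tn; pose M := 5 * t + 1; pose L := up_log D M.
have t1 : 0 < t by apply: leq_trans t0; rewrite muln_gt0 expn_gt0.
have M1 : 1 < M by rewrite /M; lia.
have Mn : M <= n by rewrite /M addn1.
have L0 : 0 < L by rewrite up_log_gt0 D1.
have /andP[DM MD] : D ^ L.-1 < M <= D ^ L by exact: up_log_bounds.
(* Rounding M down to a multiple of 2^L lets the sizes halve exactly at all L levels. *)
pose q := M %/ 2 ^ L; pose m := q * 2 ^ L; pose s k := q * 2 ^ (L - k).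
have mM : m <= M by exact: leq_trunc_div.
have Mq : M < q.+1 * 2 ^ L by apply: ltn_ceil; rewrite expn_gt0.
have le_pow i j : i <= j -> i ^ L.-1 <= j ^ L.-1 by case: (L.-1) => // k; rewrite leq_exp2r.
(* Since 4^(L-1) <= D^(L-1) < M, q is at least of order sqrt M, and so it exceeds any constant for
   large t. *)
have L2 : (2 ^ L) ^ 2 < 4 * M.
  rewrite -expnM mulnC expnM -[in leqLHS](prednK L0) expnS ltn_mul2l /=.
  by apply: leq_ltn_trans DM; apply: le_pow; apply: leq_trans D32.
have Msmall j : M < j * 2 ^ L -> M < 4 * j ^ 2.
  move=> lt; have M0 : 0 < M by apply: ltnW.
  have : M * M < j ^ 2 * (4 * M).
    apply: (@leq_trans ((j * 2 ^ L) ^ 2)); first by rewrite -mulnn ltn_mul.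
    by rewrite expnMn leq_mul2l ltnW ?orbT.
  by rewrite mulnA ltn_mul2r M0 mulnC.
have qq : q1 <= q.
  rewrite leqNgt; apply/negP => lt; have := Msmall _ Mq; apply/negP; rewrite -leqNgt.
  apply: leq_trans (leq_trans t0 _); last by rewrite /M; lia.
  by rewrite leq_mul2l leq_exp2r ?orbT //; exact: ltnW.
have q100 : 100 <= q by apply: leq_trans qq; rewrite leq_addl.
have q_0 : 0 < q by apply: leq_trans q100.
have p0 k : 0 < 2 ^ k by rewrite expn_gt0.
have qm : 100 * 2 ^ L <= m by rewrite leq_mul2r q100 orbT.
have m100 : 100 <= m by apply: leq_trans q100 _; rewrite leq_pmulr.
have m0 : 0 < m by apply: leq_trans m100.
(* 2^L 16^L = 32^L <= 32 D^(L-1) < 32 M; here D >= 32 makes the total time linear in t. *)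
have L32 : L * rho ^ L <= 32 * M.
  rewrite rhoE; apply: (@leq_trans (2 ^ L * 16 ^ L)); first by rewrite leq_mul2r (ltnW (ltn_expl _ _)) ?orbT.
  rewrite -expnMn -[in leqLHS](prednK L0) expnS leq_mul2l; apply: ltnW.
  by apply: leq_ltn_trans DM; exact: le_pow.
(* By [Msmall], 32 M is at most 128 (q+1)^2, which [poly_le_exp] compares with (4/3)^q. *)
have UL : ((L * rho ^ L)%:R * (3%:R / 4%:R) ^+ q <= 1 :> rat)%R.
  rewrite expr_div_n mulrA ler_pdivrMr ?exprn_gt0 ?ltr0n // mul1r -!natrX -natrM ler_nat.
  apply: leq_trans (q0P q (leq_trans (leq_addr _ _) qq)); rewrite leq_mul2r; apply/orP; right.
  by have := Msmall _ Mq; move: L32; rewrite -/(q.+1 ^ 2); lia.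
have mE : s 0 = m by rewrite /s subn0.
have s_half k : k < L -> s k = 2 * s k.+1.
  by move=> kL; rewrite /s -(subnSK kL) expnS mulnCA.
have s_pos k : 0 < s k by rewrite muln_gt0 q_0 p0.
have m36 : 36 <= m by apply: leq_trans m100.
have [host [host0 host_lt host_block spread]] :=
  @hosts_table q L rho b s q_0 rho0 b0 m36 (fun k _ => erefl) UL.
have [g joined] := joining_table a0 m0.
have outs k i := sampler_table k128 D0 c0 (h_min i) (d_ch i) (s_pos k).
pose out k i := proj1_sig (constructive_indefinite_description _ (outs k i)).
have outP k i := proj2_sig (constructive_indefinite_description _ (outs k i)).
rewrite -/(out _ _) in outP.
have s_pred k : 0 < k -> k <= L -> s k.-1 = 2 * s k by case: k => // k _; exact: s_half.
have out_lt k i y z : 0 < k -> k <= L -> i < rho -> y < s k.-1 -> z < d -> out k i y z < s k.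
  by move=> k0 kL _; rewrite s_pred //; case: (outP k i) => H _ _; exact: H.
pose J := e * L.
have MJ : M <= 2 ^ J by rewrite expnM -De.
have nE : n = n.-1.+1 by rewrite prednK // (leq_trans _ tn).
move: n tn Mn nE => [//|n'] tn Mn _.
have mn : m <= n'.+1 by exact: leq_trans Mn.
pose len := 2 * J + 3; exists (protocol m L rho d len dg s h host out g n').
(* With M <= 6t, the first flood and the last round take m + 1 <= 7t rounds, and the epochs at most
   32 (2e + 4) M <= 192 (2e + 4) t. *)
have late : (last_round m L rho len).+1 <= (C1 + C2) * t.
  apply: (@leq_trans (C1 * t)); last by rewrite leq_mul2r leq_addr orbT.
  rewrite /last_round /epoch_length /len /J.
  have : rho ^ L * (L + (2 * (e * L) + 3)) <= (2 * e + 4) * (L * rho ^ L).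
    rewrite [leqRHS]mulnA [leqRHS]mulnC leq_mul2l; apply/orP; right.
    by rewrite mulnDl -mulnA; lia.
  have : (2 * e + 4) * (L * rho ^ L) <= (2 * e + 4) * (32 * M) by rewrite leq_mul2l L32 orbT.
  rewrite /C1; move: mM; rewrite /M; set x := _ ^ L * _; set y := _ * (L * _); set z := 2 * e + 4.
  nia.
suff main (adv : adversary n'.+1) : #|crash_set adv| <= t ->
    exists K : {set 'I_m},
    [/\ expanding a (fun y z : 'I_m => adjacent m dg g y z) K,
        4 * #|~: K| <= m,
        forall y : 'I_m, y \in K -> up adv (last_round m L rho len).+1 y,
        a * #|~: crashed_little m L rho len adv :\: K| <= m &
        4 * #|crashed_little m L rho len adv| <= m].
  have shrink k i (W : pred nat) : 0 < k -> k <= L -> i < rho ->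
      cnt (s k.-1) W * d * kappa <= h i * s k ->
      cnt (s k) (fun y => h i <= deg d s out k i W y) * D <= cnt (s k.-1) W.
    by move=> k0 kL _; rewrite /deg s_pred //; case: (outP k i) => _ H _; exact: H.
  have amplify k i (Y : pred nat) : 0 < k -> k <= L -> i < rho ->
      kappa * h i * s k <= cnt (s k.-1) Y * d ->
      16 * cnt (s k) (fun y => deg d s out k i Y y < h i) <= s k.
    by move=> k0 kL _; rewrite /deg s_pred //; case: (outP k i) => _ _ H; exact: H.
  have D_depth : m <= D ^ L * a by apply: leq_trans mM (leq_trans MD _); rewrite leq_pmulr.
  split=> adv x few; have [K [K_exp K_large K_up K_rest Z_few]] := main adv few.
  - exact (@protocol_correct m L rho d len dg s h host out g n' adv x m0 mn rho0 L0 mE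
      host0 host_lt host_block out_lt h0 kappa D a b J K rho16 D_rho d_large b_large a_large a128
      D_depth s_half (leq_trans mM MJ) erefl shrink amplify spread joined K_exp K_large K_up
      K_rest Z_few).
  - by exists (last_round m L rho len).+1 => // i; exact: halts_by_end.
  move=> T; apply: leq_trans (@messages_bound m L rho d len dg s h host out g n' adv x m0 mn
    rho0 L0 mE host0 host_lt host_block h0 kappa D a b J K rho16 D_rho D_h h_step d_large b_large
    a_large a128 D_depth s_half (leq_trans mM MJ) erefl shrink amplify spread joined
    K_exp K_large K_up T) _.
  apply: (@leq_trans (C2 * n'.+1)); last by rewrite leq_mul2r leq_addl orbT.
  rewrite /C2; set Y := 2 * _ * _; rewrite 2!(mulnDl _ _ n'.+1) mul1n leq_add2r; apply: leq_add.
    by rewrite -mulnA leq_mul2l [m * _]mulnC leq_mul2l mn !orbT.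
  by rewrite -mulnA !leq_mul2l mn !orbT.
(* As m > 5t + 1 - 2^L and 2^L <= m/100, the t crashed nodes and m/128 others are at most a quarter
   of the little nodes. *)
have bound : 4 * t + 4 * (m %/ 128) <= m /\ 4 * t <= m.
  have : 128 * (m %/ 128) <= m by rewrite mulnC leq_trunc_div.
  by move: Mq qm; rewrite mulSn -/m /M; move: (2 ^ L) (m %/ 128) => y z; lia.
set Z := crashed_little _ _ _ _ _ => few.
have Zt : #|Z| <= t.
  apply: leq_trans few; pose f (y : 'I_m) : 'I_n'.+1 := inord y.
  have f_inj : injective f.
    move=> y z e'; apply/val_inj; have := congr1 val e'.
    by rewrite /= !inordK // (leq_trans (ltn_ord _) mn).
  rewrite -(card_imset _ f_inj); apply: subset_leq_card; apply/subsetP=> _ /imsetP[y yZ ->].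
  by move: yZ; rewrite !inE /up -/(f y); case: (crash_time adv (f y)).
have Zm : 4 * #|Z| <= m by case: bound => _; apply: leq_trans; rewrite leq_mul2l Zt.
have a7 : 7 <= a by apply: leq_trans a128.
have [K [KZ K_rest K_exp]] := expanding_core joined a7 Zm.
exists K; split=> //.
  have : #|~: K| <= #|Z| + #|~: Z :\: K|.
    apply: leq_trans (leq_card_setU _ _).1; apply: subset_leq_card; apply/subsetP=> y.
    by rewrite !inE => ->; case: (up _ _ _).
  have : #|~: Z :\: K| <= m %/ 128.
    by rewrite leq_divRL // mulnC; apply: leq_trans K_rest; rewrite leq_mul2r a128 orbT.
  by case: bound => l1 l2 l3 l4; lia.
move=> y yK; have := disjointFr KZ yK; rewrite inE; by case: (up _ _ _).
Qed.

(** * Few crashes *)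

Section Rotating.

Variables (n' t : nat).
Notation n := n'.+1.

(* Name, clock and current value; in round k the node of name k broadcasts. *)
Definition rotating : algorithm n := {|
  state := nat * nat * bool;
  init := fun i b => (val i, 0, b);
  send := fun st _ => if (st.1.2 == st.1.1) && (st.1.2 <= t) then Some st.2 else None;
  recv := fun st f =>
    (st.1.1, st.1.2.+1, if f (inord st.1.2) is Some b then b else st.2);
  output := fun st => if t < st.1.2 then Some st.2 else None;
  halted := fun st => t < st.1.2
|}.

Variables (adv : adversary n) (inp : 'I_n -> bool).
Hypothesis tn : t < n.
Hypothesis few : #|crash_set adv| <= t.

Let cfg r (i : 'I_n) : nat * nat * bool := @config n rotating adv inp r i.
Let msg r i j := @message n rotating adv (@config n rotating adv inp r) r i j.

Definition alive r (i : 'I_n) : bool :=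
  if crash_time adv i is Some c then r <= c else true.

Lemma alive_le r r' i : r <= r' -> alive r' i -> alive r i.
Proof. by rewrite /alive; case: crash_time => // c; apply: leq_trans. Qed.

Lemma crashed_alive r i : crashed_by adv r i = ~~ alive r.+1 i.
Proof. by rewrite /crashed_by /alive; case: crash_time => // c; rewrite -leqNgt. Qed.

Lemma cfgS r i : cfg r.+1 i = if (t < (cfg r i).1.2) || ~~ alive r.+1 i then cfg r i else
  ((cfg r i).1.1, (cfg r i).1.2.+1,
    if msg r (inord (cfg r i).1.2) i is Some b then b else (cfg r i).2).
Proof. by rewrite {1}/cfg /= crashed_alive ffunE. Qed.

Lemma cfg_name r i : (cfg r i).1.1 = i.
Proof. by elim: r => [//|r IH]; rewrite cfgS; case: ifP. Qed.

Lemma cfg_clock_le r i : (cfg r i).1.2 <= r.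
Proof. by elim: r => [//|r IH]; rewrite cfgS; case: ifP => // _; exact: leqW. Qed.

Lemma cfg_clock r i : r <= t.+1 -> alive r i -> (cfg r i).1.2 = r.
Proof.
elim: r => [//|r IH] rt ai; have c := IH (ltnW rt) (alive_le (leqnSn r) ai).
by rewrite cfgS c ai ltnNge -ltnS rt.
Qed.

Lemma cfg_step r i : r <= t -> alive r.+1 i -> (cfg r.+1 i).2 =
  if msg r (inord r) i is Some b then b else (cfg r i).2.
Proof.
move=> rt ai; have c := cfg_clock (leqW rt) (alive_le (leqnSn r) ai).
by rewrite cfgS c ai ltnNge rt.
Qed.

Lemma cfg_end r i : t < r -> cfg r i = cfg t.+1 i.
Proof.
elim: r => [|r IH] // /[!ltnS]; rewrite leq_eqVlt => /orP[/eqP->//|lt].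
rewrite cfgS IH //; case: (boolP (alive t.+1 i)) => [ai|di].
  by rewrite cfg_clock // ltnSn.
by rewrite (contra _ di) ?orbT //; apply: alive_le; exact: ltnW.
Qed.

Lemma dead_clock r i : ~~ alive t.+1 i -> (cfg r i).1.2 <= t.
Proof.
move=> di; elim: r => [//|r IH]; have [rt|tr] := ltnP r t; last first.
  by rewrite cfgS (contra _ di) ?orbT //; exact: alive_le.
exact: leq_trans (cfg_clock_le r.+1 i) rt.
Qed.

Lemma dead_faulty i : ~~ alive t.+1 i -> faulty rotating adv inp i.
Proof.
move=> di; have := fun r => dead_clock r di; move: di.
rewrite /alive /faulty; case: (crash_time adv i) => // c _ /(_ c) le.
by rewrite /= -leqNgt.
Qed.

Lemma msg_some r i j b : msg r i j = Some b ->
  [/\ r <= t, i = r :> nat, alive r i & b = (cfg r i).2].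
Proof.
rewrite /msg /message /=; set s := (if _ then None else _).
have sP : s = Some b -> [/\ (cfg r i).1.2 <= t, (cfg r i).1.2 = i & b = (cfg r i).2].
  by rewrite /s -/(cfg r i) cfg_name; case: ifP => // _; case: ifP => // /andP[/eqP-> ->] [->].
clearbody s => e; have [ai {}e] : alive r i /\ s = Some b.
  move: e; rewrite /alive; case: crash_time => [c|] //.
  by case: ltngtP => //= _; case: ifP.
have [le ci ->] := sP e; have [rt|tr] := ltnP t r; last first.
  by rewrite cfg_clock ?(leqW tr) // in ci.
have := le; rewrite cfg_end // leqNgt; case: (boolP (alive t.+1 i)) => [ai'|/negP[]].
  by rewrite cfg_clock // ltnSn.
exact: alive_le rt ai.
Qed.

Lemma msg_sent (i j : 'I_n) : i <= t -> alive i.+1 i -> i != j -> msg i i j = Some (cfg i i).2.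
Proof.
move=> it ai ij; rewrite /msg /message /= -/(cfg i i) cfg_name.
have c := cfg_clock (leqW it) (alive_le (leqnSn i) ai).
rewrite c ltnNge it (negbTE ij) eqxx /=; move: ai.
by rewrite /alive; case: crash_time => // e ->.
Qed.

Lemma correct_coordinator : exists2 i : 'I_n, i <= t & crash_time adv i = None.
Proof.
pose f (k : 'I_t.+1) : 'I_n := widen_ord tn k.
have f_inj : injective f by move=> k l e; apply/val_inj; exact: (congr1 val e).
have [sub|] := boolP (f @: setT \subset crash_set adv).
  have := leq_trans (subset_leq_card sub) few.
  by rewrite card_imset // cardsT card_ord ltnn.
case/subsetPn=> _ /imsetP[k _ ->]; rewrite inE; case e : crash_time => // _.
by exists (f k) => //=; rewrite -ltnS.
Qed.

Lemma common_value : exists v, forall i, alive t.+1 i -> (cfg t.+1 i).2 = v.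
Proof.
have [k kt kc] := correct_coordinator; exists (cfg k k).2.
have ak r : alive r k by rewrite /alive kc.
(* After round k all surviving nodes hold the value of node k, and later coordinators can only
   repeat it. *)
suff H j : k.+1 + j <= t.+1 -> forall i, alive (k.+1 + j) i -> (cfg (k.+1 + j) i).2 = (cfg k k).2.
  by have := H (t - k); rewrite addSn subnKC // => /(_ (leqnn _)).
elim: j => [|j IH] jt i.
  rewrite addn0 => ai; rewrite cfg_step // inord_val.
  have [<-|ki] := eqVneq k i; last by rewrite msg_sent.
  by case e : msg => [b|] //; have [_ _ _ ->] := msg_some e.
rewrite addnS => ai; rewrite cfg_step //; last by rewrite -ltnS -addnS.
have le : k.+1 + j <= t.+1 by apply: leq_trans jt; rewrite leq_add2l.
case e : msg => [b|]; last by apply: IH => //; exact: alive_le ai.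
by have [_ _ al ->] := msg_some e; exact: IH.
Qed.

Lemma value_input r i : exists j, inp j = (cfg r i).2.
Proof.
elim: r i => [|r IH] i; first by exists i.
rewrite cfgS; case: ifP => // _ /=; case e : msg => [b|] //.
by have [_ _ _ ->] := msg_some e.
Qed.

Lemma rotating_decides i v : decides rotating adv inp i v ->
  alive t.+1 i /\ (cfg t.+1 i).2 = v.
Proof.
case=> r; rewrite [output _]/= -/(cfg r i); case: ifP => // c [e].
have tr : t < r := leq_trans c (cfg_clock_le r i).
split; last by rewrite -(cfg_end i tr).
by apply: contraLR c => /(dead_clock r); rewrite -leqNgt.
Qed.

Lemma rotating_halts : all_halted rotating adv inp t.+1.
Proof.
move=> i; apply: contraR => nh; apply: dead_faulty; apply: contra nh => ai.
by suff : t < (cfg t.+1 i).1.2 by []; rewrite cfg_clock.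
Qed.

Lemma rotating_correct : ae_agreement rotating adv inp (3%:R / 5%:R)%R.
Proof.
split.
- by move=> i nf; exists t.+1; exact: rotating_halts.
- by move=> i r u /=; case: ifP => // h' e; rewrite /= h'.
- exists setT; split.
    by rewrite cardsT card_ord; apply: ler_piMl; [exact: ler0n | lra].
  move=> i _; case: (boolP (alive t.+1 i)) => [ai|]; last by left; exact: dead_faulty.
  right; exists (cfg t.+1 i).2, t.+1.
  rewrite (_ : output _ = if t < (cfg t.+1 i).1.2 then Some (cfg t.+1 i).2 else None) //.
  by rewrite cfg_clock // ltnSn.
- have [v vP] := common_value.
  by move=> i j u w /rotating_decides[/vP -> <-] /rotating_decides[/vP -> <-].
by move=> i u /rotating_decides[_ <-]; exact: value_input.
Qed.

Lemma rotating_messages T : messages_before rotating adv inp T <= t.+1 * n.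
Proof.
apply: (@leq_trans (\sum_(r < T) (r <= t) * n)).
  apply: leq_sum => r _; apply: (@leq_trans #|[set ((inord r : 'I_n), j) | j in 'I_n & (r <= t)]|).
    apply: subset_leq_card; apply/subsetP=> -[i j]; rewrite inE /=.
    case e : (message _ _ _ _) => [b|] // _; have [rt ir _ _] := msg_some e.
    by apply/imsetP; exists j; rewrite ?inE // -ir inord_val.
  case: (r <= t); last by rewrite (_ : [set _ | _ in _ & _] = set0) ?cards0 //;
    apply/setP=> p; rewrite inE; apply/negP=> /imsetP[j]; rewrite inE andbF.
  by rewrite mul1n; apply: leq_trans (leq_imset_card _ _) _; rewrite -[leqRHS]card_ord max_card.
rewrite -big_distrl leq_mul2r /=.
suff -> : \sum_(r < T) (r <= t) = minn T t.+1 by exact: geq_minr.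
by elim: T => [|T IH]; [rewrite big_ord0 | rewrite big_ord_recr /= IH; case: leqP; lia].
Qed.

End Rotating.

Theorem theorem5 :
  exists (A : forall n t : nat, algorithm n) (C : nat),
    forall n t : nat,
      (t%:R < n%:R / 5%:R :> rat)%R ->
      [/\ solves_aea (3%:R / 5%:R)%R t (A n t),
          runs_within t (A n t) (C * maxn 1 t)
        & sends_at_most t (A n t) (C * n)].
Proof.
have [t0 [C [t0_gt0 large]]] := large_crashes.
have small n t : t < t0 -> 5 * t < n -> exists A : algorithm n,
    [/\ solves_aea (3%:R / 5%:R)%R t A, runs_within t A t.+1 & sends_at_most t A (t.+1 * n)].
  case: n => [|n'] // _ tn; have {}tn : t < n'.+1 by lia.
  exists (rotating n' t); split=> adv x few.
  - exact: rotating_correct.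
  - by exists t.+1 => //; exact: rotating_halts.
  exact: rotating_messages.
have solvable n t : exists A : algorithm n, (t%:R < n%:R / 5%:R :> rat)%R ->
    [/\ solves_aea (3%:R / 5%:R)%R t A, runs_within t A ((C + t0.+2) * maxn 1 t)
      & sends_at_most t A ((C + t0.+2) * n)].
  (* Where t < n/5 fails nothing is claimed, and a trivial algorithm completes the family. *)
  have [lt|ge] := boolP (t%:R < n%:R / 5%:R :> rat)%R; last first.
    by exists (@Algorithm n unit (fun _ _ => tt) (fun _ _ => None) (fun _ _ => tt)
      (fun _ => None) (fun _ => true)).
  have tn : 5 * t < n by move: lt; rewrite ltr_pdivlMr ?ltr0n // -natrM ltr_nat mulnC.
  have [tt0|t0t] := ltnP t t0.
    have [A [cor time msgs]] := small n t tt0 tn; exists A; split=> // adv x few.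
      have [r rt h] := time adv x few; exists r => //; apply: leq_trans rt _.
      apply: (@leq_trans (2 * maxn 1 t)); first by lia.
      by rewrite leq_mul2r; apply/orP; right; lia.
    move=> T; apply: leq_trans (msgs adv x few T) _; rewrite leq_mul2r; apply/orP; right; lia.
  have [A [cor time msgs]] := large n t t0t tn; exists A; split=> // adv x few.
    have [r rt h] := time adv x few; exists r => //; apply: leq_trans rt _.
    by apply: leq_mul; [rewrite leq_addr | rewrite leq_maxr].
  move=> T; apply: leq_trans (msgs adv x few T) _; by rewrite leq_mul2r leq_addr orbT.
exists (fun n t => proj1_sig (constructive_indefinite_description _ (solvable n t))), (C + t0.+2).
by move=> n t; exact: (proj2_sig (constructive_indefinite_description _ (solvable n t))).
Qed.
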